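(* There exists $s_0\in(0,1)$, depending only on the dimension $n$, such that for all $s\in(0,s_0)$ and every rearrangement invariant space $X=X(Q_0)$ we have $$GaRo_X=\{f\in L^1(Q_0):\ \|M^{\#}_{s,Q_0}f\|_X<\infty\}.$$ Moreover, $\|f\|_{GaRo_X}\simeq\|M^{\#}_{s,Q_0}f\|_X$, with constants of equivalence depending only on $n$ and $s$ (in particular independent of $f$ and $X$).
   Context: $Q_0\subset\mathbb R^n$ is a fixed cube with $|Q_0|=1$; all cubes have sides parallel to the coordinate axes. $P=P(Q_0)$ is the set of all countable (possibly finite) families $\{Q_i\}$ of subcubes of $Q_0$ with pairwise disjoint interiors. Rearrangement invariant (r.i.) space $X$ on $Q_0$: a Banach function space on $(Q_0,dx)$ which is either separable or has the Fatou property ($0\le f_n\uparrow f\in X$ implies $\|f_n\|_X\uparrow\|f\|_X$), such that $g\in X$ and $f^*=g^*$ imply $f\in X$ and $\|f\|_X=\|g\|_X$, where $f^*$ denotes the decreasing rearrangement of $|f|$. One has $L^\infty\subset X\subset L^1$ with continuous embeddings. Convention: $\|g\|_X=\infty$ if $g\notin X$. For $f\in L^1(Q_0)$, $\Gamma_f$ is the class of integrable functions $\gamma$ on $Q_0$ such that for all $\{Q_i\}\in P$ $$\sum_i\frac1{|Q_i|}\int_{Q_i}\int_{Q_i}|f(x)-f(y)|\,dx\,dy\le\sum_i\int_{Q_i}\gamma(x)\,dx .$$ $\|f\|_{GaRo_X}=\inf\{\|\gamma\|_X:\gamma\in\Gamma_f\}$ (equal to $\infty$ if $\Gamma_f=\varnothing$),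 and $GaRo_X=\{f\in L^1(Q_0):\|f\|_{GaRo_X}<\infty\}$. For $s\in(0,1)$ and $x\in Q_0$, $$M^{\#}_{s,Q_0}f(x)=\sup_{Q\ni x,\ Q\subset Q_0}\ \inf_{c\in\mathbb R}\ \inf\{\alpha\ge0:\ |\{y\in Q:|f(y)-c|>\alpha\}|<s|Q|\},$$ the supremum being over all cubes $Q\subset Q_0$ containing $x$. $F\simeq G$ means $c_1G\le F\le c_2G$ for some constants $c_1,c_2>0$.
   Formalization: The Fatou property is taken in its standard form: 0≤f_n↑f for any measurable f, with ‖f‖_X=∞ if f∉X, so bounded norms force f∈X; with f∈X assumed, as the text writes it, the claim fails for some non-separable X. *)

(* Defs.v *)
From HB Require Import structures.
From mathcomp Require Import all_boot all_order all_algebra.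
From mathcomp Require Import all_classical all_reals all_analysis.

Set Implicit Arguments.
Unset Strict Implicit.
Unset Printing Implicit Defensive.
Import Order.TTheory GRing.Theory Num.Theory.
Import numFieldNormedType.Exports.
Local Open Scope classical_set_scope.
Local Open Scope ring_scope.

Section lebesgue_tupleS.
Context {R : realType} (n : nat).
Local Notation RB := (measurableTypeR R).

Definition consT (p : RB * n.-tuple RB) : n.+1.-tuple RB :=
  [tuple of p.1 :: p.2].

Lemma measurable_consT : measurable_fun setT consT.
Proof. exact: measurable_cons. Qed.

Variable mu : {sigma_finite_measure set (n.-tuple RB) -> \bar R}.

Definition lebesgue_tupleS : set (n.+1.-tuple RB) -> \bar R :=
  pushforward (@lebesgue_measure R \x mu)%E consT.

Let mS : {measure set (n.+1.-tuple RB) -> \bar R} :=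
  measure_function_pushforward__canonical__measure_function_Measure
    (@lebesgue_measure R \x mu)%E measurable_consT.

HB.instance Definition _ := Measure.copy lebesgue_tupleS mS.

Let lebesgue_tupleS_sigma_finite : sigma_finite setT lebesgue_tupleS.
Proof.
have /sigma_finiteP[F [TF ndF Foo]] := sigma_finiteT (@lebesgue_measure R).
have /sigma_finiteP[G [TG ndG Goo]] := sigma_finiteT mu.
pose split (t : n.+1.-tuple RB) := (thead t, [tuple of behead t]).
have msplit : measurable_fun setT split.
  apply: measurable_fun_pair => /=; last exact: measurable_behead.
  exact: measurable_tnth.
exists (fun i => split @^-1` (F i `*` G i)).
  apply/esym/seteqP; split => // t _.
  have [i _ Fi] : (\bigcup_i F i) (split t).1 by rewrite -TF.
  have [j _ Gj] : (\bigcup_i G i) (split t).2 by rewrite -TG.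
  exists (maxn i j) => //; split.
  - by move: Fi; exact/subsetPset/ndF/leq_maxl.
  - by move: Gj; exact/subsetPset/ndG/leq_maxr.
move=> i; have [mF Fi] := Foo i; have [mG Gi] := Goo i; split.
  by rewrite -[X in measurable X]setTI; apply: msplit => //; exact: measurableX.
rewrite /lebesgue_tupleS /pushforward.
have consTK : cancel consT split.
  by move=> [x t]; congr pair => //; exact/val_inj.
have -> : consT @^-1` (split @^-1` (F i `*` G i)) = F i `*` G i.
  by rewrite -comp_preimage (_ : split \o consT = id) ?preimage_id;
    last exact/funext.
by rewrite product_measure1E// lte_mul_pinfty// ge0_fin_numE.
Qed.

HB.instance Definition _ := Measure_isSigmaFinite.Build _ _ _ lebesgue_tupleS
  lebesgue_tupleS_sigma_finite.

End lebesgue_tupleS.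

Fixpoint lebesgue_tuple {R : realType} (n : nat) :
    {sigma_finite_measure set (n.-tuple (measurableTypeR R)) -> \bar R} :=
  match n with
  | 0 => \d_[tuple]
  | n.+1 => lebesgue_tupleS (lebesgue_tuple n)
  end.

(* R^n carries the sigma-algebra of Lebesgue (not only Borel) measurable sets:
   the sharp maximal function below need not be Borel. *)
Definition Rn (R : realType) (n : nat) :=
  caratheodory_type (mu_ext (@lebesgue_tuple R n)).

HB.instance Definition _ (R : realType) (n : nat) := Measurable.on (Rn R n).

Definition lebesgue (R : realType) (n : nat) : set (Rn R n) -> \bar R :=
  @completed_measure_extension _ _ _ (@lebesgue_tuple R n).

HB.instance Definition _ (R : realType) (n : nat) := Measure.on (@lebesgue R n).

HB.instance Definition _ (R : realType) (n : nat) :=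
  Measure_isSigmaFinite.Build _ _ _ (@lebesgue R n)
    (completed_measure_extension_sigma_finite
      (sigma_finiteT (@lebesgue_tuple R n))).

Section cubes.
Context {R : realType} {n : nat}.

Record cube := Cube {
  corner : 'I_n -> R;
  side : R;
  side_gt0 : 0 < side }.

Definition cube_set (Q : cube) : set (Rn R n) :=
  [set x | forall i, corner Q i <= tnth x i <= corner Q i + side Q].

(* The topological interior of the closed cube. *)
Definition cube_interior (Q : cube) : set (Rn R n) :=
  [set x | forall i, corner Q i < tnth x i < corner Q i + side Q].

End cubes.
Arguments cube : clear implicits.
Coercion cube_set : cube >-> set.

Section cube_volume.
Context {R : realType}.
Local Notation RB := (measurableTypeR R).

Let box n (a b : 'I_n -> R) : set (n.-tuple RB) :=
  [set x | forall i, a i <= tnth x i <= b i].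

Let measurable_box n (a b : 'I_n -> R) : measurable (box a b).
Proof.
have -> : box a b = \big[setI/setT]_(i < n)
    ((fun t : n.-tuple RB => tnth t i) @^-1` `[a i, b i]%classic).
  apply/seteqP; split => x /=.
    by move=> xab; rewrite -bigcap_seq => i _ /=; rewrite in_itv/= xab.
  rewrite -bigcap_seq => + i => /(_ i) /=; rewrite in_itv/=; apply.
  by rewrite mem_index_enum.
apply: bigsetI_measurable => i _; rewrite -[X in measurable X]setTI.
by apply: measurable_tnth => //; exact: measurable_itv.
Qed.

Let lebesgue_tuple_box n (a : 'I_n -> R) (h : R) : 0 < h ->
  lebesgue_tuple n (box a (fun i => a i + h)) = (h ^+ n)%:E.
Proof.
move=> h0; elim: n a => [|n ih] a.
  rewrite expr0 /= diracE mem_set// => -[]//.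
rewrite /= /lebesgue_tupleS /pushforward.
have -> : @consT R n @^-1` box a (fun i => a i + h) =
    `[a ord0, a ord0 + h]%classic `*`
     box (a \o lift ord0) (fun i => (a \o lift ord0) i + h).
  apply/seteqP; split => -[x t] /=.
    move=> xt; split => /=.
      by have := xt ord0; rewrite in_itv.
    by move=> i; have := xt (lift ord0 i); rewrite tnthS.
  move=> [/= x0 xt] i; case: (unliftP ord0 i) => [j|] ->.
    by rewrite tnthS; exact: xt.
  by move: x0; rewrite in_itv.
rewrite [LHS]product_measure1E//=; last exact: measurable_box.
rewrite [X in (_ * X)%E](ih (a \o lift ord0)).
rewrite [X in (X * _)%E]lebesgue_measure_itv/=.
by rewrite lte_fin ltrDl h0 -EFinB addrAC subrr add0r -EFinM exprS.
Qed.

Lemma measurable_cube n (Q : cube R n) : measurable (cube_set Q).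
Proof.
exact: caratheodory_measurable_mu_ext (measurable_box _ _).
Qed.

Lemma lebesgue_cube n (Q : cube R n) : lebesgue Q = (side Q ^+ n)%:E.
Proof.
rewrite -(lebesgue_tuple_box (corner Q) (side_gt0 Q)).
by apply: measurable_mu_extE; exact: measurable_box.
Qed.

End cube_volume.

Section spaces.
Context {R : realType} {n : nat}.
Implicit Types (Q : cube R n) (f g : Rn R n -> R) (X : set (Rn R n -> R))
  (N : (Rn R n -> R) -> R).

Local Notation mu := (@lebesgue R n).

(* P(Q0); a countable, possibly finite, family is indexed by a set D of
   naturals. *)
Definition packing Q0 (D : set nat) (Q : nat -> cube R n) : Prop :=
  (forall i, D i -> Q i `<=` Q0) /\ trivIset D (fun i => cube_interior (Q i)).

Definition L1 Q0 : set (Rn R n -> R) :=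
  [set f | mu.-integrable Q0 (EFin \o f)].

Definition rearrangement Q0 f (t : R) : \bar R :=
  ereal_inf [set a%:E | a in
    [set a : R | 0 <= a /\ (mu (Q0 `&` [set x | (`|f x| > a)%R]) <= t%:E)%E]].

(* The norm of an extended-valued function in the space X with norm N on X,
   equal to +oo outside X; elements of X are finite almost everywhere. *)
Definition ext_norm Q0 X N (g : Rn R n -> \bar R) : \bar R :=
  if `[< {ae mu, forall x, cube_set Q0 x -> g x \is a fin_num} /\
         X (fine \o g) >]
  then (N (fine \o g))%:E else +oo%E.

(* Functions are total on R^n but only their values on Q0 matter: by
   bfs_ideal, membership and norm are invariant under equality almost
   everywhere on Q0. *)
Record banach_function_space Q0 X N : Prop := BanachFunctionSpace {
  bfs_measurable : forall f, X f -> measurable_fun Q0 f;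
  bfs_0 : X (fun=> 0);
  bfs_add : forall f g, X f -> X g -> X (f \+ g);
  bfs_scale : forall (a : R) f, X f -> X (fun x => a * f x);
  bfs_norm_ge0 : forall f, X f -> 0 <= N f;
  bfs_norm_eq0 : forall f, X f -> N f = 0 ->
    {ae mu, forall x, cube_set Q0 x -> f x = 0};
  bfs_norm_add : forall f g, X f -> X g -> N (f \+ g) <= N f + N g;
  bfs_norm_scale : forall (a : R) f, X f -> N (fun x => a * f x) = `|a| * N f;
  bfs_ideal : forall f g, measurable_fun Q0 f -> X g ->
    {ae mu, forall x, cube_set Q0 x -> `|f x| <= `|g x|} -> X f /\ N f <= N g;
  bfs_complete : forall u : nat -> (Rn R n -> R), (forall k, X (u k)) ->
    (forall e, 0 < e -> exists K, forall j k, (K <= j)%N -> (K <= k)%N ->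
      N (u j \- u k) < e) ->
    exists f, X f /\ N (u k \- f) @[k --> \oo] --> (0 : R) }.

Definition separable_space X N : Prop :=
  exists u : nat -> (Rn R n -> R), (forall k, X (u k)) /\
    forall f, X f -> forall e, 0 < e -> exists k, N (f \- u k) < e.

(* As the limit f is not assumed to belong to X, the property includes:
   if sup_k ||u_k|| is finite then f belongs to X. *)
Definition fatou_property Q0 X N : Prop :=
  forall (u : nat -> (Rn R n -> R)) f,
    (forall k, measurable_fun Q0 (u k)) -> measurable_fun Q0 f ->
    {ae mu, forall x, cube_set Q0 x -> [/\ forall k, 0 <= u k x,
      nondecreasing_seq (u ^~ x) & u k x @[k --> \oo] --> f x]} ->
    nondecreasing_seq (fun k => ext_norm Q0 X N (EFin \o u k)) /\
    ext_norm Q0 X N (EFin \o u k) @[k --> \oo] --> ext_norm Q0 X N (EFin \o f).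

Record ri_space Q0 X N : Prop := RiSpace {
  ri_bfs : banach_function_space Q0 X N;
  ri_separable_or_fatou : separable_space X N \/ fatou_property Q0 X N;
  ri_invariant : forall f g, measurable_fun Q0 f -> X g ->
    (forall t, 0 < t -> rearrangement Q0 f t = rearrangement Q0 g t) ->
    X f /\ N f = N g;
  ri_Linfty_sub : exists C, forall f M, measurable_fun Q0 f ->
    0 <= M -> {ae mu, forall x, cube_set Q0 x -> `|f x| <= M} ->
    X f /\ N f <= C * M;
  ri_sub_L1 : exists C, forall f, X f ->
    L1 Q0 f /\ (\int[mu]_(x in Q0) `|f x|%:E <= (C * N f)%:E)%E }.

Definition Gamma Q0 f : set (Rn R n -> R) :=
  [set g | L1 Q0 g /\ forall D (Q : nat -> cube R n), packing Q0 D Q ->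
    (\sum_(0 <= i <oo | i \in D) ((fine (mu (Q i)))^-1%:E *
        \int[mu]_(x in Q i) \int[mu]_(y in Q i) `|f x - f y|%:E)
     <= \sum_(0 <= i <oo | i \in D) \int[mu]_(x in Q i) (g x)%:E)%E].

Definition garo_norm Q0 X N f : \bar R :=
  ereal_inf [set ext_norm Q0 X N (EFin \o g) | g in Gamma Q0 f].

Definition GaRo Q0 X N : set (Rn R n -> R) :=
  [set f | L1 Q0 f /\ (garo_norm Q0 X N f < +oo)%E].

Definition local_osc (s : R) f Q : \bar R :=
  ereal_inf (range (fun c : R =>
    ereal_inf [set a%:E | a in
      [set a : R | 0 <= a /\
        (mu (Q `&` [set y | (`|f y - c| > a)%R]) < s%:E * mu Q)%E]])).

Definition sharp_maximal Q0 (s : R) f (x : Rn R n) : \bar R :=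
  ereal_sup [set local_osc s f Q | Q in
    [set Q : cube R n | cube_set Q x /\ Q `<=` Q0]].

End spaces.

(* Main.v *)
(* Write u for the sharp maximal function of f.

   [garo_norm <= 8 * norm u]: the function 8 u belongs to Gamma f. On a cube P
   the set E where |f - c_P| exceeds (roughly) the local oscillation has small
   relative measure; the maximal dyadic subcubes P_j in which E has density more
   than q = 2^(-n-1) satisfy |c_P - c_(P_j)| <= osc P + osc P_j because
   s <= 2^(-n)/8, and iterating the decomposition bounds the mean oscillation of
   f on P by 4 times the integral of u. A truncation of f makes the remainder
   term vanish.

   [norm u <= C * garo_norm]: for g in Gamma f and a level l, select by a Vitali
   argument the essentially maximal cubes with mean of |g| greater than l. Cubes
   outside their dilates have oscillation O(l/s), and on the dilates a weak type
   estimate for f - c_i gives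
     int (u/C - l)_+ <= (1/4) int (|g| - l)_+   for all l > 0.
   By the Hardy-Littlewood-Polya principle (discretize the decreasing
   rearrangements and perform transfers between two slices, each a convex
   combination of permutations) the norm of u/C is at most that of g. The factor
   1/4 pays for the discretization, so that the principle needs neither
   separability nor the Fatou property for bounded u; either of them then gives
   the general case by truncation. *)

Require Import Defs.
From mathcomp Require Import all_boot all_order all_algebra.
From mathcomp Require Import all_classical all_reals all_analysis.
From mathcomp Require Import perm measurable_realfun lra.
Import Order.TTheory GRing.Theory Num.Theory.
Import numFieldNormedType.Exports.
Local Open Scope classical_set_scope.
Local Open Scope ring_scope.
Set Implicit Arguments.
Unset Strict Implicit.
Unset Printing Implicit Defensive.

(** Superlevel sets of the sharp maximal function are uncountable unions of closed cubes. Their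
    Lebesgue measurability has to be established before any of their measures can be estimated, and
    it rests on translation invariance and on completeness of the measure. The weak type inequality
    is applied to the indicator of each level set {|f - c_i| > t} and not to |f - c_i| itself. It
    thus compares distribution functions at every level t, and this comparison can be integrated in
    t, whereas a weak type bound for the maximal function of |f - c_i| would not give an integral
    bound. A rearrangement invariant norm sees only distributions, and a coordinate is uniformly
    distributed on a unit cube. Decreasing rearrangements are therefore realised on [Q0] as
    functions of one coordinate, and the slices orthogonal to it have equal measure and may be
    permuted. The chosen coordinate [i0] also serves to compare the sides of nested cubes. *)

(** * Volume of boxes *)

Section box_volume.
Context {R : realType}.
Local Notation RB := (measurableTypeR R).

Definition box n (a b : 'I_n -> R) : set (n.-tuple RB) :=
  [set x | forall i, a i <= tnth x i <= b i].

Lemma measurable_box n (a b : 'I_n -> R) : measurable (box a b).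
Proof.
have -> : box a b = \big[setI/setT]_(i < n)
    ((fun t : n.-tuple RB => tnth t i) @^-1` `[a i, b i]%classic).
  apply/seteqP; split => x /=.
    by move=> xab; rewrite -bigcap_seq => i _ /=; rewrite in_itv/= xab.
  rewrite -bigcap_seq => + i => /(_ i) /=; rewrite in_itv/=; apply.
  by rewrite mem_index_enum.
apply: bigsetI_measurable => i _; rewrite -[X in measurable X]setTI.
by apply: measurable_tnth => //; exact: measurable_itv.
Qed.

(** Sides of length zero are allowed, so that faces of cubes and slabs of zero width come out as
    null boxes. *)
Lemma lebesgue_tuple_box n (a b : 'I_n -> R) : (forall i, a i <= b i) ->
  lebesgue_tuple n (box a b) = (\prod_(i < n) (b i - a i))%:E.
Proof.
elim: n a b => [|n ih] a b ab.
  by rewrite big_ord0 /= diracE mem_set// => -[].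
rewrite /= /lebesgue_tupleS /pushforward.
have -> : @consT R n @^-1` box a b =
    `[a ord0, b ord0]%classic `*` box (a \o lift ord0) (b \o lift ord0).
  apply/seteqP; split => -[x t] /=.
    move=> xt; split => /=.
      by have := xt ord0; rewrite in_itv.
    by move=> i; have := xt (lift ord0 i); rewrite tnthS.
  move=> [/= x0 xt] i; case: (unliftP ord0 i) => [j|] ->.
    by rewrite tnthS; exact: xt.
  by move: x0; rewrite in_itv.
rewrite [LHS]product_measure1E//=; last exact: measurable_box.
rewrite [X in (_ * X)%E]ih; last by move=> i; exact: ab.
rewrite [X in (X * _)%E]lebesgue_measure_itv/= big_ord_recl/=.
rewrite lte_fin; case: ltP => [_|ba]; first by rewrite -EFinB -EFinM.
by rewrite mul0e (le_anti (introT andP (conj ba (ab ord0)))) subrr mul0r.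
Qed.

End box_volume.

(** * Translation invariance of Lebesgue measure *)

Section translation.
Context {R : realType}.
Local Notation RB := (measurableTypeR R).

Lemma measurable_translate1 (v : R) : measurable_fun setT (fun x : RB => (x + v : RB)).
Proof.
by apply: measurable_funD => //; exact: measurable_id.
Qed.

Lemma lebesgue_measure_translate (v : R) (A : set RB) : measurable A ->
  lebesgue_measure ((fun x : RB => (x + v : RB)) @^-1` A) = lebesgue_measure A.
Proof.
move=> mA.
pose m : {measure set RB -> \bar R} :=
  measure_function_pushforward__canonical__measure_function_Measure
    (@lebesgue_measure R) (measurable_translate1 v).
have := @lebesgue_measure_unique R m; move=> /(_ _ A mA) ->//.
move=> X [[a b] _ <-] /=.
rewrite /m/= /pushforward.
have -> : (fun x : RB => (x + v : RB)) @^-1` `]a, b]%classic = `]a - v, b - v]%classic.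
  apply/seteqP; split => x /=; rewrite !in_itv/= => /andP[? ?]; apply/andP; split; lra.
rewrite !lebesgue_measure_itv/= !lte_fin ltrD2r; case: ifP => // _.
by rewrite -!EFinB; congr EFin; lra.
Qed.

Definition translate n (v : 'I_n -> R) (x : n.-tuple RB) : n.-tuple RB :=
  [tuple (tnth x i + v i : RB) | i < n].

Lemma measurable_translate n (v : 'I_n -> R) :
  measurable_fun setT (translate v).
Proof.
apply/measurable_fun_tnthP => i.
rewrite (_ : _ \o _ = fun x : n.-tuple RB => (tnth x i + v i : RB)); last first.
  by apply/funext => x /=; rewrite tnth_mktuple.
apply: measurable_funD => //.
exact: measurable_tnth.
Qed.

(** Induction on the dimension: the translation acts on head and tail separately, so its pushforward
    has the right values on rectangles, and uniqueness of the product measure concludes. *)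
Lemma lebesgue_tuple_translate n (v : 'I_n -> R) A : measurable A ->
  lebesgue_tuple n (translate v @^-1` A) = lebesgue_tuple n A.
Proof.
elim: n v A => [|n ih] v A mA.
  congr (lebesgue_tuple _ _); apply/seteqP; split => x /=.
    by rewrite (tuple0 x) (tuple0 (translate _ _)).
  by rewrite (tuple0 x) (tuple0 (translate _ _)).
rewrite /= /lebesgue_tupleS /pushforward.
pose T (p : RB * n.-tuple RB) : RB * n.-tuple RB :=
  (p.1 + v ord0 : RB, translate (v \o lift ord0) p.2).
have mT : measurable_fun setT T.
  apply: measurable_fun_pair => /=.
    by apply: measurable_funD => //; exact: measurable_fst.
  by apply: measurableT_comp measurable_snd; exact: measurable_translate.
have TE p : translate v (consT p) = consT (T p).
  apply: eq_from_tnth => i; rewrite tnth_mktuple.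
  case: (unliftP ord0 i) => [j|] -> //.
  by rewrite !tnthS tnth_mktuple.
have -> : @consT R n @^-1` (translate v @^-1` A) = T @^-1` (@consT R n @^-1` A).
  by apply/funext => p; rewrite /preimage/mkset TE.
pose m : {measure set (RB * n.-tuple RB) -> \bar R} :=
  measure_function_pushforward__canonical__measure_function_Measure
    (@lebesgue_measure R \x lebesgue_tuple n)%E mT.
have mA' : measurable (@consT R n @^-1` A).
  by rewrite -[X in measurable X]setTI; exact: measurable_consT.
apply/esym.
apply: (@product_measure_unique _ _ _ _ _ (@lebesgue_measure R) (lebesgue_tuple n) m) => //.
move=> B C mB mC; rewrite /m /= /pushforward.
have -> : T @^-1` (B `*` C) = ((fun x : RB => (x + v ord0 : RB)) @^-1` B) `*`
   (translate (v \o lift ord0) @^-1` C) by [].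
rewrite product_measure1E//.
- by congr (_ * _)%E; [exact: lebesgue_measure_translate|exact: ih].
- by rewrite -[X in measurable X]setTI; exact: measurable_translate1.
- by rewrite -[X in measurable X]setTI; exact: measurable_translate.
Qed.

End translation.

(** * Borel sets and completeness in [Rn] *)

Section basics.
Context {R : realType} {n : nat}.
Local Notation RB := (measurableTypeR R).
Local Notation mu := (@lebesgue R n).
Implicit Types Q : cube R n.

Lemma measurable_Borel (A : set (n.-tuple RB)) :
  measurable A -> measurable (A : set (Rn R n)).
Proof. exact: caratheodory_measurable_mu_ext. Qed.

Lemma lebesgue_Borel (A : set (n.-tuple RB)) :
  measurable A -> mu A = lebesgue_tuple n A.
Proof. exact: measurable_mu_extE. Qed.

Lemma measurable_coord i : measurable_fun setT (fun x : Rn R n => (tnth x i : RB)).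
Proof.
move=> _ B mB; rewrite setTI.
apply: measurable_Borel; rewrite -[X in measurable X]setTI.
exact: measurable_tnth.
Qed.

Lemma lebesgue_complete (A N : set (Rn R n)) : measurable N -> mu N = 0%E ->
  A `<=` N -> measurable A.
Proof.
move=> mN N0 AN.
have := @measure_is_complete_caratheodory R (n.-tuple RB) (mu_ext (lebesgue_tuple n)).
by apply; exists N.
Qed.

End basics.

(** * Integrals through distribution functions *)

Section layer_cake.
Context d (T : measurableType d) (R : realType).
Variable mu : {sigma_finite_measure set T -> \bar R}.
Local Notation RB := (measurableTypeR R).

Lemma measurable_superlevel (D : set T) (f : T -> R) (t : R) :
  measurable D -> measurable_fun D f -> measurable (D `&` [set x | t < f x]).
Proof.
move=> mD mf; rewrite (_ : [set x | _] = f @^-1` `]t, +oo[%classic).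
  by apply: mf => //; exact: measurable_itv.
by apply/seteqP; split => x /=; rewrite in_itv/= andbT.
Qed.

Let hypograph (D : set T) (f : T -> R) : set (T * RB) :=
  [set z | [/\ D z.1, 0 < z.2 & z.2 < f z.1]].

Let measurable_hypograph D f :
  measurable D -> measurable_fun D f -> measurable (hypograph D f).
Proof.
move=> mD mf.
have mDT : measurable (D `*` `]0, +oo[%classic : set (T * RB)).
  by apply: measurableX.
have -> : hypograph D f = (D `*` `]0, +oo[%classic) `&`
    [set z | 0 < (f \o fst \- snd) z].
  apply/seteqP; split => -[x t] /=.
    by move=> [? t0 tf]; rewrite in_itv/= t0 subr_gt0; do !split.
  by rewrite in_itv/= andbT subr_gt0 => -[[? ?] ?].
rewrite (_ : [set z | _] = (f \o fst \- snd) @^-1` `]0, +oo[%classic); last first.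
  by apply/seteqP; split => x /=; rewrite in_itv/= andbT.
apply: measurable_funB => //.
  apply: (measurable_comp mD) => //.
    by move=> _ [[x t] [/= Dx _] <-].
  by apply: measurable_funTS; exact: measurable_fst.
by apply: measurable_funTS; exact: measurable_snd.
Qed.

Let ysection_hypograph D f (t : R) : 0 < t ->
  ysection (hypograph D f) t = D `&` [set x | t < f x].
Proof.
move=> t0; apply/seteqP; split => x /=; rewrite /ysection/= inE/=.
  by move=> [].
by move=> [Dx tf]; split.
Qed.

(** Tonelli for the region under the graph of [f]: its vertical sections are intervals of length
    [f x], its horizontal sections are the superlevel sets. *)
Lemma layer_cake (D : set T) (f : T -> R) : measurable D -> measurable_fun D f ->
  (forall x, D x -> 0 <= f x) ->
  (\int[mu]_(x in D) (f x)%:E =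
   \int[@lebesgue_measure R]_(t in `]0%R, +oo[) mu (D `&` [set x | (t < f x)%R]))%E.
Proof.
move=> mD mf f0; pose A := hypograph D f.
have mA : measurable A by exact: measurable_hypograph.
have := indic_fubini_tonelli mu (@lebesgue_measure R) mA.
rewrite indic_fubini_tonelli_FE// indic_fubini_tonelli_GE// => E.
rewrite integral_mkcond [RHS]integral_mkcond; apply: etrans (etrans E _).
  apply: eq_integral => x _; rewrite /= patchE; case: ifPn => xD.
    rewrite (_ : xsection A x = `]0, f x[%classic); last first.
      apply/seteqP; split => t /=; rewrite /xsection/= inE/= in_itv/=.
        by move=> [_ -> ->].
      by move=> /andP[? ?]; split => //; exact/set_mem.
    rewrite lebesgue_measure_itv/= lte_fin; case: ltP => // fx0; last first.
      rewrite (_ : f x = 0)//; apply/eqP; rewrite eq_le fx0/=.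
      by apply: f0; exact/set_mem.
    by rewrite sube0.
  rewrite (_ : xsection A x = set0) ?measure0//.
  apply/seteqP; split => t //=; rewrite /xsection/= inE/= => -[Dx].
  by move/negP: xD; rewrite inE.
apply: eq_integral => t _; rewrite /= patchE; case: ifPn => /= tD.
  congr (mu _); apply/seteqP; split => x /=; rewrite /ysection/= inE/=.
    by move=> [].
  move=> [Dx tf]; split => //.
  by move: tD; rewrite inE/= in_itv/= andbT.
rewrite (_ : ysection A t = set0) ?measure0//.
apply/seteqP; split => x //=; rewrite /ysection/= inE/= => -[_ t0 _].
by move/negP: tD; rewrite inE/= in_itv/= t0.
Qed.

Lemma measurable_fun_distribution (D : set T) (f : T -> R) :
  measurable D -> measurable_fun D f ->
  measurable_fun (`]0, +oo[%classic : set RB)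
    (fun t : RB => mu (D `&` [set x | (t < f x)%R])).
Proof.
move=> mD mf.
apply: (@eq_measurable_fun _ _ _ _ _ (mu \o ysection (hypograph D f))).
  move=> t; rewrite inE/= in_itv/= andbT => t0.
  by rewrite /= ysection_hypograph.
apply: measurable_funTS; apply: measurable_fun_ysection.
exact: measurable_hypograph.
Qed.

(** Integrates a comparison of distribution functions over the level [t]. The countable sum
    accommodates separate weak type estimates on the cubes of a covering. *)
Lemma le_integral_distribution (c : R) (D : set T) (f : T -> R)
    (E : nat -> set T) (g : nat -> T -> R) :
  0 <= c -> measurable D -> measurable_fun D f -> (forall x, D x -> 0 <= f x) ->
  (forall i, measurable (E i)) -> (forall i, measurable_fun (E i) (g i)) ->
  (forall i x, E i x -> 0 <= g i x) ->
  (forall t, 0 < t -> (mu (D `&` [set x | (t < f x)%R]) <=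
    c%:E * \sum_(i <oo) mu (E i `&` [set x | (t < g i x)%R]))%E) ->
  (\int[mu]_(x in D) (f x)%:E <= c%:E * \sum_(i <oo) \int[mu]_(x in E i) (g i x)%:E)%E.
Proof.
move=> c0 mD mf f0 mE mg g0 fg.
rewrite layer_cake//.
rewrite (eq_eseriesr (fun i _ => layer_cake (mE i) (mg i) (@g0 i))).
rewrite -integral_nneseries//; last first.
  by move=> i; exact: measurable_fun_distribution.
rewrite -ge0_integralZl//; last 2 first.
- apply: (@ge0_emeasurable_sum _ _ _ _ _ xpredT) => // i _.
  exact: measurable_fun_distribution.
- by move=> t _; apply: nneseries_ge0.
apply: ge0_le_integral => //.
- exact: measurable_fun_distribution.
- apply: measurable_funeM.
  apply: (@ge0_emeasurable_sum _ _ _ _ _ xpredT) => // i _.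
  exact: measurable_fun_distribution.
by move=> t; rewrite /= in_itv/= andbT => t0; exact: fg.
Qed.

End layer_cake.

(** * Vitali covering by cubes *)

Section vitali.
Context {R : realType} {n : nat}.
Implicit Types P Q : cube R n.

Lemma five_side_gt0 Q : 0 < 5 * side Q.
Proof. by rewrite mulr_gt0// side_gt0. Qed.

(** Concentric with [Q]; five is 1 + 2 + 2, since a cube twice as large that meets [Q] may stick out
    on either side. *)
Definition dilate5 Q : cube R n :=
  Cube (fun i => corner Q i - 2 * side Q) (five_side_gt0 Q).

Lemma sub_dilate5 Q P : (P `&` Q : set (Rn R n)) !=set0 -> side P <= 2 * side Q ->
  (P : set (Rn R n)) `<=` dilate5 Q.
Proof.
move=> [z [zP zQ]] PQ x xP i /=.
have /andP[? ?] := zP i; have /andP[? ?] := zQ i; have /andP[? ?] := xP i.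
apply/andP; split; lra.
Qed.

Lemma cube_rat_point Q : exists q : {ffun 'I_n -> rat},
  cube_interior Q [tuple (ratr (q i) : measurableTypeR R) | i < n].
Proof.
have H i : exists q : rat, corner Q i < ratr q < corner Q i + side Q.
  have [|q] := @rat_in_itvoo R (corner Q i) (corner Q i + side Q).
    by rewrite ltrDl side_gt0.
  by rewrite in_itv/=; exists q.
have [q Hq] := choice H.
by exists [ffun i => q i] => i; rewrite tnth_mktuple ffunE.
Qed.

Lemma cube_interior_sub Q : cube_interior Q `<=` Q.
Proof. by move=> x xQ i; have /andP[? ?] := xQ i; apply/andP; split; exact: ltW. Qed.

(** Each interior contains a rational point, and disjointness makes the choice injective; the code
    of the point becomes the index of the cube. *)
Lemma disjoint_cubes_countable (D : set (cube R n)) :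
  (forall P Q, D P -> D Q -> (cube_interior P `&` cube_interior Q) !=set0 -> P = Q) ->
  exists (E : set nat) (Q : nat -> cube R n),
    [/\ forall i, E i -> D (Q i), forall P, D P -> exists2 i, E i & Q i = P &
        trivIset E (fun i => cube_interior (Q i))].
Proof.
move=> disjD.
have [q Hq] := choice cube_rat_point.
pose Q0 : cube R n := Cube (fun=> 0) ltr01.
pose E := [set k | exists2 P, D P & pickle (q P) = k].
have H k : exists Q, E k -> D Q /\ pickle (q Q) = k.
  have [[P DP <-]|nE] := pselect (E k); first by exists P.
  by exists Q0.
have [F HF] := choice H.
have qinj P P' : D P -> D P' -> q P = q P' -> P = P'.
  move=> DP DP' qPP'; apply: disjD => //.
  by eexists; split; [exact: Hq|rewrite qPP'; exact: Hq].
exists E, F; split.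
- by move=> i /HF[].
- move=> P DP; exists (pickle (q P)); first by exists P.
  have [|DF qF] := HF (pickle (q P)); first by exists P.
  apply: qinj => //; apply: (pcan_inj pickleK) => //.
move=> i j Ei Ej Fij.
have [DFi <-] := HF i Ei; have [DFj <-] := HF j Ej.
by rewrite (disjD _ _ DFi DFj Fij).
Qed.

(* Zorn's lemma is applied to the disjoint subfamilies D such that every member
   of V meeting D meets a member of D of at least half its size. *)
Lemma vitali_cubes (V : set (cube R n)) (r : R) :
  (forall Q, V Q -> side Q <= r) ->
  exists (D : set nat) (Q : nat -> cube R n),
    [/\ forall i, D i -> V (Q i), trivIset D (fun i => Q i : set (Rn R n)) &
        forall P, V P -> exists2 i, D i &
          (P : set (Rn R n)) `<=` dilate5 (Q i)].
Proof.
move=> Vr.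
pose meets P Q := (P `&` Q : set (Rn R n)) !=set0.
pose good (D : set (cube R n)) := [/\ D `<=` V,
  forall P Q, D P -> D Q -> meets P Q -> P = Q &
  forall P, V P -> (exists2 Q, D Q & meets P Q) ->
    exists2 Q, D Q & meets P Q /\ side P <= 2 * side Q].
have [|D [[DV disjD bigD] Dmax]] := @Zorn_bigcup _ good.
  move=> F Fgood Ftot; split.
  - by move=> P [D FD DP]; have [+ _ _] := Fgood _ FD; exact.
  - move=> P Q [D FD DP] [D' FD' DQ] PQ.
    have [DD'|D'D] := Ftot _ _ FD FD'.
      have [_ + _] := Fgood _ FD'; apply => //; exact: DD'.
    have [_ + _] := Fgood _ FD; apply => //; exact: D'D.
  - move=> P VP [Q [D FD DQ] PQ].
    have [_ _ /(_ P VP)[|Q' DQ' ?]] := Fgood _ FD; first by exists Q.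
    by exists Q' => //; exists D.
have Dhit P : V P -> exists2 Q, D Q & meets P Q.
  move=> VP; apply: contrapT => nP.
  (* The cubes of [V] that miss every member of [D]. One of side more than half the supremum of
     their sides can be adjoined to [D], against maximality. *)
  pose V' := [set Q | V Q /\ ~ exists2 Q', D Q' & meets Q Q'].
  pose S := [set side Q | Q in V'].
  have S0 : S (side P) by exists P.
  have supS : has_sup S.
    split; first by exists (side P).
    by exists r => _ [Q [VQ _] <-]; exact: Vr.
  have sup0 : 0 < sup S.
    apply: (lt_le_trans (side_gt0 P)); exact: (ub_le_sup supS.2).
  have [_ [Q [VQ nQ] <-] Qsup] : exists2 x, S x & sup S - sup S / 2 < x.
    by apply: sup_adherent => //; rewrite divr_gt0.
  have QQ : meets Q Q.
    have [q /cube_interior_sub Qq] := cube_rat_point Q; by eexists; split; exact: Qq.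
  apply: (Dmax (D `|` [set Q])).
    split; first by move=> X; left.
    by move=> /(_ Q (or_intror erefl)) DQ; apply: nQ; exists Q.
  split.
  - by move=> X [/DV//|->].
  - move=> X Y [DX|->] [DY|->] XY //; first exact: disjD.
    + by exfalso; apply: nQ; exists X => //; rewrite /meets setIC.
    + by exfalso; apply: nQ; exists Y.
  - move=> X VX [Y DY XY].
    have [XD|nXD] := pselect (exists2 Q', D Q' & meets X Q').
      by have [Q' DQ' ?] := bigD X VX XD; exists Q' => //; left.
    case: DY => [DY|YQ]; first by exfalso; apply: nXD; exists Y.
    exists Q; first by right.
    rewrite -YQ; split => //; rewrite YQ.
    have : side X <= sup S by apply: (ub_le_sup supS.2); exists X.
    lra.
have [|E [Q [QD DE tQ]]] := @disjoint_cubes_countable D.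
  move=> P Q DP DQ [x [xP xQ]]; apply: disjD => //.
  by exists x; split; exact: cube_interior_sub.
exists E, Q; split.
- by move=> i /QD/DV.
- move=> i j Ei Ej ij; apply: tQ => //.
  rewrite (disjD _ _ (QD _ Ei) (QD _ Ej) ij) setIid.
  by have [q ?] := cube_rat_point (Q j); eexists; eassumption.
- move=> P VP; have [Q' DQ' [PQ' sPQ']] := bigD P VP (Dhit P VP).
  have [i Ei Qi] := DE _ DQ'; exists i => //; rewrite Qi.
  exact: sub_dilate5.
Qed.

End vitali.

(** * Measurability of arbitrary unions of closed cubes *)

Section measurable_union.
Context {R : realType} {n : nat}.
Local Notation RB := (measurableTypeR R).
Local Notation mu := (@lebesgue R n).
Implicit Types (V : set (cube R n)) (Q : cube R n).

Let inv_gt0 m : 0 < m.+1%:R^-1 :> R. Proof. by rewrite invr_gt0. Qed.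

Let rat_box (p : nat * {ffun 'I_n -> rat}) : set (n.-tuple RB) :=
  box (fun i => ratr (p.2 i) - p.1.+1%:R^-1) (fun i => ratr (p.2 i) + p.1.+1%:R^-1).

(** The union of the interiors of the members of [V], written as a countable union of rational boxes
    so that it is Borel. *)
Let open_hull V : set (n.-tuple RB) :=
  \bigcup_p (if `[< exists2 Q, V Q & rat_box p `<=` cube_interior Q >]
             then rat_box p else set0).

Let measurable_open_hull V : measurable (open_hull V).
Proof.
apply: countable_bigcupT_measurable => // p.
by case: ifP => _ //; exact: measurable_box.
Qed.

Let open_hull_sub V : open_hull V `<=` \bigcup_(Q in V) (Q : set (Rn R n)).
Proof.
move=> x [p _]; case: ifP => // /asboolP[Q VQ pQ] px.
by exists Q => //; apply: cube_interior_sub; exact: pQ.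
Qed.

Let sub_open_hull V Q : V Q -> cube_interior Q `<=` open_hull V.
Proof.
move=> VQ x xQ.
have H i : exists m : nat, forall m', (m <= m')%N ->
    corner Q i + 2 * m'.+1%:R^-1 < tnth x i < corner Q i + side Q - 2 * m'.+1%:R^-1.
  have /andP[xl xr] := xQ i.
  pose t : R := tnth x i.
  pose e : R := Num.min (t - corner Q i) (corner Q i + side Q - t).
  have e0 : 0 < e / 2 by rewrite divr_gt0// lt_min !subr_gt0 xl xr.
  have [m] := ltr_add_invr e0; rewrite add0r => me.
  exists m => m' mm'.
  have : m'.+1%:R^-1 <= m.+1%:R^-1 :> R by rewrite lef_pV2 ?posrE// ler_nat ltnS.
  have : e <= t - corner Q i by rewrite ge_min lexx.
  have : e <= corner Q i + side Q - t by rewrite ge_min lexx orbT.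
  rewrite -/t; move: me; move: (t) (e) (m.+1%:R^-1 : R) (m'.+1%:R^-1 : R) => t' e' a b ? ? ? ?.
  by apply/andP; split; lra.
have [m Hm] := choice H.
pose M := (\max_(i < n) m i)%N.
have H2 i : exists q : rat, tnth x i - M.+1%:R^-1 < ratr q < tnth x i + M.+1%:R^-1.
  have [|q] := @rat_in_itvoo R (tnth x i - M.+1%:R^-1) (tnth x i + M.+1%:R^-1).
    by have := inv_gt0 M; move: (M.+1%:R^-1 : R) => a; lra.
  by rewrite in_itv/=; exists q.
have [q Hq] := choice H2.
exists (M, [ffun i => q i]) => //.
rewrite ifT; last first.
  apply/asboolP; exists Q => // y /= yq i.
  have := yq i; have := Hm i M; rewrite leq_bigmax_cond//= ffunE => /(_ isT).
  have := Hq i; move: (M.+1%:R^-1 : R) => a.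
  by move=> /andP[? ?] /andP[? ?] /andP[? ?]; apply/andP; split; lra.
move=> i /=; rewrite ffunE; have := Hq i; move: (M.+1%:R^-1 : R) => a /andP[? ?].
by apply/andP; split; lra.
Qed.

Let sgnv (s : {ffun 'I_n -> bool}) (t : R) (i : 'I_n) : R := if s i then t else - t.

Let delta (m : nat) : R := 2^-1 * m.+1%:R^-1.

(** For fixed [m] the steps decrease strictly in [k] and stay positive and at most [delta m], so the
    difference of two of them is a shift smaller than [delta m]. *)
Let step m k : R := delta m * k.+1%:R^-1.

Let delta_gt0 m : 0 < delta m.
Proof. by rewrite mulr_gt0. Qed.

Let step_gt0 m k : 0 < step m k.
Proof. by rewrite mulr_gt0 ?delta_gt0. Qed.

Let step_le m k : step m k <= delta m.
Proof.
rewrite ler_piMr ?(ltW (delta_gt0 _))//.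
by rewrite invf_le1// ler1n.
Qed.

Let step_lt m j k : (k < j)%N -> step m j < step m k.
Proof.
move=> kj; rewrite ltr_pM2l ?delta_gt0//.
by rewrite ltf_pV2 ?posrE// ltr_nat ltnS.
Qed.

(* A point of a cube of side at least 2 delta that is not in the open hull lies,
   for some choice of signs s, in this set, whose translates by step m k are
   pairwise disjoint. *)
Let antichain V Q0 (p : nat * {ffun 'I_n -> bool}) : set (n.-tuple RB) :=
  (box (corner Q0) (fun i => corner Q0 i + side Q0) `\` open_hull V) `&`
  \bigcap_j \bigcap_k (if (k < j)%N then
    translate (sgnv p.2 (step p.1 k - step p.1 j)) @^-1` open_hull V else setT).

Let measurable_antichain V Q0 p : measurable (antichain V Q0 p).
Proof.
apply: measurableI.
  by apply: measurableD => //; exact: measurable_box.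
apply: bigcap_measurableType => j _; apply: bigcap_measurableType => k _.
case: ifP => // _.
by rewrite -[X in measurable X]setTI; exact: measurable_translate.
Qed.

(** If the translates for k < j had a common point, the difference of the two steps would carry one
    point of the set onto another; by definition it carries it into the open hull, which the set
    avoids. So infinitely many disjoint sets of the same measure fit in a bounded box, and that
    measure is zero. *)
Let antichain_null V Q0 p : lebesgue_tuple n (antichain V Q0 p) = 0%E.
Proof.
set A := antichain V Q0 p.
have mA : measurable A by exact: measurable_antichain.
pose T k := translate (sgnv p.2 (- step p.1 k)) @^-1` A.
have mT k : measurable (T k).
  by rewrite -[X in measurable X]setTI; exact: measurable_translate.
have TA k : lebesgue_tuple n (T k) = lebesgue_tuple n A.
  exact: lebesgue_tuple_translate.
have tT : trivIset setT T.
  apply: ltn_trivIset => j k kj.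
  apply/seteqP; split => // x [Tk Tj].
  have [[_ nG] _] := Tj.
  have TE : translate (sgnv p.2 (step p.1 k - step p.1 j))
      (translate (sgnv p.2 (- step p.1 k)) x) = translate (sgnv p.2 (- step p.1 j)) x.
    apply: eq_from_tnth => i; rewrite !tnth_mktuple /sgnv; case: ifP => _; lra.
  have [_ /(_ j I k I)] := Tk.
  by rewrite kj /preimage/mkset TE => /nG.
pose B := box (fun i => corner Q0 i - delta p.1)
  (fun i => corner Q0 i + side Q0 + delta p.1).
have TB : \bigcup_k T k `<=` B.
  move=> x [k _ [[xQ _] _]] i; have := xQ i; rewrite tnth_mktuple.
  have := step_le p.1 k; have := step_gt0 p.1 k; have := delta_gt0 p.1.
  by rewrite /sgnv; case: ifP => _ ? ? ? /andP[? ?]; apply/andP; split; lra.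
have sumT : (\sum_(k <oo) lebesgue_tuple n A <= lebesgue_tuple n B)%E.
  rewrite -(eq_eseriesr (fun k _ => TA k)).
  rewrite -(measure_semi_bigcup _ mT tT); last exact: bigcupT_measurable.
  apply: le_measure => //; rewrite inE; last exact: measurable_box.
  exact: bigcupT_measurable.
have Bfin : (lebesgue_tuple n B < +oo)%E.
  rewrite lebesgue_tuple_box ?ltry// => i.
  have := delta_gt0 p.1; have := side_gt0 Q0; lra.
apply/eqP; rewrite -measure_le0 leNgt; apply/negP => A0.
have /fineK Afin : lebesgue_tuple n A \is a fin_num.
  rewrite ge0_fin_numE//; apply: le_lt_trans Bfin; apply: le_trans sumT.
  by apply: le_trans (nneseries_lim_ge 1 _) => //; rewrite big_nat1.
have /fineK Bfin' : lebesgue_tuple n B \is a fin_num by rewrite ge0_fin_numE.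
have a0 : 0 < fine (lebesgue_tuple n A) by rewrite -lte_fin Afin.
pose K := (Num.truncn (fine (lebesgue_tuple n B) / fine (lebesgue_tuple n A))).+1.
have : (\sum_(0 <= k < K) lebesgue_tuple n A <= lebesgue_tuple n B)%E.
  apply: le_trans sumT.
  exact: nneseries_lim_ge.
rewrite -Afin -Bfin' sumEFin sumr_const_nat subn0 lee_fin leNgt => /negP; apply.
rewrite -mulr_natl -ltr_pdivrMr//.
by rewrite truncnS_gt.
Qed.

(** The union need not be Borel, but what it adds to the open hull is null. A point of a closed cube
    enters the interior when each coordinate is shifted towards the centre by less than half the
    side, so a point outside the open hull lies in [antichain] for the signs of that shift. There
    are countably many such sets, and completeness concludes. *)
Lemma measurable_bigcup_cubes V Q0 : (forall Q, V Q -> (Q : set (Rn R n)) `<=` Q0) ->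
  measurable (\bigcup_(Q in V) (Q : set (Rn R n))).
Proof.
move=> VQ0; set E := \bigcup_(Q in V) _.
pose N : set (n.-tuple RB) := \bigcup_p antichain V Q0 p.
have mN : measurable N by exact: countable_bigcupT_measurable.
have N0 : mu N = 0%E.
  rewrite (lebesgue_Borel mN).
  pose F k := if @unpickle (nat * {ffun 'I_n -> bool})%type k is Some p
    then antichain V Q0 p else set0.
  have -> : N = \bigcup_k F k.
    apply/seteqP; split => x [p _ xp].
      by exists (pickle p) => //; rewrite /F pickleK.
    by move: xp; rewrite /F; case: unpickle => // q xq; exists q.
  have mF k : measurable (F k).
    by rewrite /F; case: unpickle => // p; exact: measurable_antichain.
  apply/negligibleP; first exact: bigcupT_measurable.
  apply: negligible_bigcup => k; apply/negligibleP => //.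
  by rewrite /F; case: unpickle => // p; exact: antichain_null.
have EGN : E `\` open_hull V `<=` N.
  move=> x [[Q VQ xQ] nG].
  have [m] := ltr_add_invr (side_gt0 Q); rewrite add0r => mQ.
  have {}mQ : 2 * delta m < side Q by rewrite /delta mulrA divff ?mul1r.
  pose s := [ffun i => tnth x i <= corner Q i + side Q / 2].
  exists (m, s) => //; split; first by split => //; exact: (VQ0 _ VQ).
  move=> j _ k _; case: ifP => // kj; apply: (sub_open_hull VQ) => i.
  rewrite tnth_mktuple /sgnv ffunE/=.
  have := step_lt m kj; have := step_le m k; have := step_gt0 m j.
  have /andP[? ?] := xQ i; move=> ? ? ?.
  by case: (leP (tnth x i)) => ?; apply/andP; split; lra.
rewrite (_ : E = (open_hull V : set (Rn R n)) `|` (E `\` open_hull V)).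
  apply: measurableU; first exact: measurable_Borel.
  exact: (@lebesgue_complete _ _ _ N (measurable_Borel mN)).
apply/seteqP; split => x; last by move=> [/open_hull_sub|[]].
by move=> Ex; have [?|?] := pselect (open_hull V x); [left|right].
Qed.

End measurable_union.

(** * Dyadic cells and dyadic cubes *)

Section dyadic.
Context {R : realType} {n : nat} (Q : cube R n).
Local Notation RB := (measurableTypeR R).
Local Notation mu := (@lebesgue R n).
Local Notation index := {ffun 'I_n -> int}.

Let scaled k (x : Rn R n) i : R := 2 ^+ k * ((tnth x i - corner Q i) / side Q).

Let scaledS k x i : scaled k.+1 x i = 2 * scaled k x i.
Proof. by rewrite /scaled exprS -mulrA. Qed.

(** Cells are the fibres of this index, hence half-open: the cells of one generation partition the
    whole space exactly, and only the comparison with closed cubes costs null sets. *)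
Definition dyadic_index k (x : Rn R n) : index := [ffun i => Num.floor (scaled k x i)].

Definition cell k (m : index) : set (Rn R n) := [set x | dyadic_index k x = m].

Definition half_open_cube : set (Rn R n) := cell 0 [ffun=> 0].

Let dyadic_side_gt0 k : 0 < side Q / 2 ^+ k.
Proof. by rewrite divr_gt0 ?side_gt0 ?exprn_gt0. Qed.

Definition dyadic_cube k (m : index) : cube R n :=
  Cube (fun i => corner Q i + (m i)%:~R * (side Q / 2 ^+ k)) (dyadic_side_gt0 k).

Lemma dyadic_indexS k x y : dyadic_index k.+1 x = dyadic_index k.+1 y ->
  dyadic_index k x = dyadic_index k y.
Proof.
move=> xy; apply/ffunP => i; rewrite !ffunE.
have /ffunP/(_ i) := xy; rewrite !ffunE !scaledS.
move: (scaled k x i) (scaled k y i) => a b ab.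
apply/esym/floor_def.
have /andP[a1 a2] := floor_itv a.
set p := Num.floor a in a1 a2 *.
have m1 : 2 * p <= Num.floor (2 * b).
  by rewrite -ab floor_ge_int rmorphM/= ler_pM2l.
have m2 : Num.floor (2 * b) < 2 * p + 2.
  rewrite -ab floor_lt_int rmorphD rmorphM/=.
  by move: a2; rewrite rmorphD/=; lra.
have : (2 * p)%:~R <= 2 * b :> R by rewrite -floor_ge_int.
have : 2 * b < (2 * p + 2)%:~R :> R by rewrite -floor_lt_int.
by rewrite !rmorphD !rmorphM/= => ? ?; apply/andP; split; lra.
Qed.

Lemma dyadic_index_le j k x y : (j <= k)%N -> dyadic_index k x = dyadic_index k y ->
  dyadic_index j x = dyadic_index j y.
Proof.
move=> /subnK <-; elim: (k - j)%N => // d ih; rewrite addSn => /dyadic_indexS.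
exact: ih.
Qed.

Let cellE k m x : cell k m x <-> forall i,
  corner (dyadic_cube k m) i <= tnth x i <
    corner (dyadic_cube k m) i + side (dyadic_cube k m).
Proof.
have s0 := side_gt0 Q.
have e i : (corner (dyadic_cube k m) i <= tnth x i <
    corner (dyadic_cube k m) i + side (dyadic_cube k m)) =
    ((m i)%:~R <= scaled k x i < (m i + 1)%:~R).
  have h0 := dyadic_side_gt0 k.
  have -> : scaled k x i = (tnth x i - corner Q i) / (side Q / 2 ^+ k).
    by rewrite invf_div /scaled mulrCA.
  rewrite ler_pdivlMr// ltr_pdivrMr// lerBrDl ltrBlDl rmorphD/= mulrDl mul1r.
  by rewrite addrA.
split => [xm i|H]; first by rewrite e -xm ffunE floor_itv.
by apply/ffunP => i; rewrite ffunE; apply: floor_def; rewrite -e.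
Qed.

Lemma cell_sub k m : cell k m `<=` dyadic_cube k m.
Proof. by move=> x /cellE xc i; have /andP[? ?] := xc i; apply/andP; split => //; exact: ltW. Qed.

Lemma measurable_cell k m : measurable (cell k m).
Proof.
have -> : cell k m = \big[setI/setT]_(i < n) ((fun x : Rn R n => (tnth x i : RB)) @^-1`
   `[corner (dyadic_cube k m) i,
     corner (dyadic_cube k m) i + side (dyadic_cube k m)[%classic).
  apply/seteqP; split => x /=.
    by move=> /cellE xc; rewrite -bigcap_seq => i _ /=; rewrite in_itv/= xc.
  rewrite -bigcap_seq => xc; apply/cellE => i; have /= := xc i.
  by rewrite in_itv/=; apply; rewrite mem_index_enum.
apply: bigsetI_measurable => i _; rewrite -[X in measurable X]setTI.
by apply: measurable_coord => //; exact: measurable_itv.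
Qed.

(** The difference lies in the [n] upper faces, each a box with one degenerate side. *)
Lemma lebesgue_cell_diff k m : mu (dyadic_cube k m `\` cell k m) = 0%E.
Proof.
pose P := dyadic_cube k m.
pose face j := box (fun i => if i == j then corner P i + side P else corner P i)
  (fun i => corner P i + side P).
have face0 j : mu (face j) = 0%E.
  rewrite (lebesgue_Borel (measurable_box _ _)) lebesgue_tuple_box.
    by rewrite (bigD1 j)//= eqxx subrr mul0r.
  by move=> i; case: ifP => // _; rewrite lerDl ltW// side_gt0.
have mP := measurable_cube P; have mc := measurable_cell k m.
have sub : P `\` cell k m `<=` \big[setU/set0]_(j < n) face j.
  move=> x [xP /cellE/existsNP[j xj]].
  rewrite -bigcup_seq; exists j; first by rewrite /= mem_index_enum.
  move=> i; have /andP[x1 x2] := xP i.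
  rewrite x2 andbT; case: eqP => [->|//].
  rewrite leNgt; apply/negP => xj2; apply: xj.
  by rewrite xj2 andbT; have /andP[] := xP j.
have mface : measurable (\big[setU/set0]_(j < n) face j : set (Rn R n)).
  by apply: bigsetU_measurable => j _; apply: measurable_Borel; exact: measurable_box.
apply/eqP; rewrite -measure_le0; apply: (@le_trans _ _
  (mu (\big[setU/set0]_(j < n) face j))).
  by apply: le_measure => //; rewrite inE//; exact: measurableD.
have : mu.-negligible (\big[setU/set0]_(j < n) face j).
  apply: big_ind => //; first exact: negligible_set0.
    by move=> A B; exact: negligibleU.
  move=> j _; apply/negligibleP; last exact: face0.
  by apply: measurable_Borel; exact: measurable_box.
by move/negligibleP => ->.
Qed.

Lemma lebesgue_cell k m : mu (cell k m) = mu (dyadic_cube k m).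
Proof.
have mc := measurable_cell k m.
have mP := measurable_cube (dyadic_cube k m).
rewrite -[X in _ = mu X](setDUK (@cell_sub k m)) measureU0//; first exact: measurableD.
exact: lebesgue_cell_diff.
Qed.

Lemma dyadic_cube0 : dyadic_cube 0 [ffun=> 0] = Q :> set (Rn R n).
Proof.
by apply/seteqP; split => x xQ i; have := xQ i;
  rewrite /= ffunE mul0r addr0 expr0 divr1.
Qed.

Lemma half_open_cube_sub : half_open_cube `<=` Q.
Proof. by rewrite -dyadic_cube0; exact: cell_sub. Qed.

Lemma lebesgue_half_open_cube_diff : mu (Q `\` half_open_cube) = 0%E.
Proof. by rewrite -[X in mu (X `\` _)]dyadic_cube0 lebesgue_cell_diff. Qed.

Lemma dyadic_cube_sub k m x : cell k m x -> half_open_cube x ->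
  dyadic_cube k m `<=` Q.
Proof.
move=> xc xQ.
have mi i : 0 <= m i < 2 ^+ k.
  move: xc xQ => <-; rewrite /half_open_cube /cell/= => /ffunP/(_ i).
  rewrite !ffunE => /eqP; rewrite floor_eq add0r => /andP[].
  rewrite /scaled expr0 mul1r => a b; apply/andP; split.
    by rewrite floor_ge0 mulr_ge0// exprn_ge0.
  by rewrite floor_lt_int rmorphXn/= -[ltRHS]mulr1 ltr_pM2l// exprn_gt0.
move=> y yP i; have := yP i; have /andP[m0 m1] := mi i.
rewrite /=; set h := side Q / 2 ^+ k.
have h0 : 0 < h by rewrite divr_gt0 ?side_gt0 ?exprn_gt0.
have Qh : side Q = 2 ^+ k * h.
  by rewrite /h mulrC divfK// gt_eqF// exprn_gt0.
have m0' : 0 <= (m i)%:~R * h :> R by rewrite mulr_ge0 ?ler0z// ltW.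
have m1' : ((m i)%:~R + 1) * h <= side Q.
  rewrite Qh ler_pM2r//.
  have -> : 2 ^+ k = (2 ^+ k : int)%:~R :> R by rewrite rmorphXn.
  by rewrite -(intrD _ _ 1) ler_int lezD1.
by move=> /andP[? ?]; rewrite mulrDl mul1r in m1'; apply/andP; split; lra.
Qed.

Lemma half_open_cube_cell k m x : cell k m x -> half_open_cube x ->
  cell k m `<=` half_open_cube.
Proof.
rewrite /half_open_cube /cell/= => xm x0 y /= ym.
by rewrite -x0; apply: (@dyadic_index_le 0 k) => //; rewrite xm ym.
Qed.

End dyadic.

(** * A dyadic density theorem *)

Section density.
Context {R : realType} {n : nat} (Q : cube R n).
Local Notation RB := (measurableTypeR R).
Local Notation mu := (@lebesgue R n).
Local Notation index := {ffun 'I_n -> int}.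
Local Notation Qo := (half_open_cube Q).

Let mQo : measurable Qo. Proof. exact: measurable_cell. Qed.

Let muQo : (mu Qo < +oo)%E.
Proof. by rewrite lebesgue_cell lebesgue_cube ltry. Qed.

Let dyadic_set k (S : set index) : set (Rn R n) := [set x | S (dyadic_index Q k x)].

Let measurable_dyadic_set k S : measurable (dyadic_set k S).
Proof.
rewrite (_ : dyadic_set k S = \bigcup_m (if m \in S then cell Q k m else set0)).
  apply: countable_bigcupT_measurable => // m.
  by case: ifP => // _; exact: measurable_cell.
apply/seteqP; split => x.
  by move=> Sx; exists (dyadic_index Q k x) => //; rewrite mem_set.
by move=> [m _]; case: ifPn => // /set_mem Sm; rewrite /dyadic_set/= => ->.
Qed.

Let lift_dyadic_set j k S : (j <= k)%N -> exists S', dyadic_set j S = dyadic_set k S'.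
Proof.
move=> jk; exists [set m | exists2 y, dyadic_index Q k y = m & S (dyadic_index Q j y)].
apply/seteqP; split => x /=; first by move=> Sx; exists x.
by move=> [y yx Sy]; rewrite /dyadic_set/= -(dyadic_index_le jk yx).
Qed.

Let symdiff (A B : set (Rn R n)) := (A `\` B) `|` (B `\` A).

Let measurable_symdiff A B : measurable A -> measurable B -> measurable (symdiff A B).
Proof. by move=> mA mB; apply: measurableU; exact: measurableD. Qed.

(** Inside [Qo], and up to small measure, [A] is a union of dyadic cells of a single generation. The
    sets with this property form a sigma-algebra, which will be seen to contain the Borel sets. *)
Let approximable (A : set (Rn R n)) := measurable A /\ forall e : R, 0 < e ->
  exists k S, (mu (Qo `&` symdiff A (dyadic_set k S)) <= e%:E)%E.

Let approximableC A : approximable A -> approximable (~` A).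
Proof.
move=> [mA aA]; split; first exact: measurableC.
move=> e /aA[k [S kS]]; exists k, (~` S); apply: le_trans kS.
rewrite le_eqVlt; apply/orP; left; apply/eqP; congr (mu (_ `&` _)).
rewrite /symdiff [in RHS]setUC; congr (_ `|` _); apply/seteqP; split => x /=.
- by move=> [? /contrapT].
- by move=> [? ?]; split.
- by move=> [? /contrapT].
- by move=> [? ?]; split.
Qed.

Let approximableU A B : approximable A -> approximable B -> approximable (A `|` B).
Proof.
move=> [mA aA] [mB aB]; split; first exact: measurableU.
move=> e e0; have e20 : 0 < e / 2 by rewrite divr_gt0.
have [j [S jS]] := aA _ e20; have [k [T kT]] := aB _ e20.
have [S' SS'] := @lift_dyadic_set j (maxn j k) S (leq_maxl _ _).
have [T' TT'] := @lift_dyadic_set k (maxn j k) T (leq_maxr _ _).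
rewrite SS' in jS; rewrite TT' in kT.
exists (maxn j k), (S' `|` T').
rewrite [e]splitr EFinD; apply: (le_trans _ (leeD jS kT)).
set U := _ `&` symdiff A _; set V := _ `&` symdiff B _.
have mU : measurable U by apply: measurableI => //; exact: measurable_symdiff.
have mV : measurable V by apply: measurableI => //; exact: measurable_symdiff.
apply: le_trans (measureU2 _ mU mV).
apply: le_measure; rewrite ?inE.
- apply: measurableI => //; apply: measurable_symdiff => //; exact: measurableU.
- exact: measurableU.
move=> x [Qx]; rewrite /U /V /symdiff /dyadic_set /=.
move: (S' _) (T' _) => a b.
case: (pselect (A x)); case: (pselect (B x)); case: (pselect a);
  case: (pselect b); tauto.
Qed.

(** As [Qo] has finite measure, a finite subunion misses at most [e / 2]; its own approximation
    costs the other half. *)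
Let approximable_bigcup (F : nat -> set (Rn R n)) :
  (forall k, approximable (F k)) -> approximable (\bigcup_k F k).
Proof.
move=> aF; pose G m := \big[setU/set0]_(k < m) F k.
have a0 : approximable set0.
  split => // e e0; exists 0%N, set0.
  by rewrite /symdiff (_ : dyadic_set _ _ = set0)// !setD0 setU0 setI0 measure0 lee_fin ltW.
have aG m : approximable (G m).
  rewrite /G; elim: m => [|m ih]; first by rewrite big_ord0.
  by rewrite big_ord_recr; exact: approximableU.
have mF : measurable (\bigcup_k F k) by apply: bigcupT_measurable => k; exact: (aF k).1.
split => // e e0.
have e20 : 0 < e / 2 by rewrite divr_gt0.
have GF : \bigcup_m (Qo `&` G m) = Qo `&` \bigcup_k F k.
  apply/seteqP; split => x.
    move=> [m _ [Qx]]; rewrite /G -bigcup_mkord => -[k _ Fkx]; split => //.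
    by exists k.
  move=> [Qx [k _ Fkx]]; exists k.+1 => //; split => //.
  by rewrite /G -bigcup_mkord; exists k => /=.
have mG m : measurable (Qo `&` G m) by apply: measurableI => //; exact: (aG m).1.
have mGF : measurable (\bigcup_m (Qo `&` G m)) by rewrite GF; exact: measurableI.
have cvgG : (mu \o (fun m => Qo `&` G m)) x @[x --> \oo] --> mu (Qo `&` \bigcup_k F k).
  rewrite -GF; apply: nondecreasing_cvg_mu => // i j ij; apply/subsetPset.
  apply: setIS; rewrite /G => x; rewrite -!bigcup_mkord => -[k ki Fk].
  by exists k => //=; exact: leq_trans ij.
have finF : mu (Qo `&` \bigcup_k F k) \is a fin_num.
  rewrite ge0_fin_numE//; apply: le_lt_trans muQo.
  by apply: measureIl.
have [m Gm] : exists m, (mu (Qo `&` \bigcup_k F k) - (e / 2)%:E <= mu (Qo `&` G m))%E.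
  have : (mu (Qo `&` \bigcup_k F k) - (e / 2)%:E < mu (Qo `&` \bigcup_k F k))%E.
    by rewrite lteBlDr// lteDl// lte_fin.
  move=> H; have /cvgG[N _ HN] : nbhs (mu (Qo `&` \bigcup_k F k))
      [set y | (mu (Qo `&` \bigcup_k F k) - (e / 2)%:E < y)%E].
    by apply: open_nbhs_nbhs; split => //; exact: open_ereal_gt_ereal.
  by exists N; apply: ltW; exact: (HN N (leqnn N)).
have [k [S kS]] := (aG m).2 _ e20; exists k, S.
have mD : measurable (Qo `&` (\bigcup_k F k `\` G m)).
  by apply: measurableI => //; apply: measurableD => //; exact: (aG m).1.
have muD : (mu (Qo `&` (\bigcup_k F k `\` G m)) <= (e / 2)%:E)%E.
  rewrite (_ : _ `&` _ = (Qo `&` \bigcup_k F k) `\` (Qo `&` G m)); last first.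
    apply/seteqP; split => x /=; first by move=> [? [? ?]]; tauto.
    by move=> [[? ?] ?]; tauto.
  rewrite measureD//; last 2 first.
  - exact: measurableI.
  - by rewrite -ge0_fin_numE.
  rewrite (_ : _ `&` _ `&` _ = Qo `&` G m); last first.
    apply/seteqP; split => x; first by move=> [].
    by move=> Gx; split => //; rewrite -GF; exists m.
  have finG : mu (Qo `&` G m) \is a fin_num.
    rewrite ge0_fin_numE//; apply: le_lt_trans muQo.
    by apply: measureIl => //; exact: (aG m).1.
  by move: Gm; rewrite !leeBlDr// addeC.
set U := _ `&` symdiff (G m) _ in kS.
have mU : measurable U.
  by apply: measurableI => //; apply: measurable_symdiff => //; exact: (aG m).1.
rewrite [e]splitr EFinD; apply: (le_trans _ (leeD muD kS)).
apply: le_trans (measureU2 _ mD mU).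
apply: le_measure; rewrite ?inE.
- by apply: measurableI => //; exact: measurable_symdiff.
- exact: measurableU.
have GmF : G m `<=` \bigcup_k F k.
  by move=> x; rewrite /G -bigcup_mkord => -[j _ ?]; exists j.
move=> x [Qx]; rewrite /U /symdiff /= => H; have := GmF x.
case: (pselect (G m x)); tauto.
Qed.

(** The error lies in the one dyadic slab that contains the hyperplane [x_i = t]; its part in [Q]
    has volume at most [side Q ^+ n / 2 ^+ k]. *)
Let approximable_ray i (t : R) : approximable [set x | tnth x i <= t].
Proof.
split.
  rewrite (_ : [set x | _] = (fun x : Rn R n => (tnth x i : RB)) @^-1` `]-oo, t]%classic).
    rewrite -[X in measurable X]setTI.
    by apply: measurable_coord => //; exact: measurable_itv.
  by apply/seteqP; split => x /=; rewrite in_itv.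
move=> e e0.
have V0 : 0 < side Q ^+ n by rewrite exprn_gt0 ?side_gt0.
have [k] := ltr_add_invr (divr_gt0 e0 V0); rewrite add0r => ke.
have {}ke : side Q ^+ n / 2 ^+ k <= e.
  rewrite mulrC -ler_pdivlMr// ltW// (le_lt_trans _ ke)//.
  rewrite lef_pV2 ?posrE// ?exprn_gt0//.
  by rewrite -natrX ler_nat ltn_expl.
pose p := Num.floor (2 ^+ k * ((t - corner Q i) / side Q)).
exists k, [set m : index | m i <= p].
pose h := side Q / 2 ^+ k.
have h0 : 0 < h by rewrite divr_gt0 ?side_gt0 ?exprn_gt0.
pose slab := box (fun j => if j == i then corner Q i + p%:~R * h else corner Q j)
  (fun j => if j == i then corner Q i + p%:~R * h + h else corner Q j + side Q).
have mslab : measurable (slab : set (Rn R n)).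
  by apply: measurable_Borel; exact: measurable_box.
apply: (@le_trans _ _ (mu slab)); last first.
  rewrite (lebesgue_Borel (measurable_box _ _)) lebesgue_tuple_box; last first.
    by move=> j; case: ifP => _; rewrite lerDl ltW// side_gt0.
  rewrite lee_fin; apply: le_trans ke; rewrite (bigD1 i)//= eqxx.
  rewrite (eq_bigr (fun=> side Q)); last first.
    by move=> j /negbTE ->; rewrite addrAC subrr add0r.
  rewrite prodr_const (addrAC _ h) subrr add0r /h.
  rewrite (_ : #|_| = n.-1); last first.
    by rewrite cardC1 card_ord.
  rewrite mulrAC -exprS prednK//.
  exact: (leq_ltn_trans (leq0n i) (ltn_ord i)).
apply: le_measure; rewrite ?inE//.
  apply: measurableI => //; apply: measurable_symdiff => //.
  rewrite (_ : [set x | _] = (fun x : Rn R n => (tnth x i : RB)) @^-1` `]-oo, t]%classic).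
    rewrite -[X in measurable X]setTI.
    by apply: measurable_coord => //; exact: measurable_itv.
  by apply/seteqP; split => x /=; rewrite in_itv.
have mono : {homo (fun y => 2 ^+ k * ((y - corner Q i) / side Q)) : x y / x <= y}.
  move=> x y xy; rewrite ler_pM2l ?exprn_gt0// ler_pM2r ?invr_gt0 ?side_gt0//.
  by rewrite lerD2r.
move=> x [Qx xS].
have xQ := half_open_cube_sub Qx.
have [xt xp] : t <= tnth x i /\ dyadic_index Q k x i = p.
  case: xS; rewrite /dyadic_set/= !ffunE => -[].
    by move=> xt []; apply: le_floor; exact: mono.
  move=> xp /negP; rewrite -ltNge => /ltW xt; split => //.
  by apply/eqP; rewrite eq_le xp /p; apply: le_floor; exact: mono.
have := @cell_sub _ _ Q k (dyadic_index Q k x) x erefl i; rewrite /= xp -/h => xi.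
by move=> j; case: eqP => [->//|_]; exact: xQ.
Qed.

(** Minimality is used twice: for the sigma-algebra generated by the coordinate maps, then for that
    of the line, generated by half-open intervals. *)
Let approximable_Borel (A : set (n.-tuple RB)) : measurable A -> approximable A.
Proof.
apply: smallest_sub; first split.
- split => // e e0; exists 0%N, set0.
  by rewrite /symdiff (_ : dyadic_set _ _ = set0)// !setD0 setU0 setI0 measure0 lee_fin ltW.
- by move=> B aB; rewrite setTD; exact: approximableC.
- by move=> F aF; exact: approximable_bigcup.
move=> B; rewrite -bigcup_seq => -[i _ [Y mY <-{B}]]; rewrite setTI.
move: Y mY; apply: smallest_sub; first split.
- rewrite /= preimage_set0; split => // e e0; exists 0%N, set0.
  by rewrite /symdiff (_ : dyadic_set _ _ = set0)// !setD0 setU0 setI0 measure0 lee_fin ltW.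
- by move=> B aB; rewrite setTD /= preimage_setC; exact: approximableC.
- by move=> F aF; rewrite /= preimage_bigcup; exact: approximable_bigcup.
move=> _ [[a b] _ <-] /=.
rewrite (_ : _ @^-1` _ = ~` (~` [set x : Rn R n | tnth x i <= b] `|`
    [set x : Rn R n | tnth x i <= a])); last first.
  apply/seteqP; split => x /=; rewrite in_itv/=.
    by move=> /andP[ax xb] [//|]; rewrite leNgt ax.
  move=> /not_orP[/contrapT -> /negP]; rewrite andbT -ltNge//.
apply: approximableC; apply: approximableU; last exact: approximable_ray.
by apply: approximableC; exact: approximable_ray.
Qed.

(** A substitute for Lebesgue's density theorem. Approximate [A] by a union of cells of one
    generation, of total measure at most mu A + 2 e, that misses at most [e] of it. Summing the
    hypothesis over these cells gives mu A <= q (mu A + 2 e) + e, which fails for small [e] when mu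
    A > 0. *)
Lemma dyadic_density (A : set (Rn R n)) (q : R) : measurable A -> A `<=` Qo ->
  0 <= q < 1 ->
  (forall k m, cell Q k m `<=` Qo ->
    (mu (A `&` cell Q k m) <= q%:E * mu (cell Q k m))%E) ->
  mu A = 0%E.
Proof.
move=> mA AQ /andP[q0 q1] Aq.
have finA : mu A \is a fin_num.
  rewrite ge0_fin_numE//; apply: le_lt_trans muQo.
  by apply: le_measure => //; rewrite inE.
have := fineK finA; set a := fine (mu A) => aE.
apply/eqP; rewrite eq_le measure_ge0 andbT -aE lee_fin leNgt; apply/negP => a0.
(* Then q (a + 2 e) + e <= q a + 3 e = a - e < a. *)
pose e := a * (1 - q) / 4.
have e0 : 0 < e by rewrite divr_gt0// mulr_gt0// subr_gt0.
(* [A] is only Lebesgue measurable; a Borel cover of nearly the same outer measure takes its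
   place. *)
have [_ [B [mB AB] <-] Be] := lb_ereal_inf_adherent e0 finA.
rewrite -[ereal_inf _]/(mu A) -aE in Be.
pose BB := \bigcup_k B k.
have mBB' : measurable BB by exact: bigcupT_measurable.
have mBB : measurable (BB : set (Rn R n)) by exact: measurable_Borel.
have muBB : (mu BB <= (a + e)%:E)%E.
  rewrite EFinD; apply: le_trans (ltW Be); rewrite (lebesgue_Borel mBB').
  exact: measure_sigma_subadditive.
have [_ /(_ e e0)[k [S kS]]] := approximable_Borel mBB'.
set D := dyadic_set k S in kS.
have mD : measurable D by exact: measurable_dyadic_set.
pose F j : set (Rn R n) := if @pickle_inv index j is Some m then
  (if `[< S m /\ cell Q k m `<=` Qo >] then cell Q k m else set0) else set0.
have mF j : measurable (F j).
  by rewrite /F; case: pickle_inv => // m; case: ifP => // _; exact: measurable_cell.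
have tF : trivIset setT F.
  move=> i j _ _ [x []]; rewrite /F.
  have := @pickle_invK index i; have := @pickle_invK index j.
  case: (pickle_inv i) => [mi|//]; case: (pickle_inv j) => [mj|//] /= <- <-.
  by do 2 case: ifP => // _; move=> + <- => <-.
have FE : \bigcup_j F j = Qo `&` D.
  apply/seteqP; split => x.
    move=> [j _]; rewrite /F; case: pickle_inv => // m; case: ifP => // /asboolP[Sm mQ] xm.
    by split; [exact: mQ|rewrite /D /dyadic_set /= (xm : dyadic_index Q k x = m)].
  move=> [Qx Dx]; exists (pickle (dyadic_index Q k x)) => //; rewrite /F pickleK_inv.
  rewrite ifT//; apply/asboolP; split => //.
  exact: (half_open_cube_cell (erefl : cell Q k (dyadic_index Q k x) x)).
have mQD : measurable (Qo `&` D) by exact: measurableI.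
have ADq : (mu (A `&` D) <= q%:E * mu (Qo `&` D))%E.
  rewrite -FE measure_semi_bigcup//; last exact: bigcupT_measurable.
  rewrite -nneseriesZl//; last first.
  apply: (@le_trans _ _ (\sum_(j <oo) mu (A `&` F j))%E).
    apply: measure_sigma_subadditive.
    - by move=> j; exact: measurableI.
    - exact: measurableI.
    - move=> x [Ax Dx]; have : (Qo `&` D) x by split => //; exact: AQ.
      by rewrite -FE => -[j _ Fj]; exists j.
  apply: lee_nneseries => // j _; rewrite /F.
  case: pickle_inv => [m|]; last by rewrite setI0 !measure0 mule0.
  case: ifP => [/asboolP[_ mQ]|_]; first exact: Aq.
  by rewrite setI0 !measure0 mule0.
have muQD : (mu (Qo `&` D) <= (a + e + e)%:E)%E.
  rewrite EFinD; apply: (le_trans _ (leeD muBB kS)).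
  have mS : measurable (Qo `&` symdiff BB D).
    by apply: measurableI => //; exact: measurable_symdiff.
  apply: le_trans (measureU2 _ mBB mS).
  apply: le_measure; rewrite ?inE//; first exact: measurableU.
  move=> x [Qx Dx]; have [?|?] := pselect (BB x); [by left|right].
  by split => //; right.
have muAD : (mu (A `\` D) <= e%:E)%E.
  apply: le_trans kS; apply: le_measure; rewrite ?inE.
  - exact: measurableD.
  - by apply: measurableI => //; exact: measurable_symdiff.
  move=> x [Ax Dx]; split; first exact: AQ.
  by left; split => //; exact: AB.
have : (mu A <= (q * (a + e + e))%:E + e%:E)%E.
  rewrite -{1}(setUIDK A D).
  apply: (le_trans (measureU2 _ _ _)); [exact: measurableI|exact: measurableD|].
  apply: leeD => //; apply: (le_trans ADq); rewrite EFinM.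
  by apply: lee_wpmul2l.
rewrite -aE -EFinD lee_fin leNgt => /negP; apply.
have qe : q * e <= e by rewrite ler_piMl// ltW.
have : a * (1 - q) = 4 * e by rewrite /e mulrCA divff ?mulr1.
rewrite !mulrDr mulr1 mulrN (mulrC a q).
move: (q * a) (q * e) qe => u v ? ?; lra.
Qed.

End density.

(** * Calderon-Zygmund decomposition *)

Section stopping.
Context {R : realType} {n : nat} (Q : cube R n).
Local Notation mu := (@lebesgue R n).
Local Notation index := {ffun 'I_n -> int}.

(* Calderon-Zygmund stopping: the maximal dyadic subcubes in which E has
   relative measure greater than q. *)
Lemma stopping_cubes (E : set (Rn R n)) (q : R) : measurable E -> E `<=` Q ->
  0 < q < 1 -> (mu E <= q%:E * mu Q)%E ->
  exists (D : set nat) (P : nat -> cube R n) (H : nat -> set (Rn R n)),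
  [/\ forall i, D i -> [/\ H i `<=` P i, P i `<=` Q, mu (P i `\` H i) = 0%E,
        (q%:E * mu (P i) < mu (E `&` P i))%E &
        (mu (E `&` P i) <= (2 ^+ n * q)%:E * mu (P i))%E],
      forall i, ~ D i -> H i = set0,
      forall i, measurable (H i),
      trivIset setT H &
      mu (E `\` \bigcup_i H i) = 0%E].
Proof.
move=> mE EQ /andP[q0 q1] Eq.
have q01 : 0 <= q < 1 by rewrite ltW.
pose Qo := half_open_cube Q.
have mc k m : measurable (cell Q k m) by exact: measurable_cell.
have mQo : measurable Qo by exact: mc.
have mQ := measurable_cube Q.
pose bad k m := (q%:E * mu (cell Q k m) < mu (E `&` cell Q k m))%E.
(* A selected cell is bad and has no bad ancestor: selected cells are disjoint, and the parent of
   each one is not bad. *)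
pose sel (p : nat * index) := [/\ cell Q p.1 p.2 `<=` Qo, bad p.1 p.2 &
  forall j x, (j < p.1)%N -> cell Q p.1 p.2 x -> ~ bad j (dyadic_index Q j x)].
pose D : set nat := [set i | if pickle_inv i is Some p then sel p else False].
pose P i := if @pickle_inv (nat * index)%type i is Some p then dyadic_cube Q p.1 p.2 else Q.
pose H i : set (Rn R n) := if @pickle_inv (nat * index)%type i is Some p then
  (if `[< sel p >] then cell Q p.1 p.2 else set0) else set0.
have mEc k m : measurable (E `&` cell Q k m) by exact: measurableI.
have EcP k m : mu (E `&` dyadic_cube Q k m) = mu (E `&` cell Q k m).
  have mP := measurable_cube (dyadic_cube Q k m).
  apply/eqP; rewrite eq_le; apply/andP; split; last first.
    apply: le_measure; rewrite ?inE//; first exact: measurableI.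
    by apply: setIS; exact: cell_sub.
  have mD : measurable (dyadic_cube Q k m `\` cell Q k m) by exact: measurableD.
  rewrite -[leRHS]adde0 -(lebesgue_cell_diff Q k m).
  apply: le_trans (measureU2 _ (mEc k m) mD).
  apply: le_measure; rewrite ?inE//; [exact: measurableI|exact: measurableU|].
  move=> x [Ex Px]; have [?|?] := pselect (cell Q k m x); [by left|by right].
have sel_uniq p p' x : sel p -> sel p' -> cell Q p.1 p.2 x -> cell Q p'.1 p'.2 x -> p = p'.
  move=> [_ bp sp] [_ bp' sp'] xp xp'.
  have [pp'|pp'|pp'] := ltngtP p.1 p'.1.
  - exfalso; apply: (sp' _ _ pp' xp'); rewrite (xp : dyadic_index _ _ _ = _)//.
  - exfalso; apply: (sp _ _ pp' xp); rewrite (xp' : dyadic_index _ _ _ = _)//.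
  - apply: injective_projections => //; rewrite -xp -xp' pp'//.
have mH i : measurable (H i).
  by rewrite /H; case: pickle_inv => // p; case: ifP.
exists D, P, H; split => //.
- move=> i; rewrite /D /P /H /=; case: pickle_inv => // -[k m] kmsel.
  have [/= kmQ bkm skm] := kmsel.
  rewrite ifT; last exact/asboolP.
  have [x [Ex xkm]] : (E `&` cell Q k m) !=set0.
    apply/set0P/negP => /eqP E0; move: bkm; rewrite /bad E0 measure0.
    by rewrite ltNge mule_ge0// lee_fin ltW.
  split.
  + exact: cell_sub.
  + by apply: (dyadic_cube_sub xkm); exact: kmQ.
  + exact: lebesgue_cell_diff.
  + by rewrite -lebesgue_cell EcP.
  (* Generation 0 is excluded by the density of [E] in [Q]; otherwise the parent has density at most
     [q], and its volume is [2 ^+ n] times that of the cell. *)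
  + case: k => [|k] in kmsel kmQ bkm skm xkm *.
      exfalso; move: bkm; rewrite /bad ltNge => /negP; apply.
      have -> : m = [ffun=> 0] by rewrite -xkm; exact: kmQ.
      rewrite lebesgue_cell dyadic_cube0; apply: le_trans Eq.
      by apply: le_measure; rewrite ?inE//; move=> y [].
    have := skm k x (ltnSn k) xkm; rewrite /bad => /negP; rewrite -leNgt => Ex'.
    rewrite EcP; apply: (@le_trans _ _ (mu (E `&` cell Q k (dyadic_index Q k x)))).
      apply: le_measure; rewrite ?inE//; apply: setIS => y ykm.
      by apply: dyadic_indexS; rewrite (xkm : dyadic_index _ _ _ = _).
    apply: (le_trans Ex'); rewrite lebesgue_cell !lebesgue_cube -!EFinM lee_fin/=.
    rewrite !exprMn !exprVn [2 ^+ k.+1]exprS exprMn invfM.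
    rewrite [2 ^+ n * q]mulrC -!mulrA ler_pM2l// [leRHS]mulrCA.
    rewrite ler_pM2l ?exprn_gt0 ?side_gt0// mulrA divff ?mul1r//.
- move=> i; rewrite /D /H /=; case: pickle_inv => // p np; rewrite ifF//.
  by apply/asboolP.
- move=> i j _ _ [x []]; rewrite /H.
  have := @pickle_invK (nat * index)%type i; have := @pickle_invK (nat * index)%type j.
  case: (pickle_inv i) => [pi|//]; case: (pickle_inv j) => [pj|//] /= <- <-.
  case: ifP => // /asboolP si xi; case: ifP => // /asboolP sj xj.
  by rewrite (sel_uniq _ _ x si sj).
pose A := (E `&` Qo) `\` \bigcup_i H i.
have mUH : measurable (\bigcup_i H i) by exact: bigcupT_measurable.
have mA : measurable A by apply: measurableD => //; exact: measurableI.
(* A cell with a point of [A] is not bad: its first bad ancestor would be selected and would contain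
   the point. So [dyadic_density] applies. *)
have A0 : mu A = 0%E.
  apply: (@dyadic_density _ _ Q A q) => //.
  - by move=> x [[]].
  - move=> k m kmQ.
    have [->|/set0P[x [[[Ex Qx] nH] xkm]]] := eqVneq (A `&` cell Q k m) set0.
      by rewrite measure0 mule_ge0// lee_fin ltW.
    apply: (@le_trans _ _ (mu (E `&` cell Q k m))).
      by apply: le_measure; rewrite ?inE//; [exact: measurableI|apply: setSI => y [[]]].
    rewrite leNgt; apply/negP => bkm; apply: nH.
    have ex : exists j, `[< bad j (dyadic_index Q j x) >].
      by exists k; apply/asboolP; rewrite (xkm : dyadic_index _ _ _ = _).
    case: (ex_minnP ex) => j /asboolP bj jmin.
    exists (pickle (j, dyadic_index Q j x)) => //.
    rewrite /H pickleK_inv ifT//; apply/asboolP; split => //=.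
    + exact: (half_open_cube_cell (erefl : cell Q j (dyadic_index Q j x) x)).
    + move=> i y ij yj by_; have := jmin i; rewrite leqNgt ij => /(_ _)/negP; apply => //.
      apply/asboolP; rewrite (@dyadic_index_le _ _ Q i j x y)//; first exact: ltnW.
have mD : measurable (Q `\` Qo) by exact: measurableD.
apply/eqP; rewrite eq_le measure_ge0 andbT.
rewrite -[leRHS]adde0 -{1}A0 -(lebesgue_half_open_cube_diff Q).
apply: le_trans (measureU2 _ mA mD).
apply: le_measure; rewrite ?inE//; [exact: measurableD|exact: measurableU|].
move=> x [Ex nH]; have [?|?] := pselect (Qo x); [by left|right; split => //; exact: EQ].
Qed.

End stopping.

(** * Mean oscillation of bounded functions *)

Section oscillation.
Context {R : realType} {n : nat}.
Local Notation mu := (@lebesgue R n).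
Implicit Types P Q : cube R n.

Lemma ge0_integralID d (T : measurableType d) (m : {measure set T -> \bar R})
    (A B : set T) (f : T -> \bar R) : measurable A -> measurable B -> B `<=` A ->
  measurable_fun A f -> (forall x, A x -> (0 <= f x)%E) ->
  (\int[m]_(x in A) f x = \int[m]_(x in B) f x + \int[m]_(x in A `\` B) f x)%E.
Proof.
move=> mA mB BA mf f0; have AE := setDUK BA.
rewrite -{1}AE ge0_integral_setU//.
- exact: measurableD.
- by rewrite AE.
- by rewrite AE.
- by apply/disj_setPS => x [? []].
Qed.

Lemma measurable_absB (A : set (Rn R n)) (f : Rn R n -> R) (c : R) :
  measurable_fun A f -> measurable_fun A (fun x => `|f x - c|).
Proof.
move=> mf; apply: (measurableT_comp (@normr_measurable R setT)).
by apply: measurable_funB.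
Qed.

Lemma fine_lebesgue_cube P : mu P = (fine (mu P))%:E.
Proof. by rewrite lebesgue_cube. Qed.

Lemma fine_lebesgue_cube_gt0 P : 0 < fine (mu P).
Proof. by rewrite lebesgue_cube/= exprn_gt0 ?side_gt0. Qed.

Section bounded.
Context (Q0 : cube R n) (s M : R) (f G : Rn R n -> R) (a c : cube R n -> R).
Hypotheses (s0 : 0 < s) (s1 : s <= (8 * 2 ^+ n)^-1) (M0 : 0 <= M).
Hypotheses (mf : measurable_fun Q0 f) (fM : forall x, `|f x| <= M).
Hypotheses (mG : measurable_fun Q0 G) (G0 : forall x, cube_set Q0 x -> 0 <= G x).
Hypothesis ac : forall P, P `<=` Q0 -> [/\ 0 <= a P <= 2 * M, `|c P| <= M,
  (mu (P `&` [set x | (a P < `|f x - c P|)%R]) <= s%:E * mu P)%E &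
  {ae mu, forall x, cube_set P x -> a P <= G x}].

Let E P := P `&` [set x | a P < `|f x - c P|].

Let mQ0 := measurable_cube Q0.

Let mfP P : P `<=` Q0 -> measurable_fun P f.
Proof. by move=> PQ; exact: measurable_funS mf. Qed.

Let mGP P : P `<=` Q0 -> measurable_fun P G.
Proof. by move=> PQ; exact: measurable_funS mG. Qed.

Let mE P : P `<=` Q0 -> measurable (E P).
Proof.
move=> PQ; apply: measurable_superlevel; first exact: measurable_cube.
by apply: measurable_absB; exact: mfP.
Qed.

(** The stopping density. With it [E P] fills at most [2 ^+ n * q] = 1/2 of a stopped cube, which
    leaves room for the exceptional set of that cube, while [s <= q / 4] bounds the total volume of
    the stopped cubes by a quarter of that of [P]. *)
Let q : R := (2 * 2 ^+ n)^-1.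

Let q_gt0 : 0 < q. Proof. by rewrite invr_gt0 mulr_gt0 ?exprn_gt0. Qed.

Let q_lt1 : q < 1.
Proof.
rewrite invf_lt1 ?mulr_gt0 ?exprn_gt0//.
have : 1 <= 2 ^+ n :> R by rewrite exprn_ege1// ler1n.
lra.
Qed.

Let qE : 2 ^+ n * q = 2^-1.
Proof. by rewrite /q invfM mulrCA divff ?mulr1// gt_eqF// exprn_gt0. Qed.

Let sq : s <= q / 4.
Proof.
apply: (le_trans s1); rewrite /q -invfM lef_pV2 ?posrE ?mulr_gt0 ?exprn_gt0//.
have : 0 < 2 ^+ n :> R by rewrite exprn_gt0.
lra.
Qed.

(* The exceptional sets of P and of P' together do not exhaust P', so that the
   two medians are comparable. *)
Let comparable P P' : P `<=` Q0 -> P' `<=` P ->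
  (mu (E P `&` P') <= (2 ^+ n * q)%:E * mu P')%E ->
  `|c P - c P'| <= a P + a P'.
Proof.
move=> PQ P'P EP.
have P'Q : P' `<=` Q0 by apply: subset_trans PQ.
have [y [Py [yP yP']]] : exists y, cube_set P' y /\ (~ E P y /\ ~ E P' y).
  apply: contrapT => /forallNP H.
  have sub : P' `<=` (E P `&` P') `|` E P'.
    move=> y Py; have [?|nP] := pselect (E P y); first by left.
    right; apply: contrapT => nP'; exact: (H y).
  have mE1 : measurable (E P `&` P').
    by apply: measurableI; [exact: mE|exact: measurable_cube].
  have : (mu P' <= (2 ^+ n * q)%:E * mu P' + s%:E * mu P')%E.
    have [_ _ EP' _] := ac P'Q.
    apply: le_trans (leeD EP EP'); apply: le_trans (measureU2 _ mE1 (mE P'Q)).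
    apply: le_measure; rewrite ?inE//; first exact: measurable_cube.
    by apply: measurableU => //; exact: mE.
  rewrite (fine_lebesgue_cube P') -!EFinM -EFinD lee_fin -mulrDl qE.
  rewrite -{1}[fine _]mul1r ler_pM2r ?fine_lebesgue_cube_gt0//.
  by have := sq; have := q_lt1; lra.
have y1 : `|f y - c P| <= a P.
  by rewrite leNgt; apply/negP => ?; apply: yP; split => //; exact: P'P.
have y2 : `|f y - c P'| <= a P'.
  by rewrite leNgt; apply/negP => ?; apply: yP'; split.
rewrite (_ : c P - c P' = (f y - c P') - (f y - c P)); last by lra.
by apply: (le_trans (ler_normB _ _)); rewrite addrC; exact: lerD.
Qed.

Let piece (H : set (Rn R n)) P P' : measurable H -> H `<=` Q0 ->
  `|c P - c P'| <= a P + a P' ->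
  (\int[mu]_(x in H) `|f x - c P|%:E <= (a P)%:E * mu H +
    (\int[mu]_(x in H) `|f x - c P'|%:E + (a P')%:E * mu H))%E.
Proof.
move=> mH HQ cPP'.
have mfH c' : measurable_fun H (fun x => `|f x - c'|%:E).
  apply/measurable_EFinP; apply: measurable_absB.
  exact: (measurable_funS mQ0 HQ mf).
have a0 : 0 <= a P + a P' by apply: le_trans cPP'.
have mc : measurable_fun H (cst (a P + a P')%:E) by exact: measurable_cst.
have abs0 c' x : H x -> (0 <= `|f x - c'|%:E)%E by rewrite lee_fin.
have cst0 x : H x -> (0 <= cst (a P + a P')%:E x)%E by rewrite lee_fin.
have muH : mu H \is a fin_num.
  rewrite ge0_fin_numE//; apply: (@le_lt_trans _ _ (mu Q0)).
    by apply: le_measure; rewrite ?inE.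
  by rewrite lebesgue_cube ltry.
apply: (@le_trans _ _ (\int[mu]_(x in H) (`|f x - c P'|%:E + cst (a P + a P')%:E x))%E).
  apply: (ge0_le_integral mu mH (abs0 (c P)) (mfH _)).
    exact: emeasurable_funD (mfH _) mc.
  move=> x _; rewrite /= -EFinD lee_fin.
  rewrite (_ : f x - c P = (f x - c P') - (c P - c P')); last by lra.
  by apply: (le_trans (ler_normB _ _)); rewrite lerD2l.
rewrite (ge0_integralD mu mH (abs0 (c P')) (mfH _) cst0 mc) integral_cst//.
by rewrite EFinD muleDl// addeCA.
Qed.

Let integral_null_diff (A B : set (Rn R n)) (g : Rn R n -> \bar R) :
  measurable A -> measurable B -> B `<=` A -> mu (A `\` B) = 0%E ->
  measurable_fun A g -> (forall x, A x -> (0 <= g x)%E) ->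
  (\int[mu]_(x in B) g x = \int[mu]_(x in A) g x)%E.
Proof.
move=> mA mB BA AB0 mg g0; rewrite (ge0_integralID mu mA mB BA mg g0).
have mAB : measurable (A `\` B) by exact: measurableD.
rewrite [X in (_ + X)%E](null_set_integral mAB _ AB0) ?adde0//.
exact: (measurable_funS mA (@subDsetl _ A B) mg).
Qed.

(** Off the stopped cubes, |f - c P| <= a P almost everywhere. On a stopped cube S the constant
    [c P] is changed to [c S] at the cost a P + a S; the summand [a P * mu P] on the left of the
    estimate is there so that the induction hypothesis on S pays the a S. The remainder gets
    multiplied by mu T / mu P <= 1/4. What is left is 2 a P mu P <= 4 a P mu V <= 4 int_V G, since
    [V] fills more than half of [P]: hence the constant 4. *)
Let step (k : R) : 0 <= k ->
  (forall P, P `<=` Q0 -> (\int[mu]_(x in P) `|f x - c P|%:E + (a P)%:E * mu P <=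
    4%:E * \int[mu]_(x in P) (G x)%:E + k%:E * mu P)%E) ->
  (forall P, P `<=` Q0 -> (\int[mu]_(x in P) `|f x - c P|%:E + (a P)%:E * mu P <=
    4%:E * \int[mu]_(x in P) (G x)%:E + (k / 4)%:E * mu P)%E).
Proof.
move=> k0 IH P PQ.
have [/andP[a0 _] _ EPs aG] := ac PQ.
have mP := measurable_cube P.
have [] := @stopping_cubes _ _ P (E P) q.
- exact: mE.
- by move=> x [].
- by rewrite q_gt0.
- apply: (le_trans EPs); apply: lee_wpmul2r => //; rewrite lee_fin.
  by have := sq; have := q_gt0; lra.
move=> D [S [H [DSH H0 mH tH EH]]].
pose T := \bigcup_i H i; pose V := P `\` T.
have mT : measurable T by exact: bigcupT_measurable.
have mV : measurable V by exact: measurableD.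
have HP i : H i `<=` P.
  have [Di|nDi] := pselect (D i); last by rewrite H0.
  by have [HS SP _ _ _] := DSH _ Di; apply: subset_trans SP.
have TP : T `<=` P by move=> x [i _]; exact: HP.
have VP : V `<=` P by move=> x [].
have mfc c' A : A `<=` P -> measurable_fun A (fun x => `|f x - c'|%:E).
  move=> AP; apply/measurable_EFinP; apply: measurable_absB.
  by apply: (measurable_funS mP AP); exact: mfP.
have mGA A : A `<=` P -> measurable_fun A (EFin \o G).
  by move=> AP; apply/measurable_EFinP; apply: (measurable_funS mP AP); exact: mGP.
have GA A : A `<=` P -> forall x, A x -> (0 <= (G x)%:E)%E.
  by move=> AP x Ax; rewrite lee_fin; apply: G0; apply: PQ; exact: AP.
pose r := fine (mu P).
have rE : mu P = r%:E by exact: fine_lebesgue_cube.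
have r0 : 0 < r by exact: fine_lebesgue_cube_gt0.
have muT : mu T = (\sum_(i <oo) mu (H i))%E by exact: measure_semi_bigcup.
have finT : mu T \is a fin_num.
  rewrite ge0_fin_numE// (@le_lt_trans _ _ (mu P))//; last by rewrite rE ltry.
  by apply: le_measure => //; rewrite inE.
pose t := fine (mu T).
have tE : mu T = t%:E by rewrite fineK.
have HS i : D i -> mu (S i) = mu (H i).
  move=> Di; have [HiS _ SH0 _ _] := DSH _ Di.
  rewrite -(setDUK HiS) measureU0//.
  by apply: measurableD => //; exact: measurable_cube.
have tr : t <= r / 4.
  have : (q%:E * mu T <= s%:E * mu P)%E.
    apply: (@le_trans _ _ (mu (E P `&` T))); last first.
      apply: le_trans EPs; apply: le_measure; rewrite ?inE//.
      - by apply: measurableI => //; exact: mE.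
      - exact: mE.
    rewrite muT -nneseriesZl// setI_bigcupr measure_semi_bigcup//; last 3 first.
    - by move=> i; apply: measurableI => //; exact: mE.
    - exact: trivIset_setIl.
    - by apply: bigcupT_measurable => i; apply: measurableI => //; exact: mE.
    apply: lee_nneseries => [i _ _|i _]; first by rewrite mule_ge0// lee_fin ltW.
    have [Di|nDi] := pselect (D i); last by rewrite H0// setI0 !measure0 mule0.
    have [HiS SP SH0 Sq _] := DSH _ Di.
    rewrite -HS//; apply: (le_trans (ltW Sq)).
    have mS := measurable_cube (S i).
    rewrite -[leRHS]adde0 -SH0.
    have mEH : measurable (E P `&` H i) by apply: measurableI => //; exact: mE.
    have mSH : measurable (S i `\` H i) by exact: measurableD.
    apply: le_trans (measureU2 _ mEH mSH).
    apply: le_measure; rewrite ?inE.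
    - by apply: measurableI => //; exact: mE.
    - exact: measurableU.
    - move=> x [Ex Sx]; have [?|?] := pselect (H i x); [by left|by right].
  rewrite tE rE -!EFinM lee_fin => qt.
  have : q * t <= q * (r / 4).
    apply: (le_trans qt); rewrite [leRHS]mulrA -[_ * r / 4]mulrAC.
    by rewrite ler_pM2r.
  by rewrite ler_pM2l.
have Poo : (mu P < +oo)%E by rewrite rE ltry.
have vE : mu V = (r - t)%:E.
  by rewrite EFinB -rE -tE -[X in (_ - mu X)%E](setIidr TP) -measureD.
have intV : (\int[mu]_(x in V) `|f x - c P|%:E <= (a P)%:E * mu V)%E.
  rewrite -integral_cst//; apply: (ae_ge0_le_integral mV).
  - by move=> x _; rewrite lee_fin.
  - exact: mfc.
  - by move=> x _; rewrite lee_fin.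
  - exact: measurable_cst.
  exists (E P `\` T); split => //; first by apply: measurableD => //; exact: mE.
  move=> x /= /not_implyP[[Px nT]] /negP; rewrite lee_fin -ltNge => fx.
  by split.
have GV : ((a P)%:E * mu V <= \int[mu]_(x in V) (G x)%:E)%E.
  rewrite -integral_cst//; apply: (ae_ge0_le_integral mV).
  - by move=> x _; rewrite lee_fin.
  - exact: measurable_cst.
  - exact: GA.
  - exact: mGA.
  apply: filterS aG => x xG Vx; rewrite lee_fin; apply: xG; exact: VP.
have GT : (\int[mu]_(x in T) (G x)%:E = \sum_(i <oo) \int[mu]_(x in H i) (G x)%:E)%E.
  exact: (ge0_integral_bigcup mu mH (mGA _ TP) (GA _ TP) tH).
have intT : (\int[mu]_(x in T) `|f x - c P|%:E <=
    (a P)%:E * mu T + 4%:E * \int[mu]_(x in T) (G x)%:E + k%:E * mu T)%E.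
  have f0 x : T x -> (0 <= `|f x - c P|%:E)%E by rewrite lee_fin.
  rewrite (ge0_integral_bigcup mu mH (mfc (c P) _ TP) f0 tH).
  rewrite GT muT -!nneseriesZl//; last first.
    by move=> i _; apply: integral_ge0 => x; exact: GA.
  have iG0 i : (0 <= 4%:E * \int[mu]_(x in H i) (G x)%:E)%E.
    by rewrite mule_ge0//; apply: integral_ge0 => x; exact: GA.
  rewrite -!nneseriesD//; try by move=> i _ _; rewrite ?adde_ge0// mule_ge0.
  apply: lee_nneseries => [i _ _|i _]; first exact: integral_ge0.
  have [Di|nDi] := pselect (D i); last first.
    by rewrite H0// !integral_set0 !measure0 !mule0 !adde0.
  have [HiS SP SH0 _ Sq] := DSH _ Di.
  have SQ : S i `<=` Q0 by apply: subset_trans PQ.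
  have mS := measurable_cube (S i).
  have [/andP[aS0 _] _ _ _] := ac SQ.
  have cc := comparable PQ SP Sq.
  rewrite -addeA; apply: (le_trans (piece (mH i) (subset_trans (HP i) PQ) cc)).
  apply: leeD2l.
  rewrite (integral_null_diff mS (mH i) HiS SH0 (mGA _ SP) (GA _ SP)).
  rewrite -HS//; apply: le_trans (IH _ SQ); apply: leeD2r.
  by apply: (ge0_subset_integral mu (mH i) mS (mfc _ _ SP) _ HiS) => x _; rewrite lee_fin.
have abs0 x : cube_set P x -> (0 <= `|f x - c P|%:E)%E by rewrite lee_fin.
rewrite (ge0_integralID mu mP mT TP (mfc (c P) _ (@subset_refl _ P)) abs0).
rewrite (ge0_integralID mu mP mT TP (mGA _ (@subset_refl _ P)) (GA _ (@subset_refl _ P))).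
apply: (le_trans (leeD (leeD intT intV) (lexx _))).
have iT0 : (0 <= \int[mu]_(x in T) (G x)%:E)%E by apply: integral_ge0; exact: GA.
have iV0 : (0 <= \int[mu]_(x in V) (G x)%:E)%E by apply: integral_ge0; exact: GA.
rewrite (ge0_muleDr _ iT0 iV0).
have : ((a P)%:E * mu T + k%:E * mu T + (a P)%:E * mu V + (a P)%:E * mu P <=
  4%:E * \int[mu]_(x in V) (G x)%:E + (k / 4)%:E * mu P)%E.
  apply: (@le_trans _ _ (4%:E * ((a P)%:E * mu V) + (k / 4)%:E * mu P)%E); last first.
    by rewrite leeD2r// lee_wpmul2l.
  rewrite vE tE rE -!EFinM -!EFinD lee_fin.
  have : 0 <= a P * (r / 2 - t) by rewrite mulr_ge0//; lra.
  have : 0 <= k * (r / 4 - t) by rewrite mulr_ge0//; lra.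
  by nra.
move=> sum_le.
rewrite -[leRHS]addeA; apply: le_trans (leeD2l _ sum_le).
by rewrite (addeC ((a P)%:E * mu T)%E (4%:E * _)%E) -!addeA.
Qed.

Lemma bounded_oscillation P : P `<=` Q0 ->
  (\int[mu]_(x in P) `|f x - c P|%:E <= 4%:E * \int[mu]_(x in P) (G x)%:E)%E.
Proof.
have M4 : 0 <= 4 * M by rewrite mulr_ge0.
(* For k = 0 both summands are at most 2 M mu P; each use of [step] divides the remainder by 4. *)
have iter k : forall P, P `<=` Q0 ->
    (\int[mu]_(x in P) `|f x - c P|%:E + (a P)%:E * mu P <=
     4%:E * \int[mu]_(x in P) (G x)%:E + (4 * M / 4 ^+ k)%:E * mu P)%E.
  elim: k => [|k ih] {}P PQ.
    have [/andP[a0 aM] cM _ _] := ac PQ.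
    have mP := measurable_cube P.
    rewrite expr0 divr1.
    have iG0 : (0 <= 4%:E * \int[mu]_(x in P) (G x)%:E)%E.
      rewrite mule_ge0//; apply: integral_ge0 => x Px; rewrite lee_fin.
      by apply: G0; exact: PQ.
    apply: le_trans (leeDr _ iG0).
    apply: (@le_trans _ _ ((2 * M)%:E * mu P + (2 * M)%:E * mu P)%E).
      apply: leeD; last by apply: lee_wpmul2r => //; rewrite lee_fin.
      rewrite -integral_cst//; apply: (ge0_le_integral mu mP).
      - by move=> x _; rewrite lee_fin.
      - by apply/measurable_EFinP; apply: measurable_absB; exact: mfP.
      - exact: measurable_cst.
      move=> x _; rewrite /= lee_fin; apply: (le_trans (ler_normB _ _)).
      by have := fM x; lra.
    rewrite fine_lebesgue_cube -!EFinM -EFinD lee_fin.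
    by rewrite -mulrDl ler_wpM2r//; [exact/ltW/fine_lebesgue_cube_gt0|lra].
  have := step _ ih PQ; rewrite exprS invfM mulrCA (mulrC 4^-1); apply.
  by rewrite divr_ge0// exprn_ge0.
move=> PQ; have [/andP[a0 _] _ _ _] := ac PQ.
apply/lee_addgt0Pr => e e0.
have r0 := fine_lebesgue_cube_gt0 P.
pose K := (4 * M * fine (mu P)).
have [k ke] : exists k, K / 4 ^+ k <= e.
  have K0 : 0 <= K by rewrite mulr_ge0// ltW.
  exists (Num.truncn (K / e)).+1.
  rewrite ler_pdivrMr ?exprn_gt0// -ler_pdivrMl// mulrC.
  apply: (le_trans (ltW (truncnS_gt _))).
  by rewrite -natrX ler_nat ltnW// ltn_expl.
have h := iter k P PQ.
apply: (@le_trans _ _ (\int[mu]_(x in P) `|f x - c P|%:E + (a P)%:E * mu P)%E).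
  by rewrite leeDl// mule_ge0.
apply: (le_trans h); rewrite leeD2l// fine_lebesgue_cube -EFinM lee_fin.
by rewrite mulrAC.
Qed.

End bounded.

End oscillation.

(** * Two-sided truncation *)

Section clamp.
Context {R : realType}.
Implicit Types M x y : R.

Definition clamp M x : R := Num.max (- M) (Num.min M x).

Lemma clampP M x : 0 <= M -> [\/ clamp M x = x /\ - M <= x <= M,
  clamp M x = M /\ M <= x | clamp M x = - M /\ x <= - M].
Proof.
move=> M0; rewrite /clamp; have [Mx|xM] := leP M x.
  by constructor 2; split => //; rewrite (max_idPr _)//; lra.
have [Mx|{}xM] := leP (- M) x; last by constructor 3; split => //; exact: ltW.
by constructor 1; split => //=; rewrite ltW.
Qed.

Lemma clamp_dist M x y : 0 <= M -> `|clamp M x - clamp M y| <= `|x - y|.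
Proof.
move=> M0; have := ler_norm (x - y); have := ler_norm (- (x - y)).
rewrite normrN => ? ?; rewrite ler_norml.
by case: (clampP x M0) => -[-> ?]; case: (clampP y M0) => -[-> ?];
  apply/andP; split; lra.
Qed.

Lemma clamp_bound M x : 0 <= M -> `|clamp M x| <= M.
Proof.
by move=> M0; rewrite ler_norml; case: (clampP x M0) => -[-> ?]; apply/andP; split; lra.
Qed.

Lemma clamp_id M x : `|x| <= M -> clamp M x = x.
Proof.
move=> xM; have M0 : 0 <= M by exact: le_trans xM.
move: xM; rewrite ler_norml => /andP[? ?].
by case: (clampP x M0) => -[-> ?]; lra.
Qed.

(** With [clamp_dist] this makes |clamp M x - clamp M y| nondecreasing in [M], as monotone
    convergence requires. *)
Lemma clamp_clamp M M' x : 0 <= M -> M <= M' -> clamp M (clamp M' x) = clamp M x.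
Proof.
move=> M0 MM'; have M'0 : 0 <= M' by exact: le_trans MM'.
case: (clampP x M'0) => -[-> ?] //; case: (clampP x M0) => -[-> ?].
- by rewrite clamp_id; [lra|rewrite ler_norml; apply/andP; split; lra].
- by case: (clampP M' M0) => -[-> ?]; lra.
- by case: (clampP M' M0) => -[-> ?]; lra.
- by case: (clampP (- M') M0) => -[-> ?]; lra.
- by case: (clampP (- M') M0) => -[-> ?]; lra.
- by case: (clampP (- M') M0) => -[-> ?]; lra.
Qed.

Lemma measurable_clamp d (T : measurableType d) (D : set T) M (f : T -> R) :
  measurable_fun D f -> measurable_fun D (fun t => clamp M (f t)).
Proof.
move=> mf; apply: measurable_maxr; first exact: measurable_cst.
by apply: measurable_minr => //; exact: measurable_cst.
Qed.

End clamp.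

(** * A multiple of the sharp maximal function lies in [Gamma] *)

Section upper_bound.
Context {R : realType} {n : nat}.
Local Notation mu := (@lebesgue R n).
Implicit Types P Q : cube R n.

(** Reduction to bounded functions: clamping [f] and the constants at level [k] shrinks the
    exceptional sets, because clamping is 1-Lipschitz, and the integrals increase to that of |f - c
    P|. *)
Lemma oscillation_integral (Q0 : cube R n) (s : R) (f G : Rn R n -> R)
    (a c : cube R n -> R) : s <= (8 * 2 ^+ n)^-1 ->
  measurable_fun Q0 f -> measurable_fun Q0 G ->
  (forall x, cube_set Q0 x -> 0 <= G x) ->
  (forall P, P `<=` Q0 -> [/\ 0 <= a P,
    (mu (P `&` [set x | (a P < `|f x - c P|)%R]) <= s%:E * mu P)%E &
    {ae mu, forall x, cube_set P x -> a P <= G x}]) ->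
  forall P, P `<=` Q0 ->
  (\int[mu]_(x in P) `|f x - c P|%:E <= 4%:E * \int[mu]_(x in P) (G x)%:E)%E.
Proof.
move=> s1 mf mG G0 ac P PQ.
have mP := measurable_cube P.
have mQ0 := measurable_cube Q0.
have mfP : measurable_fun P f by exact: (measurable_funS mQ0 PQ mf).
pose g (k : nat) x := `|clamp k%:R (f x) - clamp k%:R (c P)|%:E.
have mg k : measurable_fun P (g k).
  by apply/measurable_EFinP; apply: measurable_absB; exact: measurable_clamp.
have g0 k x : cube_set P x -> (0 <= g k x)%E by rewrite lee_fin.
have ndg x : cube_set P x -> {homo g ^~ x : i j / (i <= j)%N >-> (i <= j)%E}.
  move=> _ i j ij; rewrite lee_fin.
  rewrite -(@clamp_clamp _ i%:R j%:R (f x)) ?ler_nat//.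
  rewrite -(@clamp_clamp _ i%:R j%:R (c P)) ?ler_nat//.
  exact: clamp_dist.
have limg x : limn (g ^~ x) = `|f x - c P|%:E.
  apply/cvg_lim => //; apply: cvg_near_cst.
  exists (maxn (Num.truncn `|f x|).+1 (Num.truncn `|c P|).+1) => // k /= ck.
  rewrite /g !clamp_id//.
    by apply: (le_trans (ltW (truncnS_gt _))); rewrite ler_nat (leq_trans _ ck)// leq_maxr.
  by apply: (le_trans (ltW (truncnS_gt _))); rewrite ler_nat (leq_trans _ ck)// leq_maxl.
rewrite (eq_integral (fun x => limn (g ^~ x))); last by move=> x _; rewrite limg.
have cvgI := @cvg_monotone_convergence _ _ _ mu _ mP _ mg g0 ndg.
rewrite -(cvg_lim _ cvgI)//; apply: lime_le; first by apply/cvg_ex; eexists; exact: cvgI.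
near=> k.
have mfk : measurable_fun Q0 (fun x => clamp k%:R (f x)) by exact: measurable_clamp.
have fk (x : Rn R n) : `|clamp k%:R (f x)| <= k%:R by exact: clamp_bound.
(* Clamped values differ by at most 2 k, so [a P] may be lowered to the minimum of [a P] and 2 k
   without enlarging the exceptional set beyond that of [f]; this is the range asked for in the
   bounded case. *)
apply: (@bounded_oscillation _ _ Q0 s k%:R (fun x => clamp k%:R (f x)) G
  (fun P => Num.min (a P) (2 * k%:R)) (fun P => clamp k%:R (c P)) s1
  (ler0n _ _) mfk fk mG G0 _ P PQ).
move=> {PQ mP mfP g mg g0 ndg limg cvgI}P PQ; have [a0 acs aG] := ac P PQ.
have mP := measurable_cube P.
split.
- by rewrite le_min a0 mulr_ge0//= ge_min lexx orbT.
- exact: clamp_bound.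
- apply: le_trans acs; apply: le_measure.
  + rewrite inE; apply: (measurable_superlevel _ mP); apply: measurable_absB.
    exact: (measurable_funS mQ0 PQ mfk).
  + rewrite inE; apply: (measurable_superlevel _ mP); apply: measurable_absB.
    exact: (measurable_funS mQ0 PQ mf).
  move=> x [Px] /=; rewrite gt_min => /orP[ax|kx]; split => //=.
    by apply: (lt_le_trans ax); exact: clamp_dist.
  exfalso; move: kx; apply/negP; rewrite -leNgt.
  apply: (le_trans (ler_normB _ _)).
  have := @clamp_bound R k%:R (f x); have := @clamp_bound R k%:R (c P).
  by rewrite ler0n => /(_ isT) + /(_ isT); lra.
- by apply: filterS aG => x xG Px; rewrite ge_min xG.
Unshelve. all: by end_near. Qed.

(** The integral of a nonnegative function is a supremum over the simple functions below it, and the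
    larger function has more of them. In this form the lemma applies to inner integrals whose
    measurability is not at hand. *)
Lemma le_integral_nonneg d (T : measurableType d) (m : {measure set T -> \bar R})
    (D : set T) (f g : T -> \bar R) :
  (forall x, D x -> (0 <= f x)%E) -> (forall x, D x -> (f x <= g x)%E) ->
  (\int[m]_(x in D) f x <= \int[m]_(x in D) g x)%E.
Proof.
move=> f0 fg.
have g0 x : D x -> (0 <= g x)%E by move=> Dx; exact: le_trans (f0 _ Dx) (fg _ Dx).
rewrite !ge0_integralE//; apply: le_ereal_sup => _ [h hf <-]; exists h => //= x.
apply: (le_trans (hf x)); rewrite !patchE; case: ifPn => // /set_mem; exact: fg.
Qed.

Lemma double_integral_le P (f : Rn R n -> R) (c : R) : measurable_fun P f ->
  (\int[mu]_(x in P) \int[mu]_(y in P) `|f x - f y|%:E <=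
   (2 * fine (mu P))%:E * \int[mu]_(x in P) `|f x - c|%:E)%E.
Proof.
move=> mf; have mP := measurable_cube P.
have mfc : measurable_fun P (fun x => `|f x - c|%:E).
  by apply/measurable_EFinP; exact: measurable_absB.
set I := (\int[mu]_(x in P) `|f x - c|%:E)%E.
have fc0 x : cube_set P x -> (0 <= `|f x - c|%:E)%E by rewrite lee_fin.
have I0 : (0 <= I)%E by exact: integral_ge0.
have r0 : 0 <= fine (mu P) by exact/ltW/fine_lebesgue_cube_gt0.
apply: (@le_trans _ _ (\int[mu]_(x in P) ((fine (mu P))%:E * `|f x - c|%:E + cst I x))%E).
  apply: le_integral_nonneg => x Px.
    by apply: integral_ge0 => y _; rewrite lee_fin.
  apply: (@le_trans _ _ (\int[mu]_(y in P) (cst `|f x - c|%:E y + `|f y - c|%:E))%E).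
    apply: le_integral_nonneg => y Py; first by rewrite lee_fin.
    rewrite /= -EFinD lee_fin (_ : f x - f y = (f x - c) - (f y - c)); last by lra.
    exact: ler_normB.
  have c0 y : cube_set P y -> (0 <= cst `|f x - c|%:E y)%E by rewrite lee_fin.
  rewrite (ge0_integralD mu mP c0 (measurable_cst _) fc0 mfc).
  rewrite integral_cst// -fine_lebesgue_cube.
  by rewrite muleC.
have cI0 x : cube_set P x -> (0 <= cst I x)%E by [].
rewrite (ge0_integralD mu mP _ _ cI0 (measurable_cst _)).
- rewrite (ge0_integralZl_EFin mu mP fc0 mfc r0) integral_cst//.
  rewrite -/I [(I * _)%E]muleC.
  by rewrite EFinM -muleA mule_natl mule2n -fine_lebesgue_cube.
- by move=> x _; rewrite mule_ge0// lee_fin.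
- by apply: emeasurable_funM => //; exact: measurable_cst.
Qed.

Lemma local_osc_ge0 (s : R) f P : (0 <= local_osc s f P)%E.
Proof.
apply: le_ereal_inf_tmp => _ [c _ <-]; apply: le_ereal_inf_tmp => _ [a [a0 _] <-].
by rewrite lee_fin.
Qed.

Lemma local_osc_ltP (s y : R) f P : (local_osc s f P < y%:E)%E ->
  exists a c, [/\ 0 <= a, a < y &
    (mu (P `&` [set x | (a < `|f x - c|)%R]) < s%:E * mu P)%E].
Proof.
move=> /ereal_inf_lt[_ [c _ <-]] /ereal_inf_lt[_ [a [a0 aP] <-]].
by rewrite lte_fin => ay; exists a, c.
Qed.

Lemma local_osc_le_sharp_maximal Q0 (s : R) f P x : P `<=` Q0 -> cube_set P x ->
  (local_osc s f P <= sharp_maximal Q0 s f x)%E.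
Proof. by move=> PQ Px; apply: ereal_sup_ubound; exists P. Qed.

Lemma sharp_maximal_ge0 Q0 (s : R) f x : cube_set Q0 x ->
  (0 <= sharp_maximal Q0 s f x)%E.
Proof.
move=> Qx; apply: (le_trans (local_osc_ge0 s f Q0)).
exact: local_osc_le_sharp_maximal.
Qed.

Lemma cube_ae_nonempty P (p : Rn R n -> Prop) :
  {ae mu, forall x, cube_set P x -> p x} -> exists2 x, cube_set P x & p x.
Proof.
move=> [N [mN N0 sub]]; apply: contrapT => np.
have PN : P `<=` N.
  by move=> x Px; apply: sub => /= /(_ Px) px; apply: np; exists x.
have : (mu P <= mu N)%E by apply: le_measure; rewrite ?inE//; exact: measurable_cube.
rewrite N0 (fine_lebesgue_cube P) lee_fin leNgt => /negP; apply.
exact: fine_lebesgue_cube_gt0.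
Qed.

(** The two series are compared term by term. On one cube 8 = 2 * 4, with 2 from
    [double_integral_le] and 4 from [oscillation_integral]. *)
Lemma sharp_maximal_Gamma Q0 (s : R) f : s <= (8 * 2 ^+ n)^-1 -> L1 Q0 f ->
  {ae mu, forall x, cube_set Q0 x -> sharp_maximal Q0 s f x \is a fin_num} ->
  L1 Q0 (fine \o sharp_maximal Q0 s f) ->
  Gamma Q0 f (fun x => 8 * (fine \o sharp_maximal Q0 s f) x).
Proof.
move=> s1 /measurable_int/measurable_EFinP mf ufin L1u.
set F := fine \o sharp_maximal Q0 s f.
have mQ0 := measurable_cube Q0.
have mF : measurable_fun Q0 F by move: L1u => /measurable_int/measurable_EFinP.
have F0 x : cube_set Q0 x -> 0 <= F x.
  by move=> Qx; apply: fine_ge0; exact: sharp_maximal_ge0.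
split.
  rewrite /L1/=.
  apply: (eq_integrable mQ0 (fun x => 8%:E * (EFin \o F) x)%E).
    by move=> x _ /=; rewrite EFinM.
  exact: integrableZl.
move=> D Q [QQ0 _].
apply: lee_nneseries => [i _ _|i /set_mem Di].
  rewrite mule_ge0//; first by rewrite lee_fin invr_ge0 ltW// fine_lebesgue_cube_gt0.
  by apply: integral_ge0 => x _; apply: integral_ge0 => y _; rewrite lee_fin.
have PQ := QQ0 _ Di; move: (Q i) PQ => P PQ {QQ0 Q i Di D}.
have mP := measurable_cube P.
have r0 := fine_lebesgue_cube_gt0 P.
have mFP : measurable_fun P (EFin \o F).
  by apply/measurable_EFinP; exact: (measurable_funS mQ0 PQ mF).
have FP0 x : cube_set P x -> (0 <= (EFin \o F) x)%E.
  by move=> Px; rewrite lee_fin; apply: F0; exact: PQ.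
apply/lee_addgt0Pr => e e0.
(* The infima in [local_osc] need not be attained: the levels chosen below exceed them by less than
   [h], which costs 8 h mu P = e in total. *)
pose h := e / (8 * fine (mu P)).
have h0 : 0 < h by rewrite divr_gt0// mulr_gt0.
have pick (S : cube R n) : exists ac : R * R, S `<=` Q0 -> [/\ 0 <= ac.1,
    (mu (S `&` [set x | (ac.1 < `|f x - ac.2|)%R]) <= s%:E * mu S)%E &
    {ae mu, forall x, cube_set S x -> ac.1 <= F x + h}].
  have [SQ|nSQ] := pselect (S `<=` Q0); last by exists (0, 0).
  (* A single point with finite maximal function bounds the oscillation on all of [S]. *)
  have [x0 Sx0 x0fin] : exists2 x, cube_set S x & sharp_maximal Q0 s f x \is a fin_num.
    by apply: cube_ae_nonempty; apply: filterS ufin => x ux Sx; apply: ux; exact: SQ.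
  have oscfin : local_osc s f S \is a fin_num.
    rewrite ge0_fin_numE ?local_osc_ge0//.
    apply: le_lt_trans (local_osc_le_sharp_maximal _ _ SQ Sx0) _.
    by rewrite -ge0_fin_numE// sharp_maximal_ge0//; exact: SQ.
  have [|a [c [a0 ay acS]]] := @local_osc_ltP s (fine (local_osc s f S) + h) f S.
    by rewrite EFinD fineK// lteDl// lte_fin.
  exists (a, c) => _; split => //=; first exact: ltW.
  apply: filterS ufin => x ux Sx; apply: (le_trans (ltW ay)); rewrite lerD2r.
  apply: fine_le => //; first by apply: ux; exact: SQ.
  exact: local_osc_le_sharp_maximal.
have [ac Hac] := choice pick.
have mFh : measurable_fun Q0 (fun x => F x + h).
  by apply: measurable_funD => //; exact: measurable_cst.
have Fh0 x : cube_set Q0 x -> 0 <= F x + h.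
  by move=> Qx; rewrite addr_ge0 ?F0// ltW.
have := oscillation_integral s1 mf mFh Fh0 Hac PQ.
set I := (\int[mu]_(x in P) `|_|%:E)%E => osc.
have mfP : measurable_fun P f by exact: (measurable_funS mQ0 PQ mf).
have := double_integral_le (ac P).2 mfP; rewrite -/I => dbl.
apply: (@le_trans _ _ (2%:E * I)%E).
  have ri0 : (0 <= (fine (mu P))^-1%:E)%E by rewrite lee_fin invr_ge0 ltW.
  apply: (le_trans (lee_wpmul2l ri0 dbl)); rewrite muleA -EFinM mulrCA mulVf ?mulr1//.
  by rewrite gt_eqF.
have two0 : (0 <= 2%:E :> \bar R)%E by rewrite lee_fin.
have cst0 x : cube_set P x -> (0 <= cst h%:E x)%E by rewrite lee_fin ltW.
apply: (le_trans (lee_wpmul2l two0 osc)).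
have -> : (\int[mu]_(x in P) (F x + h)%:E =
    \int[mu]_(x in P) (EFin \o F) x + h%:E * mu P)%E.
  rewrite -integral_cst// -(ge0_integralD mu mP FP0 mFP cst0 (measurable_cst _)).
  by apply: eq_integral => x _; rewrite /= EFinD.
have -> : (\int[mu]_(x in P) (8 * F x)%:E = 8%:E * \int[mu]_(x in P) (EFin \o F) x)%E.
  rewrite -(ge0_integralZl_EFin mu mP FP0 mFP (ler0n _ 8)).
  by apply: eq_integral => x _; rewrite /= EFinM.
rewrite muleA -EFinM (_ : 2 * 4 = 8); last by rewrite -natrM.
rewrite ge0_muleDr; last 2 first.
- exact: integral_ge0.
- by rewrite mule_ge0// lee_fin ltW.
rewrite leeD2l// fine_lebesgue_cube -!EFinM lee_fin /h.
by rewrite mulrCA divfK// gt_eqF// mulr_gt0.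
Qed.

End upper_bound.

(** * Coverings by heavy cubes and a weak type estimate *)

Section covering.
Context {R : realType} {n : nat} (i0 : 'I_n).
Local Notation mu := (@lebesgue R n).
Implicit Types P Q : cube R n.

Lemma cube_side_le P Q : P `<=` Q -> side P <= side Q.
Proof.
move=> PQ.
pose x : Rn R n := [tuple (corner P i : measurableTypeR R) | i < n].
pose y : Rn R n := [tuple (corner P i + side P : measurableTypeR R) | i < n].
have Px : cube_set P x.
  by move=> i; rewrite tnth_mktuple lexx lerDl ltW// side_gt0.
have Py : cube_set P y.
  by move=> i; rewrite tnth_mktuple lexx lerDl ltW// side_gt0.
have := PQ _ Px i0; have := PQ _ Py i0; rewrite !tnth_mktuple.
by move=> /andP[? ?] /andP[? ?]; lra.
Qed.

(** [dilate5 P] shifted coordinatewise into [Q0]. The result is again a cube, so that when it fits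
    in [Q0] it can be tested for heaviness and used with [Gamma], unlike the intersection of the
    dilate with [Q0]. *)
Definition enclosing Q0 P : cube R n :=
  Cube (fun i => Num.max (corner Q0 i)
    (Num.min (corner P i - 2 * side P) (corner Q0 i + side Q0 - 5 * side P)))
    (five_side_gt0 P).

Lemma enclosing_sub Q0 P : 5 * side P <= side Q0 -> enclosing Q0 P `<=` Q0.
Proof.
move=> PQ x xP i; have /= := xP i.
set m := Num.max _ _.
have m1 : corner Q0 i <= m by rewrite le_max lexx.
have m2 : m <= corner Q0 i + side Q0 - 5 * side P.
  by rewrite ge_max ge_min lexx orbT andbT; lra.
by move=> /andP[? ?]; apply/andP; split; lra.
Qed.

Lemma sub_enclosing Q0 P : 5 * side P <= side Q0 ->
  dilate5 P `&` Q0 `<=` enclosing Q0 P.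
Proof.
move=> PQ x [xP xQ] i; have /= := xP i; have := xQ i.
move=> /andP[? ?] /andP[? ?]; rewrite /Num.max /Num.min.
case: (ltP (corner P i - 2 * side P)) => ?.
  by case: (ltP (corner Q0 i)) => ?; apply/andP; split; lra.
by case: (ltP (corner Q0 i)) => ?; apply/andP; split; lra.
Qed.

Lemma lebesgue_five P Q : side P = 5 * side Q -> (mu P = (5 ^+ n)%:E * mu Q)%E.
Proof. by move=> PQ; rewrite !lebesgue_cube PQ exprMn EFinM. Qed.

(* The cubes Q i are maximal, up to the factor 5, among the cubes on which the
   mean of g exceeds l; so the mean of g over the larger cube Qs i is still at
   most l. *)
Lemma heavy_cubes Q0 (g : Rn R n -> R) (l : R) : 0 < l ->
  measurable_fun Q0 g -> (forall x, cube_set Q0 x -> 0 <= g x) ->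
  exists (D : set nat) (Q Qs : nat -> cube R n), [/\
    forall i, D i -> [/\ Q i `<=` Q0, Qs i `<=` Q0,
      (l%:E * mu (Q i) < \int[mu]_(x in Q i) (g x)%:E)%E &
      (\int[mu]_(x in Qs i) (g x)%:E <= (5 ^+ n)%:E * \int[mu]_(x in Q i) (g x)%:E)%E],
    trivIset D (fun i => Q i : set (Rn R n)) &
    forall P, P `<=` Q0 -> (l%:E * mu P < \int[mu]_(x in P) (g x)%:E)%E ->
      exists2 i, D i & P `<=` Qs i].
Proof.
move=> l0 mg g0.
pose heavy P := P `<=` Q0 /\ (l%:E * mu P < \int[mu]_(x in P) (g x)%:E)%E.
have five1 : 1 <= 5 ^+ n :> R by rewrite exprn_ege1// ler1n.
have ig0 P : P `<=` Q0 -> (0 <= \int[mu]_(x in P) (g x)%:E)%E.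
  by move=> PQ; apply: integral_ge0 => x /PQ Qx; rewrite lee_fin g0.
(* If [Q0] is heavy it serves alone, as selected cube and as its own enlargement. *)
have [hQ0|nhQ0] := pselect (heavy Q0).
  exists [set 0%N], (fun=> Q0), (fun=> Q0); split.
  - move=> _ _; split => //; first exact: hQ0.2.
    rewrite -[leLHS]mul1e; apply: lee_wpmul2r; last by rewrite lee_fin.
    exact: ig0.
  - by move=> i j -> ->.
  - by move=> P PQ _; exists 0%N.
have {}nhQ0 : (\int[mu]_(x in Q0) (g x)%:E <= l%:E * mu Q0)%E.
  by rewrite leNgt; apply/negP => ?; apply: nhQ0; split.
(* No heavy cube containing a member of [V] is five times as long; so the enclosing cube of a
   member, when it fits in [Q0], is not heavy. *)
pose V := [set P | heavy P /\
  forall P', heavy P' -> P `<=` P' -> side P' < 5 * side P].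
have [|D [Q [QV tQ VQ]]] := @vitali_cubes _ _ V (side Q0).
  by move=> P [[PQ _] _]; exact: cube_side_le.
have heavyV P : heavy P -> exists2 P', V P' & P `<=` P'.
  move=> hP; pose S := [set side P' | P' in [set P' | heavy P' /\ P `<=` P']].
  have SP : S (side P) by exists P => //; split.
  have supS : has_sup S.
    split; first by exists (side P).
    by exists (side Q0) => _ [P' [[P'Q _] _] <-]; exact: cube_side_le.
  have sup0 : 0 < sup S.
    apply: (lt_le_trans (side_gt0 P)); exact: (ub_le_sup supS.2).
  (* The subtraction leaves a fifth of the supremum: a heavy cube five times as long as [P'] would
     exceed the supremum. *)
  have [_ [P' [hP' PP'] <-] P'S] : exists2 x, S x & sup S - 4 / 5 * sup S < x.
    by apply: sup_adherent => //; rewrite mulr_gt0.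
  exists P' => //; split => // P'' hP'' P'P''.
  have : side P'' <= sup S.
    by apply: (ub_le_sup supS.2); exists P'' => //; split => //; exact: subset_trans P'P''.
  by lra.
(* A dilate too large for [Q0] is replaced by [Q0], which is not heavy in this case and has less
   than [5 ^+ n] times the volume of [Q i]. *)
pose Qs i := if 5 * side (Q i) <= side Q0 then enclosing Q0 (Q i) else Q0.
have QsQ0 i : Qs i `<=` Q0.
  by rewrite /Qs; case: ifP => [?|_]; [exact: enclosing_sub|exact: subset_refl].
have dilQs i : dilate5 (Q i) `&` Q0 `<=` Qs i.
  by rewrite /Qs; case: ifP => [?|_ x []//]; exact: sub_enclosing.
have QQs i : D i -> Q i `<=` Qs i.
  move=> Di x Qx; apply: dilQs; split; last by have [[QQ _] _] := QV _ Di; exact: QQ.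
  move=> j /=; have /andP[? ?] := Qx j; have := side_gt0 (Q i).
  by move=> ?; apply/andP; split; lra.
exists D, Q, Qs; split => //.
- move=> i Di; have [[QQ0 hQ] Qmax] := QV _ Di; split => //.
  have le5 : ((5 ^+ n)%:E * (l%:E * mu (Q i)) <=
      (5 ^+ n)%:E * \int[mu]_(x in Q i) (g x)%:E)%E.
    by apply: lee_wpmul2l; [rewrite lee_fin exprn_ge0|exact: ltW].
  apply: le_trans le5; rewrite muleCA.
  have := @QQs i Di; have := @QsQ0 i; rewrite /Qs; case: ifPn => [le5 QsQ QQs'|].
    rewrite -(@lebesgue_five (enclosing Q0 (Q i)))// leNgt; apply/negP => hQs.
    by have := Qmax _ (conj QsQ hQs) QQs'; rewrite ltxx.
  rewrite -ltNge => lt5 _ _; apply: (le_trans nhQ0).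
  apply: lee_wpmul2l; first by rewrite lee_fin ltW.
  rewrite !lebesgue_cube -EFinM lee_fin -exprMn lerXn2r ?nnegrE ?ltW//.
    exact: side_gt0.
  by rewrite mulr_gt0// side_gt0.
- move=> P PQ0 lP; have [P' VP' PP'] := heavyV P (conj PQ0 lP).
  have [i Di P'i] := VQ _ VP'; exists i => //.
  by move=> x Px; apply: dilQs; split; [exact/P'i/PP'|exact: PQ0].
Qed.

(** The weak type (1,1) inequality for the maximal function of the indicator of [B]. Vitali cubes
    are disjoint, each has a share at least [s] of its volume in [B], and their dilates cover the
    union. *)
Lemma weak_type_cubes Q0 (B : set (Rn R n)) (s : R) : 0 < s -> measurable B ->
  (mu (\bigcup_(P in [set P : cube R n | P `<=` Q0 /\ (s%:E * mu P <= mu (P `&` B))%E])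
    (P : set (Rn R n))) <= (5 ^+ n / s)%:E * mu B)%E.
Proof.
move=> s0 mB; set V := [set P : cube R n | _]; set U := \bigcup_(P in V) _.
have mU : measurable U by apply: (@measurable_bigcup_cubes _ _ V Q0) => P [].
have [|D [Q [QV tQ VQ]]] := @vitali_cubes _ _ V (side Q0).
  by move=> P [PQ _]; exact: cube_side_le.
pose H i : set (Rn R n) := if i \in D then cube_set (Q i) else set0.
pose H5 i : set (Rn R n) := if i \in D then cube_set (dilate5 (Q i)) else set0.
have mH i : measurable (H i) by rewrite /H; case: ifP => // _; exact: measurable_cube.
have mH5 i : measurable (H5 i) by rewrite /H5; case: ifP => // _; exact: measurable_cube.
have tH : trivIset setT H.
  apply/trivIsetP => i j _ _ ij; rewrite /H.
  case: ifPn => [/set_mem Di|_]; last by rewrite set0I.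
  case: ifPn => [/set_mem Dj|_]; last by rewrite setI0.
  by move/trivIsetP: tQ; apply.
apply: (@le_trans _ _ (\sum_(i <oo) mu (H5 i))%E).
  apply: measure_sigma_subadditive => // x [P VP Px].
  have [i Di Pi] := VQ _ VP; exists i => //.
  by rewrite /H5 mem_set//; exact: Pi.
have mHB i : measurable (H i `&` B) by exact: measurableI.
apply: (@le_trans _ _ ((5 ^+ n / s)%:E * \sum_(i <oo) mu (H i `&` B))%E); last first.
  apply: lee_wpmul2l; first by rewrite lee_fin divr_ge0 ?exprn_ge0// ltW.
  rewrite -measure_semi_bigcup; last 3 first.
  - exact: mHB.
  - exact: trivIset_setIr.
  - exact: bigcupT_measurable.
  apply: le_measure; rewrite ?inE//; first exact: bigcupT_measurable.
  by move=> x [i _ []].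
rewrite -nneseriesZl; last by move=> i _; exact: measure_ge0.
apply: lee_nneseries => [i _ _|i _]; first exact: measure_ge0.
rewrite /H5 /H; case: ifPn => [/set_mem Di|_]; last by rewrite set0I !measure0 mule0.
have [_ sQ] := QV _ Di.
rewrite (@lebesgue_five _ (Q i))// EFinM -muleA; apply: lee_wpmul2l.
  by rewrite lee_fin exprn_ge0.
rewrite -[leLHS]mul1e -(mulVf (lt0r_neq0 s0)) EFinM -muleA; apply: lee_wpmul2l => //.
by rewrite lee_fin invr_ge0 ltW.
Qed.

End covering.

(** * Distribution of the sharp maximal function *)

Section sharp_maximal_estimate.
Context {R : realType} {n : nat} (i0 : 'I_n).
Local Notation mu := (@lebesgue R n).
Implicit Types P Q : cube R n.

Lemma chebyshev_superlevel d (T : measurableType d) (m : {measure set T -> \bar R})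
    (D : set T) (h : T -> R) (t : R) : measurable D -> measurable_fun D h ->
  (forall x, D x -> 0 <= h x) -> 0 < t ->
  (t%:E * m (D `&` [set x | (t < h x)%R]) <= \int[m]_(x in D) (h x)%:E)%E.
Proof.
move=> mD mh h0 t0.
have mS : measurable (D `&` [set x | t < h x]) by exact: measurable_superlevel.
apply: (@le_trans _ _ (\int[m]_(x in D `&` [set x | (t < h x)%R]) (h x)%:E)%E).
  rewrite -integral_cst//; apply: le_integral_nonneg => x [Dx tx].
    by rewrite lee_fin ltW.
  by rewrite lee_fin ltW.
apply: (ge0_subset_integral m mS mD).
- exact/measurable_EFinP.
- by move=> x Dx; rewrite lee_fin h0.
- by move=> x [].
Qed.

(** A superlevel set is the union of the cubes of larger oscillation, to which
    [measurable_bigcup_cubes] applies. *)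
Lemma measurable_sharp_maximal Q0 (s : R) f :
  measurable_fun Q0 (sharp_maximal Q0 s f).
Proof.
apply: (measurability _ (ErealGenOInfty.measurableE R)) => _ [_ [r ->] <-].
rewrite (_ : _ `&` _ = \bigcup_(P in [set P : cube R n | P `<=` Q0 /\
    (r%:E < local_osc s f P)%E]) (P : set (Rn R n))).
  by apply: (@measurable_bigcup_cubes _ _ _ Q0) => P [].
apply/seteqP; split => x.
  move=> [Qx] /=; rewrite in_itv/= andbT => /ereal_sup_gt[_ [P [Px PQ] <-] rP].
  by exists P.
move=> [P [PQ rP] Px]; split; first exact: PQ.
by rewrite /= in_itv/= andbT (lt_le_trans rP)// local_osc_le_sharp_maximal.
Qed.

Lemma nneseries_set1 (F : nat -> \bar R) :
  (\sum_(0 <= i <oo | i \in [set 0%N]) F i = F 0%N)%E.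
Proof.
apply/cvg_lim => //; apply: cvg_near_cst; exists 1%N => // k /= k0.
rewrite big_ltn_cond// mem_set// big_nat_cond big1 ?adde0// => i /andP[/andP[i1 _]].
by move=> /set_mem/= i0'; rewrite i0' in i1.
Qed.

(** The packing with the single member [P]. Members of [Gamma] may change sign, so |g| takes the
    place of [g] from here on. *)
Lemma Gamma_cube Q0 f g P : Gamma Q0 f g -> P `<=` Q0 ->
  (\int[mu]_(x in P) \int[mu]_(y in P) `|f x - f y|%:E <=
   mu P * \int[mu]_(x in P) `|g x|%:E)%E.
Proof.
move=> [L1g Gg] PQ.
have mP := measurable_cube P; have mQ0 := measurable_cube Q0.
have r0 := fine_lebesgue_cube_gt0 P.
have := Gg [set 0%N] (fun=> P); rewrite !nneseries_set1 => /(_ _)/le_trans H.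
rewrite (fine_lebesgue_cube P) -lee_pdivrMl//.
apply: H.
  by split => // i j -> ->.
have ig : mu.-integrable P (EFin \o g) by exact: (integrableS mQ0 mP PQ L1g).
apply: (le_integral mP ig (integrable_abse ig)) => x _ /=.
by rewrite lee_fin ler_norm.
Qed.

(** The constant is a value of [f]: if the integral of |f - f x| over [P] exceeded [A] for every x
    in [P], the double integral would be at least A mu P, more than [Gamma_cube] allows. *)
Lemma good_constant Q0 f g P (A : R) : Gamma Q0 f g -> P `<=` Q0 ->
  (\int[mu]_(x in P) `|g x|%:E < A%:E)%E ->
  exists c, (\int[mu]_(x in P) `|f x - c|%:E <= A%:E)%E.
Proof.
move=> Gg PQ gA; apply: contrapT => /forallNP nc.
have mP := measurable_cube P.
have ig0 : (0 <= \int[mu]_(x in P) `|g x|%:E)%E.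
  by apply: integral_ge0 => x _; rewrite lee_fin.
have A0 : 0 < A by rewrite -lte_fin; exact: le_lt_trans gA.
have : (A%:E * mu P <= mu P * \int[mu]_(x in P) `|g x|%:E)%E.
  apply: le_trans (Gamma_cube Gg PQ); rewrite -integral_cst//.
  apply: le_integral_nonneg => x _; first by rewrite lee_fin ltW.
  rewrite leNgt; apply/negP => /ltW fx; apply: (nc (f x)).
  by under eq_integral do rewrite distrC.
rewrite muleC (fine_lebesgue_cube P) lee_pmul2l ?lte_fin ?fine_lebesgue_cube_gt0//.
by rewrite leNgt gA.
Qed.

(** Some [c] has mean deviation at most 2 l, and Chebyshev at height 3 l / s leaves a set of
    relative measure at most 2 s / 3; the 3 against the 2 yields the strict inequality in
    [local_osc]. *)
Lemma local_osc_light Q0 f g P (s l : R) : 0 < s -> 0 < l -> measurable_fun Q0 f ->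
  Gamma Q0 f g -> P `<=` Q0 ->
  (\int[mu]_(x in P) `|g x|%:E <= l%:E * mu P)%E ->
  (local_osc s f P <= (3 / s * l)%:E)%E.
Proof.
move=> s0 l0 mf Gg PQ gl.
have mP := measurable_cube P; have mQ0 := measurable_cube Q0.
have mfP : measurable_fun P f by exact: (measurable_funS mQ0 PQ mf).
have r0 := fine_lebesgue_cube_gt0 P.
have a0 : 0 < 3 / s * l by rewrite mulr_gt0// divr_gt0.
have [|c cP] := @good_constant Q0 f g P (2 * l * fine (mu P)) Gg PQ.
  apply: (le_lt_trans gl); rewrite (fine_lebesgue_cube P) -EFinM lte_fin.
  by rewrite ltr_pM2r// ltr_pMl// ltr1n.
apply: (le_trans (ereal_inf_lbound (ex_intro2 _ _ c I erefl))).
apply: ereal_inf_lbound.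
exists (3 / s * l) => //; split; first exact: ltW.
have := @chebyshev_superlevel _ _ mu P (fun x => `|f x - c|) (3 / s * l) mP.
move=> /(_ (measurable_absB _ mfP) (fun x _ => normr_ge0 _) a0) /le_trans /(_ cP) ch.
rewrite -(@lte_pmul2l _ (3 / s * l)%:E)//.
apply: (le_lt_trans ch); rewrite (fine_lebesgue_cube P) -!EFinM lte_fin mulrA.
by rewrite ltr_pM2r// mulrAC divfK ?gt_eqF// ltr_pM2r// ltr_nat.
Qed.

Let absorb_quarter (l a b m : R) :
  l * m <= a -> a <= b + l / 4 * m -> 0 <= b -> a <= 4 * b.
Proof. by move=> ? ? ?; lra. Qed.

(** A cube with oscillation above 3 l / s + t is heavy by [local_osc_light], hence inside some
    [Qs i]; as its oscillation exceeds [t], a share at least [s] of it lies in {|f - c i| > t}, and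
    [weak_type_cubes] applies for this [i]. The constant [8 * 5 ^+ n] is [2 * 5 ^+ n], from the
    choice of [c i] on [Qs i], times 4, from cutting |g| at l / 4 on the heavy cubes. *)
Lemma sharp_maximal_superlevel Q0 f g (s l : R) : 0 < s -> 0 < l ->
  L1 Q0 f -> Gamma Q0 f g ->
  exists (E : nat -> set (Rn R n)) (c : nat -> R), [/\
    forall i, measurable (E i), forall i, measurable_fun (E i) (fun x => `|f x - c i|),
    (\sum_(i <oo) \int[mu]_(x in E i) `|f x - c i|%:E <= (8 * 5 ^+ n)%:E *
      \int[mu]_(x in Q0) (Num.max 0 (`|g x| - l / 4))%:E)%E &
    forall t, 0 < t ->
      (mu (Q0 `&` [set x | ((3 / s * l + t)%:E < sharp_maximal Q0 s f x)%E]) <=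
       (5 ^+ n / s)%:E * \sum_(i <oo) mu (E i `&` [set x | (t < `|f x - c i|)%R]))%E].
Proof.
move=> s0 l0 L1f Gg; have [L1g _] := Gg.
have mQ0 := measurable_cube Q0.
have mf : measurable_fun Q0 f by move: L1f => /measurable_int/measurable_EFinP.
have mg : measurable_fun Q0 g by move: L1g => /measurable_int/measurable_EFinP.
have mag : measurable_fun Q0 (fun x => `|g x|).
  exact: (measurableT_comp (@normr_measurable R setT)).
have [D [Q [Qs [QQs tQ cov]]]] :=
  @heavy_cubes R n i0 Q0 (fun x => `|g x|) l l0 mag (fun x _ => normr_ge0 (g x)).
have ifin P : P `<=` Q0 -> (\int[mu]_(x in P) `|g x|%:E)%E \is a fin_num.
  move=> PQ; have mP := measurable_cube P.
  have ig : mu.-integrable P (EFin \o g) by exact: (integrableS mQ0 mP PQ L1g).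
  by have := integrable_fin_num mP (integrable_abse ig).
pose I i := fine (\int[mu]_(x in Q i) `|g x|%:E)%E.
have IE i : D i -> (\int[mu]_(x in Q i) `|g x|%:E = (I i)%:E)%E.
  by move=> Di; rewrite fineK//; apply: ifin; have [] := QQs _ Di.
have I0 i : D i -> 0 < I i.
  move=> Di; have [_ _ h _] := QQs _ Di; move: h; rewrite IE// -lte_fin.
  by apply: le_lt_trans; rewrite mule_ge0// lee_fin ltW.
have pick i : exists c, D i ->
    (\int[mu]_(x in Qs i) `|f x - c|%:E <= (2 * 5 ^+ n)%:E * (I i)%:E)%E.
  have [Di|nDi] := pselect (D i); last by exists 0.
  have [_ QsQ _ Qs5] := QQs _ Di.
  have [|c cP] := @good_constant Q0 f g (Qs i) (2 * 5 ^+ n * I i) Gg QsQ; last by exists c.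
  apply: (le_lt_trans Qs5); rewrite IE// -EFinM lte_fin ltr_pM2r ?I0//.
  by rewrite ltr_pMl ?exprn_gt0// ltr1n.
have [c Hc] := choice pick.
pose E i : set (Rn R n) := if i \in D then cube_set (Qs i) else set0.
pose H i : set (Rn R n) := if i \in D then cube_set (Q i) else set0.
have mE i : measurable (E i) by rewrite /E; case: ifP => // _; exact: measurable_cube.
have mH i : measurable (H i) by rewrite /H; case: ifP => // _; exact: measurable_cube.
have EQ i : E i `<=` Q0.
  rewrite /E; case: ifPn => [/set_mem Di|_]; last exact: sub0set.
  by have [] := QQs _ Di.
have HQ i : H i `<=` Q0.
  rewrite /H; case: ifPn => [/set_mem Di|_]; last exact: sub0set.
  by have [] := QQs _ Di.
have mfE i : measurable_fun (E i) (fun x => `|f x - c i|).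
  by apply: measurable_absB; exact: (measurable_funS mQ0 (EQ i) mf).
exists E, c; split.
- exact: mE.
- exact: mfE.
- have tH : trivIset setT H.
    apply/trivIsetP => i j _ _ ij; rewrite /H.
    case: ifPn => [/set_mem Di|_]; last by rewrite set0I.
    case: ifPn => [/set_mem Dj|_]; last by rewrite setI0.
    by move/trivIsetP: tQ; apply.
  pose U := \bigcup_i H i.
  have mU : measurable U by exact: bigcupT_measurable.
  have UQ : U `<=` Q0 by move=> x [i _]; exact: HQ.
  have magU : measurable_fun U (fun x => `|g x|%:E).
    by apply/measurable_EFinP; exact: (measurable_funS mQ0 UQ mag).
  have ag0 (A : set (Rn R n)) : forall x, A x -> (0 <= `|g x|%:E)%E by move=> x _; rewrite lee_fin.
  have UE := ge0_integral_bigcup mu mH magU (ag0 _) tH.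
  have sumE : (\sum_(i <oo) \int[mu]_(x in E i) `|f x - c i|%:E <=
      (2 * 5 ^+ n)%:E * \int[mu]_(x in U) `|g x|%:E)%E.
    rewrite UE -nneseriesZl; last by move=> i _; apply: integral_ge0; exact: ag0.
    apply: lee_nneseries => [i _ _|i _]; first by apply: integral_ge0 => x _; rewrite lee_fin.
    rewrite /E /H; case: ifPn => [/set_mem Di|_]; first by rewrite IE//; exact: Hc.
    by rewrite !integral_set0 mule0.
  (* The mean of |g| over the heavy cubes is at least [l], so lowering |g| by l / 4 there costs at
     most a quarter of its integral. *)
  have lU : (l%:E * mu U <= \int[mu]_(x in U) `|g x|%:E)%E.
    rewrite UE measure_semi_bigcup; [|exact: mH|exact: tH|exact: mU].
    rewrite -nneseriesZl; last by move=> i _; exact: measure_ge0.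
    apply: lee_nneseries => [i _ _|i _]; first by rewrite mule_ge0// lee_fin ltW.
    rewrite /H; case: ifPn => [/set_mem Di|_]; last by rewrite measure0 integral_set0 mule0.
    by have [_ _ /ltW] := QQs _ Di.
  pose p x := Num.max 0 (`|g x| - l / 4).
  have mp : measurable_fun Q0 p.
    apply: measurable_maxr; first exact: measurable_cst.
    by apply: measurable_funB => //; exact: measurable_cst.
  have p0 (A : set (Rn R n)) : forall x, A x -> (0 <= (p x)%:E)%E.
    by move=> x _; rewrite lee_fin le_max lexx.
  have mpU : measurable_fun U (EFin \o p).
    by apply/measurable_EFinP; exact: (measurable_funS mQ0 UQ mp).
  have finU : mu U \is a fin_num.
    rewrite ge0_fin_numE//; apply: (@le_lt_trans _ _ (mu Q0)).
      by apply: le_measure; rewrite ?inE.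
    by rewrite lebesgue_cube ltry.
  have gU : (\int[mu]_(x in U) `|g x|%:E <=
      \int[mu]_(x in U) (p x)%:E + (l / 4)%:E * mu U)%E.
    rewrite -integral_cst// -(ge0_integralD mu mU (p0 U) mpU _ (measurable_cst _)).
      apply: le_integral_nonneg => [|x _]; first exact: ag0.
      rewrite /= -EFinD lee_fin -lerBlDr /p le_max lexx orbT//.
    by move=> x _; rewrite lee_fin divr_ge0// ltW.
  have gUfin : (\int[mu]_(x in U) `|g x|%:E)%E \is a fin_num.
    have ig : mu.-integrable U (EFin \o g) by exact: (integrableS mQ0 mU UQ L1g).
    by have := integrable_fin_num mU (integrable_abse ig).
  have gU2 : (\int[mu]_(x in U) `|g x|%:E <= 4%:E * \int[mu]_(x in U) (p x)%:E)%E.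
    have pUfin : (\int[mu]_(x in U) (p x)%:E)%E \is a fin_num.
      rewrite ge0_fin_numE; last by apply: integral_ge0; exact: p0.
      apply: (@le_lt_trans _ _ (\int[mu]_(x in U) `|g x|%:E)%E); last first.
        by rewrite -ge0_fin_numE//; apply: integral_ge0; exact: ag0.
      apply: le_integral_nonneg => [|x _]; first exact: p0.
      by rewrite lee_fin /p ge_max normr_ge0 gerBl divr_ge0// ltW.
    have pI0 : 0 <= fine (\int[mu]_(x in U) (p x)%:E)%E.
      by apply: fine_ge0; apply: integral_ge0; exact: p0.
    move: lU gU; rewrite -(fineK gUfin) -(fineK pUfin) -(fineK finU) -!EFinM -EFinD !lee_fin.
    by move=> lU gU; exact: (absorb_quarter lU gU).
  apply: (le_trans sumE).
  apply: (@le_trans _ _ ((2 * 5 ^+ n)%:E * (4%:E * \int[mu]_(x in Q0) (p x)%:E))%E).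
    apply: lee_wpmul2l; first by rewrite lee_fin mulr_ge0// exprn_ge0.
    apply: (le_trans gU2); apply: lee_wpmul2l => //.
    have mpQ : measurable_fun Q0 (EFin \o p) by exact/measurable_EFinP.
    exact: (ge0_subset_integral mu mU mQ0 mpQ (p0 (cube_set Q0)) UQ).
  by rewrite muleA -EFinM mulrAC (_ : 2 * 4 = 8)// -natrM.
move=> t t0.
pose B i := E i `&` [set x | t < `|f x - c i|].
have mB i : measurable (B i) by exact: (measurable_superlevel _ (mE i) (mfE i)).
pose W i := \bigcup_(P in [set P : cube R n | P `<=` Q0 /\
  (s%:E * mu P <= mu (P `&` B i))%E]) (P : set (Rn R n)).
have mW i : measurable (W i) by apply: (@measurable_bigcup_cubes _ _ _ Q0) => P [].
apply: (@le_trans _ _ (\sum_(i <oo) mu (W i))%E).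
  apply: measure_sigma_subadditive.
  - exact: mW.
  - rewrite (_ : [set x | _] = sharp_maximal Q0 s f @^-1` `]((3 / s * l + t)%:E), +oo[%classic).
      by apply: measurable_sharp_maximal => //; exact: emeasurable_itv.
    by apply/seteqP; split => x /=; rewrite in_itv/= andbT.
  move=> x [Qx] /= /ereal_sup_gt[_ [P [Px PQ] <-] oscP].
  have [i Di PQs] : exists2 i, D i & P `<=` Qs i.
    apply: (cov P PQ); rewrite ltNge; apply/negP => light.
    have := local_osc_light s0 l0 mf Gg PQ light; rewrite leNgt => /negP; apply.
    by apply: le_lt_trans oscP; rewrite lee_fin lerDl ltW.
  exists i => //; exists P => //; split => //.
  rewrite leNgt; apply/negP => sP.
  have : (local_osc s f P <= t%:E)%E.
    apply: (le_trans (ereal_inf_lbound (ex_intro2 _ _ (c i) Logic.I erefl))).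
    apply: ereal_inf_lbound; exists t => //; split; first exact: ltW.
    apply: le_lt_trans sP; apply: le_measure.
    - rewrite inE; apply: (measurable_superlevel _ (measurable_cube P)).
      by apply: measurable_absB; exact: (measurable_funS mQ0 PQ mf).
    - by rewrite inE; apply: measurableI => //; exact: measurable_cube.
    move=> y [Py ty]; split => //; split => //.
    by rewrite /E mem_set//; exact: PQs.
  rewrite leNgt => /negP; apply; apply: le_lt_trans oscP.
  by rewrite lee_fin lerDr mulr_ge0 ?divr_ge0// ltW.
rewrite -nneseriesZl; last by move=> i _; exact: measure_ge0.
apply: lee_nneseries => [i _ _|i _]; first exact: measure_ge0.
exact: weak_type_cubes.
Qed.

End sharp_maximal_estimate.

(** * Majorization of the sharp maximal function *)

Section convex_order.
Context {R : realType} {n : nat} (i0 : 'I_n).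
Local Notation mu := (@lebesgue R n).

Lemma measurable_excess d (T : measurableType d) (D : set T) (f : T -> R) (l : R) :
  measurable_fun D f -> measurable_fun D (fun x => Num.max 0 (f x - l)).
Proof.
move=> mf; apply: measurable_maxr; first exact: measurable_cst.
exact: measurable_funB mf (measurable_cst _).
Qed.

Lemma excess_ge0 (x l : R) : 0 <= Num.max 0 (x - l).
Proof. by rewrite le_max lexx. Qed.

Lemma le_excess (x y l m : R) : x <= y -> m <= l ->
  Num.max 0 (x - l) <= Num.max 0 (y - m).
Proof. by move=> xy ml; rewrite ge_max !le_max lexx/= lerB// orbT. Qed.

Lemma lt_excess (x l t : R) : 0 < t -> (t < Num.max 0 (x - l)) = (l + t < x).
Proof. by move=> t0; rewrite lt_max ltNge (ltW t0)/= ltrBrDl. Qed.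

Lemma integral_excess_fin (Q0 : cube R n) (g : Rn R n -> R) (l : R) : L1 Q0 g -> 0 <= l ->
  (\int[mu]_(x in Q0) (Num.max 0 (`|g x| - l))%:E)%E \is a fin_num.
Proof.
move=> L1g l0; have mQ0 := measurable_cube Q0.
rewrite ge0_fin_numE; last by apply: integral_ge0 => x _; rewrite lee_fin excess_ge0.
apply: (@le_lt_trans _ _ (\int[mu]_(x in Q0) `|g x|%:E)%E).
  apply: le_integral_nonneg => x _; rewrite lee_fin ?excess_ge0//.
  by rewrite ge_max normr_ge0 gerBl.
rewrite -ge0_fin_numE; last by apply: integral_ge0 => x _; rewrite lee_fin.
exact: (integrable_fin_num mQ0 (integrable_abse L1g)).
Qed.

(** Chebyshev in the superlevel estimate at l = 1 bounds the measure of the set of infinite values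
    by a multiple of 1 / t, for every t > 0. *)
Lemma sharp_maximal_ae_fin (Q0 : cube R n) f g (s : R) : 0 < s -> L1 Q0 f -> Gamma Q0 f g ->
  {ae mu, forall x, cube_set Q0 x -> sharp_maximal Q0 s f x \is a fin_num}.
Proof.
move=> s0 L1f Gg; have [L1g _] := Gg.
have mQ0 := measurable_cube Q0.
have [E [c [mE mfE sumE lvl]]] := sharp_maximal_superlevel i0 s0 ltr01 L1f Gg.
set u := sharp_maximal Q0 s f in lvl *.
have mZ : measurable (Q0 `&` u @^-1` [set +oo%E]).
  exact: measurable_sharp_maximal.
exists (Q0 `&` u @^-1` [set +oo%E]); split => //; last first.
  move=> x /= /not_implyP[Qx ufin]; split => //=; apply: contrapT => uoo.
  apply: ufin; rewrite ge0_fin_numE ?sharp_maximal_ge0//.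
  by rewrite lt_neqAle leey andbT; apply/eqP.
set K := (\int[mu]_(x in Q0) _)%E in sumE.
have Kfin : K \is a fin_num by apply: integral_excess_fin => //; rewrite divr_ge0.
pose C := 5 ^+ n / s * (8 * 5 ^+ n * fine K).
have Zt t : 0 < t -> (mu (Q0 `&` u @^-1` [set +oo%E]) <= (C / t)%:E)%E.
  move=> t0; apply: (@le_trans _ _ ((5 ^+ n / s)%:E *
      \sum_(i <oo) mu (E i `&` [set x | (t < `|f x - c i|)%R]))%E).
    apply: le_trans (lvl t t0); apply: le_measure; rewrite ?inE//.
      rewrite (_ : [set x | _] = u @^-1` `]((3 / s * 1 + t)%:E), +oo[%classic).
        by apply: measurable_sharp_maximal => //; exact: emeasurable_itv.
      by apply/seteqP; split => x /=; rewrite in_itv/= andbT.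
    by move=> x [Qx] /= ->; split => //=; rewrite ltry.
  have -> : C / t = 5 ^+ n / s * (t^-1 * (8 * 5 ^+ n * fine K)).
    by rewrite /C -mulrA [t^-1 * _]mulrC.
  rewrite [leRHS]EFinM; apply: lee_wpmul2l.
    by rewrite lee_fin divr_ge0 ?exprn_ge0// ltW.
  rewrite [leRHS]EFinM lee_pdivlMl//; apply: (@le_trans _ _ ((8 * 5 ^+ n)%:E * K)%E).
    apply: le_trans sumE; rewrite -nneseriesZl; last by move=> i _; exact: measure_ge0.
    apply: lee_nneseries => [i _ _|i _]; first by rewrite mule_ge0// lee_fin ltW.
    exact: chebyshev_superlevel.
  by rewrite -(fineK Kfin) -EFinM.
apply/eqP; rewrite eq_le measure_ge0 andbT; apply/lee_addgt0Pr => e e0.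
rewrite add0e; have C0 : 0 <= C.
  have K0 : 0 <= fine K.
    by apply: fine_ge0; apply: integral_ge0 => x _; rewrite lee_fin excess_ge0.
  by apply: mulr_ge0; [rewrite divr_ge0 ?exprn_ge0// ltW|rewrite !mulr_ge0 ?exprn_ge0].
have t0 : 0 < (C + 1) / e by rewrite divr_gt0// ltr_wpDl.
apply: (le_trans (Zt _ t0)); rewrite lee_fin invf_div mulrCA.
rewrite ger_pMr// ler_pdivrMr ?mul1r ?lerDl// ltr_wpDl//.
Qed.

Lemma sharp_maximal_excess (Q0 : cube R n) f g (s l : R) : 0 < s -> 0 < l ->
  L1 Q0 f -> Gamma Q0 f g ->
  (\int[mu]_(x in Q0) (Num.max 0 ((fine \o sharp_maximal Q0 s f) x - 3 / s * l))%:E <=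
   (5 ^+ n / s * (8 * 5 ^+ n))%:E *
     \int[mu]_(x in Q0) (Num.max 0 (`|g x| - l / 4))%:E)%E.
Proof.
move=> s0 l0 L1f Gg; have [L1g _] := Gg.
have mQ0 := measurable_cube Q0.
have [E [c [mE mfE sumE lvl]]] := sharp_maximal_superlevel i0 s0 l0 L1f Gg.
set u := sharp_maximal Q0 s f in lvl *.
have mF : measurable_fun Q0 (fine \o u).
  by apply: (measurableT_comp (fine_measurable measurableT)); exact: measurable_sharp_maximal.
have c0 : 0 <= 5 ^+ n / s by rewrite divr_ge0 ?exprn_ge0// ltW.
rewrite EFinM -muleA; apply: le_trans (lee_wpmul2l _ sumE); last by rewrite lee_fin.
have y0 : 0 < 3 / s * l by rewrite mulr_gt0// divr_gt0.
apply: (le_integral_distribution c0 mQ0 (measurable_excess _ mF) _ mE mfE).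
- by move=> x _; exact: excess_ge0.
- by [].
move=> t t0; apply: le_trans (lvl t t0); apply: le_measure; rewrite ?inE.
- by apply: measurable_superlevel mQ0 (measurable_excess _ mF).
- rewrite (_ : [set x | _] = u @^-1` `]((3 / s * l + t)%:E), +oo[%classic).
    by apply: measurable_sharp_maximal => //; exact: emeasurable_itv.
  by apply/seteqP; split => x /=; rewrite in_itv/= andbT.
move=> x [Qx] /=; rewrite lt_excess// => h; split => //=.
(* [fine] sends infinite values to 0, so where it is positive it is the value of [u]. *)
have : 0 < fine (u x) by apply: lt_trans h; rewrite addr_gt0.
by case: (u x) h => [r| |] /=; rewrite ?ltxx// lte_fin.
Qed.

(** The previous estimate at [l' = C * s / 3 * l], chosen so that 3 / s * l' = C l. The 32 in [C] is
    4 * 8: the constant of that estimate is then C / 4, which leaves the factor 1/4 after division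
    by [C]; and l' / 4 >= l. *)
Lemma sharp_maximal_majorized (Q0 : cube R n) f g (s l : R)
    (C := 32 * (5 ^+ n * 5 ^+ n) / s) : 0 < s -> 0 < l ->
  L1 Q0 f -> Gamma Q0 f g ->
  (\int[mu]_(x in Q0) (Num.max 0 (C^-1 * (fine \o sharp_maximal Q0 s f) x - l))%:E <=
   4^-1%:E * \int[mu]_(x in Q0) (Num.max 0 (`|g x| - l))%:E)%E.
Proof.
move=> s0 l0 L1f Gg; have [L1g _] := Gg.
have mQ0 := measurable_cube Q0.
have f1 : 1 <= 5 ^+ n * 5 ^+ n :> R by rewrite mulr_ege1// exprn_ege1// ler1n.
have C0 : 0 < C by rewrite /C divr_gt0// mulr_gt0// (lt_le_trans ltr01).
have mF : measurable_fun Q0 (fine \o sharp_maximal Q0 s f).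
  by apply: (measurableT_comp (fine_measurable measurableT)); exact: measurable_sharp_maximal.
set F := fine \o _ in mF *.
pose l' := C * s / 3 * l.
have Cs : C * s = 32 * (5 ^+ n * 5 ^+ n) by rewrite /C divfK// gt_eqF.
have l'E : 3 / s * l' = C * l.
  rewrite /l' [LHS]mulrA mulf_div [s * 3]mulrC -mulf_div divff// mul1r.
  by rewrite mulfK// gt_eqF.
have l'4 : l <= l' / 4.
  rewrite /l' Cs mulrAC ler_peMl// ?ltW//.
  by move: (5 ^+ n * 5 ^+ n) f1 => a ?; lra.
have l'0 : 0 < l' by rewrite /l' mulr_gt0// Cs divr_gt0// mulr_gt0// (lt_le_trans ltr01).
have := sharp_maximal_excess s0 l'0 L1f Gg; rewrite l'E -/F => exc.
have C0' : 0 <= C^-1 by rewrite invr_ge0 ltW.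
have -> : (\int[mu]_(x in Q0) (Num.max 0 (C^-1 * F x - l))%:E =
    C^-1%:E * \int[mu]_(x in Q0) (Num.max 0 (F x - C * l))%:E)%E.
  have ex0 x : cube_set Q0 x -> (0 <= (Num.max 0 (F x - C * l))%:E)%E.
    by rewrite lee_fin excess_ge0.
  have mex : measurable_fun Q0 (fun x => (Num.max 0 (F x - C * l))%:E).
    by apply/measurable_EFinP; exact: measurable_excess.
  rewrite -(ge0_integralZl_EFin mu mQ0 ex0 mex C0').
  apply: eq_integral => x _; rewrite -EFinM; congr EFin.
  by rewrite maxr_pMr// mulr0 mulrBr mulrA mulVf ?gt_eqF// mul1r.
rewrite lee_pdivrMl// muleA -EFinM; apply: (le_trans exc).
rewrite (_ : C / 4 = 5 ^+ n / s * (8 * 5 ^+ n)); last first.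
  by rewrite /C mulrAC [RHS]mulrAC; congr (_ / s); lra.
apply: lee_wpmul2l.
  by rewrite lee_fin mulr_ge0 ?divr_ge0 ?mulr_ge0 ?exprn_ge0// ltW.
apply: le_integral_nonneg => x _; rewrite lee_fin ?excess_ge0//.
exact: le_excess.
Qed.

End convex_order.

(** * Decreasing rearrangement along the first coordinate *)

Section rearrangement.
Context {R : realType} {n : nat} (i0 : 'I_n) (Q0 : cube R n).
Local Notation mu := (@lebesgue R n).
Hypothesis Q01 : mu Q0 = 1%E.
Implicit Types f g : Rn R n -> R.

Let mQ0 := measurable_cube Q0.

Definition distribution f (a : R) : R := fine (mu (Q0 `&` [set x | a < f x])).

Let measure_Q0_sub (A : set (Rn R n)) : measurable A -> A `<=` Q0 -> mu A \is a fin_num.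
Proof.
move=> mA AQ; rewrite ge0_fin_numE//; apply: (@le_lt_trans _ _ (mu Q0)).
  by apply: le_measure; rewrite ?inE.
by rewrite Q01 ltry.
Qed.

Lemma distributionE f a : measurable_fun Q0 f ->
  mu (Q0 `&` [set x | a < f x]) = (distribution f a)%:E.
Proof.
move=> mf; rewrite fineK//; apply: measure_Q0_sub => [|x []//].
exact: measurable_superlevel.
Qed.

Lemma distribution_ge0 f a : 0 <= distribution f a.
Proof. exact: fine_ge0. Qed.

Lemma le_distribution f g a b : measurable_fun Q0 f -> measurable_fun Q0 g ->
  (forall x, cube_set Q0 x -> a < f x -> b < g x) ->
  distribution f a <= distribution g b.
Proof.
move=> mf mg fg; rewrite -lee_fin -!distributionE//; apply: le_measure; rewrite ?inE.
- exact: measurable_superlevel.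
- exact: measurable_superlevel.
by move=> x [Qx /= afx]; split => //=; exact: fg.
Qed.

Lemma distribution_le1 f a : measurable_fun Q0 f -> distribution f a <= 1.
Proof.
move=> mf; rewrite -lee_fin -distributionE// -Q01; apply: le_measure; rewrite ?inE//.
exact: measurable_superlevel.
Qed.

Lemma distribution_noninc f a b : measurable_fun Q0 f -> a <= b ->
  distribution f b <= distribution f a.
Proof. by move=> mf ab; apply: le_distribution => // x _; exact: le_lt_trans. Qed.

Lemma distribution_rcont f a t : measurable_fun Q0 f -> t < distribution f a ->
  exists2 b, a < b & t < distribution f b.
Proof.
move=> mf ta.
pose G (k : nat) := Q0 `&` [set x | a + k.+1%:R^-1 < f x].
have mG k : measurable (G k) by exact: measurable_superlevel.
have GE : \bigcup_k G k = Q0 `&` [set x | a < f x].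
  apply/seteqP; split => x.
    move=> [k _ [Qx /= h]]; split => //=; apply: le_lt_trans h.
    by rewrite lerDl invr_ge0.
  move=> [Qx /= h]; have := h; rewrite -subr_gt0 => /ltr_add_invr[k].
  by rewrite add0r ltrBrDl => hk; exists k.
have mGE : measurable (\bigcup_k G k) by exact: bigcupT_measurable.
have cvgG : (mu \o G) k @[k --> \oo] --> mu (\bigcup_k G k).
  apply: nondecreasing_cvg_mu => // i j ij; apply/subsetPset => x [Qx /= h]; split => //=.
  by apply: le_lt_trans h; rewrite lerD2l lef_pV2 ?posrE// ler_nat ltnS.
rewrite GE distributionE// in cvgG.
have /cvgG[k _ Hk] : nbhs (distribution f a)%:E [set y | (t%:E < y)%E].
  by apply: open_nbhs_nbhs; split; [exact: open_ereal_gt_ereal|rewrite /= lte_fin].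
exists (a + k.+1%:R^-1); first by rewrite ltrDl invr_gt0.
by have := Hk k (leqnn k); rewrite /= /G distributionE.
Qed.

Lemma distribution_vanish f t : measurable_fun Q0 f -> 0 < t ->
  exists2 a, 0 <= a & distribution f a <= t.
Proof.
move=> mf t0.
pose G (k : nat) := Q0 `&` [set x | k%:R < f x].
have mG k : measurable (G k) by exact: measurable_superlevel.
have GE : \bigcap_k G k = set0.
  apply/seteqP; split => x // /(_ (Num.truncn (f x)).+1 I)[_ /=].
  by move=> /(lt_trans (truncnS_gt (f x))); rewrite ltxx.
have G0 : (mu (G 0%N) < +oo)%E by rewrite /G distributionE// ltry.
have cvgG : (mu \o G) k @[k --> \oo] --> mu (\bigcap_k G k).
  apply: nonincreasing_cvg_mu => //.
  - by rewrite GE.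
  move=> i j ij; apply/subsetPset => x [Qx /= h]; split => //=.
  by apply: le_lt_trans h; rewrite ler_nat.
rewrite GE measure0 in cvgG.
have /cvgG[k _ Hk] : nbhs (0%E : \bar R) [set y | (y < t%:E)%E].
  by apply: open_nbhs_nbhs; split; [exact: open_ereal_lt_ereal|rewrite /= lte_fin].
exists k%:R => //; apply: ltW.
by have := Hk k (leqnn k); rewrite /= /G distributionE.
Qed.

(** The decreasing rearrangement for f >= 0, with real values. The infimum of the empty set is 0 by
    convention, whence the hypothesis of an admissible level in [star_gt] and [star_noninc]. *)
Definition star f (t : R) : R := inf [set a | 0 <= a /\ distribution f a <= t].

(** The Galois connection between [star] and [distribution], due to the right continuity of the
    latter; monotonicity and equimeasurability follow from it. *)
Lemma star_gt f t a : measurable_fun Q0 f ->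
  (exists2 a', 0 <= a' & distribution f a' <= t) -> 0 <= a ->
  (a < star f t) = (t < distribution f a).
Proof.
move=> mf [a' a'0 a't] a0; set S := [set a | 0 <= a /\ distribution f a <= t].
have infS : has_inf S by split; [exists a'|exists 0 => y []].
apply/idP/idP => [aS|].
  rewrite ltNge; apply/negP => ta; move: aS; rewrite ltNge => /negP; apply.
  by apply: ge_inf => //; exists 0 => y [].
move=> /(distribution_rcont mf)[b ab tb]; apply: (lt_le_trans ab).
apply: lb_le_inf => [|y [y0 yt]]; first by exists a'.
rewrite leNgt; apply/negP => yb.
by have := distribution_noninc mf (ltW yb); lra.
Qed.

Lemma star_ge0 f t : 0 <= star f t.
Proof.
rewrite /star; set S := [set a | _].
have [->|/set0P S0] := eqVneq S set0; first by rewrite inf0.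
by apply: lb_le_inf => // y [].
Qed.

Lemma star_noninc f t t' : measurable_fun Q0 f ->
  (exists2 a, 0 <= a & distribution f a <= t) -> t <= t' -> star f t' <= star f t.
Proof.
move=> mf St tt'; have St' : exists2 a, 0 <= a & distribution f a <= t'.
  by have [a a0 at_] := St; exists a => //; exact: le_trans tt'.
rewrite leNgt; apply/negP; rewrite star_gt ?star_ge0// => h.
by have := le_lt_trans tt' h; rewrite -star_gt ?star_ge0// ltxx.
Qed.

Lemma unit_cube_side : side Q0 = 1.
Proof.
have := lebesgue_cube Q0; rewrite Q01 => -[/esym/eqP].
rewrite pexpr_eq1 ?ltW ?side_gt0//; last exact: (leq_ltn_trans (leq0n i0) (ltn_ord i0)).
by move=> /eqP.
Qed.

Definition first_coord (x : Rn R n) : R := tnth x i0 - corner Q0 i0.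
Local Notation sigma := first_coord.

Lemma first_coord_itv x : cube_set Q0 x -> 0 <= sigma x <= 1.
Proof.
move=> /(_ i0); rewrite unit_cube_side /first_coord => /andP[? ?].
by apply/andP; split; lra.
Qed.

Lemma measurable_first_coord : measurable_fun Q0 sigma.
Proof.
apply: measurable_funB; last exact: measurable_cst.
by apply: measurable_funTS; exact: measurable_coord.
Qed.

Let lebesgue_slab (s t : R) : s <= t ->
  mu (box (fun i => if i == i0 then corner Q0 i + s else corner Q0 i)
    (fun i => if i == i0 then corner Q0 i + t else corner Q0 i + side Q0)) = (t - s)%:E.
Proof.
move=> st; rewrite (lebesgue_Borel (measurable_box _ _)) lebesgue_tuple_box; last first.
  by move=> i; rewrite unit_cube_side; case: ifP => _; lra.
congr EFin; rewrite (bigD1 i0)//= eqxx big1 ?mulr1; first lra.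
by move=> i /negbTE ->; rewrite unit_cube_side; lra.
Qed.

Lemma lebesgue_first_coord_lt t : 0 <= t <= 1 -> mu (Q0 `&` [set x | sigma x < t]) = t%:E.
Proof.
move=> /andP[t0 t1].
have mS := measurable_first_coord.
have mlt : measurable (Q0 `&` [set x | sigma x < t]).
  rewrite (_ : [set x | _] = sigma @^-1` `]-oo, t[%classic).
    by apply: mS => //; exact: measurable_itv.
  by apply/seteqP; split => x /=; rewrite in_itv.
pose slab (s t : R) : set (Rn R n) :=
  box (fun i => if i == i0 then corner Q0 i + s else corner Q0 i)
      (fun i => if i == i0 then corner Q0 i + t else corner Q0 i + side Q0).
have mslab s t' : measurable (slab s t').
  by apply: measurable_Borel; exact: measurable_box.
have sub : Q0 `&` [set x | sigma x < t] `<=` slab 0 t.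
  move=> x [Qx /=]; rewrite /first_coord => xt i; have := Qx i.
  by case: eqP => [->|_] /andP[? ?]; apply/andP; split; lra.
apply/eqP; rewrite eq_le; apply/andP; split.
  rewrite -[X in (_ <= X%:E)%E]subr0 -lebesgue_slab//.
  by apply: le_measure; rewrite ?inE//; exact: mslab.
rewrite -[leRHS]adde0 -(_ : mu (slab t t) = 0%E); last by rewrite lebesgue_slab// subrr.
apply: le_trans (measureU2 _ mlt (mslab t t)).
rewrite -[X in (X%:E <= _)%E]subr0 -lebesgue_slab//.
apply: le_measure; rewrite ?inE; [exact: mslab|exact: measurableU|].
move=> x xs.
have Qx : cube_set Q0 x.
  move=> i; have := xs i; rewrite unit_cube_side.
  by case: eqP => [->|_] /andP[? ?]; apply/andP; split; lra.
have [xt|tx] := ltP (sigma x) t; first by left.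
right => i; have := xs i; case: eqP => [->|//] /andP[? ?].
by move: tx; rewrite /first_coord => tx; apply/andP; split; lra.
Qed.

Definition rear f (x : Rn R n) : R := star f (sigma x).

Let star_dom f x : measurable_fun Q0 f -> 0 < sigma x ->
  exists2 a, 0 <= a & distribution f a <= sigma x.
Proof. by move=> mf; exact: distribution_vanish. Qed.

(** Where the coordinate is 0 the infimum in [star] may run over the empty set; this null face is
    set aside below. *)
Let Z := Q0 `&` [set x | sigma x <= 0].

Let mZ : measurable Z.
Proof.
rewrite /Z (_ : [set x | _] = sigma @^-1` `]-oo, 0]%classic).
  by apply: measurable_first_coord => //; exact: measurable_itv.
by apply/seteqP; split => x /=; rewrite in_itv.
Qed.

Let Z0 : mu Z = 0%E.
Proof.
apply/eqP; rewrite eq_le measure_ge0 andbT; apply/lee_addgt0Pr => e e0; rewrite add0e.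
pose t := Num.min e 1.
have t01 : 0 <= t <= 1 by rewrite le_min ltW//= ler01 ge_min lexx orbT.
have t0 : 0 < t by rewrite lt_min e0 ltr01.
apply: (@le_trans _ _ t%:E); last by rewrite lee_fin ge_min lexx.
rewrite -lebesgue_first_coord_lt//; apply: le_measure; rewrite ?inE.
- exact: mZ.
- rewrite (_ : [set x | _] = sigma @^-1` `]-oo, t[%classic).
    by apply: measurable_first_coord => //; exact: measurable_itv.
  by apply/seteqP; split => x /=; rewrite in_itv.
by move=> x [Qx /= x0]; split => //=; exact: le_lt_trans t0.
Qed.

Lemma first_coord_gt0_ae : {ae mu, forall x, cube_set Q0 x -> 0 < sigma x}.
Proof.
exists Z; split; [exact: mZ|exact: Z0|].
by move=> x /= /not_implyP[Qx /negP]; rewrite -leNgt => ?; split.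
Qed.

Lemma measurable_rear f : measurable_fun Q0 f -> measurable_fun Q0 (rear f).
Proof.
move=> mf; apply: (measurability _ (RGenOInfty.measurableE R)) => _ [_ [a ->] <-].
have [a0|a0] := ltP a 0.
  rewrite (_ : _ `&` _ = cube_set Q0)//.
  apply/seteqP; split => x; first by case.
  by move=> Qx; split => //=; rewrite in_itv/= andbT (lt_le_trans a0)// star_ge0.
pose A := Q0 `&` [set x | sigma x < distribution f a].
have mA : measurable A.
  rewrite /A (_ : [set x | _] = sigma @^-1` `]-oo, distribution f a[%classic).
    by apply: measurable_first_coord => //; exact: measurable_itv.
  by apply/seteqP; split => x /=; rewrite in_itv.
rewrite (_ : _ `&` _ = (A `\` Z) `|` (if a < star f 0 then Z else set0)).
  apply: measurableU; first by apply: measurableD => //; exact: mZ.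
  by case: ifP => _ //; exact: mZ.
have sZ x : Z x -> sigma x = 0.
  by move=> [/first_coord_itv/andP[? _] /= ?]; apply/eqP; rewrite eq_le; apply/andP.
apply/seteqP; split => x.
  move=> [Qx]; rewrite /= in_itv/= andbT /rear => ax.
  have [s0|s0] := leP (sigma x) 0.
    by right; have Zx : Z x by []; move: ax; rewrite sZ// => ->.
  left; split; last by move=> [_ /=]; rewrite leNgt s0.
  by split => //=; rewrite -star_gt//; exact: star_dom.
move=> [[[Qx /= sx] nZ]|].
  have s0 : 0 < sigma x by rewrite ltNge; apply/negP => ?; exact: nZ.
  by split => //=; rewrite in_itv/= andbT /rear star_gt//; exact: star_dom.
case: ifP => // ax Zx; split; first by case: Zx.
by rewrite /= in_itv/= andbT /rear sZ.
Qed.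

(** Up to the null set [Z], a < rear f x means that the coordinate of x is less than
    [distribution f a], and the coordinate is uniformly distributed. *)
Lemma distribution_rear f a : measurable_fun Q0 f -> 0 <= a ->
  mu (Q0 `&` [set x | a < rear f x]) = mu (Q0 `&` [set x | a < f x]).
Proof.
move=> mf a0; rewrite (distributionE _ mf).
rewrite -lebesgue_first_coord_lt ?distribution_ge0 ?distribution_le1//.
have mA : measurable (Q0 `&` [set x | sigma x < distribution f a]).
  rewrite (_ : [set x | _] = sigma @^-1` `]-oo, distribution f a[%classic).
    by apply: measurable_first_coord => //; exact: measurable_itv.
  by apply/seteqP; split => x /=; rewrite in_itv.
have mB : measurable (Q0 `&` [set x | a < rear f x]).
  by apply: measurable_superlevel => //; exact: measurable_rear.
apply/eqP; rewrite eq_le; apply/andP; split.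
  rewrite -[leRHS]adde0 -Z0; apply: le_trans (measureU2 _ mA mZ).
  apply: le_measure; rewrite ?inE//; first by apply: measurableU => //; exact: mZ.
  move=> x [Qx /= ax]; have [s0|s0] := leP (sigma x) 0; first by right.
  by left; split => //=; rewrite -star_gt//; exact: star_dom.
rewrite -[leRHS]adde0 -Z0; apply: le_trans (measureU2 _ mB mZ).
apply: le_measure; rewrite ?inE//; first by apply: measurableU => //; exact: mZ.
move=> x [Qx /= ax]; have [s0|s0] := leP (sigma x) 0; first by right.
by left; split => //=; rewrite /rear star_gt//; exact: star_dom.
Qed.

End rearrangement.

(** * The Hardy-Littlewood-Polya principle for finite sequences *)

Section hardy_littlewood_polya.
Context {R : realType} (K : nat) (Phi : (nat -> R) -> R).
Implicit Types a b : nat -> R.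

Definition swap_seq j k b : nat -> R :=
  fun i => if i == j then b k else if i == k then b j else b i.

(** The three hypotheses are modelled on the norm of a step function with [K] slices of equal
    measure. *)
Hypothesis Phi_mono : forall a b,
  (forall i, (i < K)%N -> 0 <= a i <= b i) -> Phi a <= Phi b.
Hypothesis Phi_swap : forall b j k, (j < K)%N -> (k < K)%N ->
  (forall i, (i < K)%N -> 0 <= b i) -> Phi (swap_seq j k b) = Phi b.
Hypothesis Phi_convex : forall a b (t : R), 0 <= t <= 1 ->
  (forall i, (i < K)%N -> 0 <= a i) -> (forall i, (i < K)%N -> 0 <= b i) ->
  Phi (fun i => (1 - t) * a i + t * b i) <= (1 - t) * Phi a + t * Phi b.

Let transfer j k (d : R) b : nat -> R :=
  fun i => if i == j then b j - d else if i == k then b k + d else b i.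

Let sum_transfer j k d b m : (j < k)%N ->
  \sum_(i < m) transfer j k d b i = \sum_(i < m) b i
    - (if (j < m)%N then d else 0) + (if (k < m)%N then d else 0).
Proof.
move=> jk; elim: m => [|m ih]; first by rewrite !big_ord0 !ltn0 subrr addr0.
rewrite !big_ord_recr/= ih /transfer.
have [mj|mj|mj] := ltngtP m j.
- have mk := ltn_trans mj jk.
  have -> : (j < m.+1)%N = false by rewrite ltnS leqNgt mj.
  have -> : (k < m.+1)%N = false by rewrite ltnS leqNgt mk.
  have -> : (k < m)%N = false by rewrite ltnNge ltnW.
  have -> : (m == k) = false by rewrite ltn_eqF.
  lra.
- have -> : (j < m.+1)%N by rewrite ltnS ltnW.
  have [mk|mk|mk] := ltngtP m k.
  + have -> : (k < m.+1)%N = false by rewrite ltnS leqNgt mk.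
    lra.
  + have -> : (k < m.+1)%N by rewrite ltnS ltnW.
    lra.
  + by rewrite mk ltnS leqnn; lra.
- have -> : (j < m.+1)%N by rewrite mj.
  have -> : (k < m.+1)%N = false by rewrite ltnS leqNgt mj jk.
  have -> : (k < m)%N = false by rewrite mj ltnNge ltnW.
  by rewrite mj; lra.
Qed.

(* A transfer of mass from j to k that does not reverse their order is a convex
   combination of b and of b with j and k exchanged. *)
Let Phi_transfer j k d b : (j < k)%N -> (k < K)%N ->
  (forall i, (i < K)%N -> 0 <= b i) -> 0 < d -> d <= b j - b k ->
  Phi (transfer j k d b) <= Phi b.
Proof.
move=> jk kK b0 d0 djk.
have jK := ltn_trans jk kK.
have D0 : 0 < b j - b k by exact: lt_le_trans djk.
pose t := d / (b j - b k).
have t01 : 0 <= t <= 1 by rewrite /t divr_ge0 ?ler_pdivrMr ?mul1r// ltW.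
have tD : t * (b j - b k) = d by rewrite divfK// gt_eqF.
have -> : transfer j k d b = fun i => (1 - t) * b i + t * swap_seq j k b i.
  apply/funext => i; rewrite /transfer /swap_seq.
  case: eqP => [->|_]; first by rewrite -tD; lra.
  by case: eqP => [->|_]; first (by rewrite -tD; lra); lra.
apply: (le_trans (Phi_convex t01 b0 _)).
  by move=> i iK; rewrite /swap_seq; case: ifP => _; [|case: ifP => _]; exact: b0.
by rewrite Phi_swap// -mulrDl subrK mul1r.
Qed.

Let ndiff a b := (\sum_(i < K) (a i != b i))%N.

(** Induction on the number of indices where [a] and [b] differ. Take the first k with b k < a k and
    the last j < k with a j < b j; moving [d] from j to k makes one of the two entries agree with
    [a]. Since a k <= a j, one has b k + d <= a k <= a j <= b j - d, so the order is not
    reversed. *)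
Lemma majorized_le a b :
  (forall i, (i < K)%N -> 0 <= a i) -> (forall i, (i < K)%N -> 0 <= b i) ->
  (forall i j, (i <= j)%N -> (j < K)%N -> a j <= a i) ->
  (forall m, (m <= K)%N -> \sum_(i < m) a i <= \sum_(i < m) b i) ->
  Phi a <= Phi b.
Proof.
move=> a0 + nda; have [c] := ubnP (ndiff a b); elim: c b => // c ih b cb b0 ab.
have [alb|nalb] := pselect (forall i, (i < K)%N -> a i <= b i).
  by apply: Phi_mono => i iK; rewrite a0//=; exact: alb.
have exk : exists k, (k < K)%N && (b k < a k).
  apply: contrapT => /forallNP nk; apply: nalb => i iK.
  by rewrite leNgt; apply/negP => h; apply: (nk i); rewrite iK.
case: (ex_minnP exk) => k /andP[kK bak] kmin.
have lek i : (i < k)%N -> a i <= b i.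
  move=> ik; rewrite leNgt; apply/negP => h.
  by have := kmin i; rewrite h (ltn_trans ik kK) => /(_ isT); rewrite leqNgt ik.
(* The partial sums of length k + 1 are ordered, so the surplus of [b] before [k] covers its deficit
   at [k]. *)
have sumk : a k - b k <= \sum_(i < k) (b i - a i).
  have := ab k.+1 kK; rewrite !big_ord_recr/= sumrB; lra.
have exj : exists j, (j < k)%N && (a j < b j).
  apply: contrapT => /forallNP nj.
  have : \sum_(i < k) (b i - a i) <= 0.
    apply: sumr_le0 => i _; rewrite subr_le0 leNgt; apply/negP => h.
    by apply: (nj i); rewrite h ltn_ord.
  by lra.
have jub j : (j < k)%N && (a j < b j) -> (j <= k)%N by move=> /andP[/ltnW].
case: (ex_maxnP exj jub) => j /andP[jk abj] jmax.
have eqjk i : (j < i < k)%N -> a i = b i.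
  move=> /andP[ji ik]; apply/eqP; rewrite eq_le lek//= leNgt; apply/negP => h.
  by have := jmax i; rewrite ik h => /(_ isT); rewrite leqNgt ji.
have jK := ltn_trans jk kK.
pose d := Num.min (b j - a j) (a k - b k).
have d0 : 0 < d by rewrite lt_min !subr_gt0 abj.
have d1 : d <= b j - a j by rewrite ge_min lexx.
have d2 : d <= a k - b k by rewrite ge_min lexx orbT.
have akj : a k <= a j by apply: nda => //; exact: ltnW.
apply: (@le_trans _ _ (Phi (transfer j k d b))); last first.
  by apply: Phi_transfer => //; lra.
apply: ih.
- rewrite -ltnS; apply: leq_trans cb; rewrite ltnS /ndiff.
  pose oj := Ordinal jK; pose ok := Ordinal kK.
  have kj : ok != oj by apply/eqP => -[e]; rewrite e ltnn in jk.
  have split_ndiff b' : ndiff a b' = ((a j != b' j) + ((a k != b' k) +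
      \sum_(i < K | (i != oj) && (i != ok)) (a i != b' i)))%N.
    by rewrite /ndiff (bigD1 oj)//= (bigD1 ok).
  rewrite -/(ndiff a (transfer j k d b)) -/(ndiff a b) !split_ndiff.
  rewrite [X in (_ + (_ + X) < _)%N](eq_bigr (fun i : 'I_K => a i != b i : nat)); last first.
    move=> i /andP[ij ik]; rewrite /transfer ifF; last exact/negbTE.
    by rewrite ifF//; exact/negbTE.
  rewrite !addnA ltn_add2r (lt_eqF abj) (gt_eqF bak)/= /transfer eqxx (gtn_eqF jk) eqxx.
  have [dj|dk] : d = b j - a j \/ d = a k - b k.
    by rewrite /d; case: leP => _; [left|right].
  + have -> : b j - d = a j by lra.
    by rewrite eqxx/=; case: (_ != _).
  + have -> : b k + d = a k by lra.
    by rewrite eqxx/=; case: (_ != _).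
- move=> i iK; rewrite /transfer; case: eqP => _; first by have := a0 _ jK; lra.
  by case: eqP => _; [have := b0 _ kK; lra|exact: b0].
- move=> m mK; rewrite sum_transfer//.
  have [mj|jm] := leqP m j.
    by rewrite ltnNge (leq_trans mj (ltnW jk))/=; have := ab m mK; lra.
  have [mk|km] := leqP m k; last by have := ab m mK; lra.
  (* Between [j] and [k] the sequences agree, so the surplus at length [m] equals that at length
     [k], which is at least [d]. *)
  have : \sum_(i < k) (b i - a i) = \sum_(i < m) (b i - a i).
    rewrite -!(big_mkord xpredT (fun i => b i - a i)) (big_cat_nat (n := m))//=.
    rewrite [X in _ + X]big_nat_cond [X in _ + X]big1 ?addr0//.
    by move=> i /andP[/andP[mi ik] _]; rewrite eqjk ?subrr// ik (leq_trans jm mi).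
  by rewrite [in RHS]sumrB; lra.
Qed.

End hardy_littlewood_polya.

(** * Step functions on equal slices *)

Section step_functions.
Context {R : realType} {n : nat} (i0 : 'I_n) (Q0 : cube R n).
Local Notation mu := (@lebesgue R n).
Hypothesis Q01 : mu Q0 = 1%E.
Context (K : nat) (K0 : (0 < K)%N).
Local Notation sigma := (first_coord i0 Q0).

Let mQ0 := measurable_cube Q0.

Let K0' : 0 < K%:R :> R. Proof. by rewrite ltr0n. Qed.

(** The minimum puts the end point 1 into the last slice instead of giving it a slice of its own. *)
Definition slice_index (x : Rn R n) : nat := minn (Num.truncn (K%:R * sigma x)) K.-1.

Lemma slice_index_lt x : (slice_index x < K)%N.
Proof. by rewrite /slice_index gtn_min orbC ltn_predL K0. Qed.

Lemma slice_index_lb x : cube_set Q0 x -> (slice_index x)%:R / K%:R <= sigma x.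
Proof.
move=> Qx; have /andP[s0 s1] := first_coord_itv i0 Q01 Qx.
rewrite ler_pdivrMr// mulrC; apply: (@le_trans _ _ (Num.truncn (K%:R * sigma x))%:R).
  by rewrite ler_nat geq_minl.
by rewrite truncn_le mulr_ge0.
Qed.

Lemma slice_index_ub x : cube_set Q0 x -> sigma x <= (slice_index x).+1%:R / K%:R.
Proof.
move=> Qx; have /andP[s0 s1] := first_coord_itv i0 Q01 Qx.
rewrite ler_pdivlMr// mulrC /slice_index minnE; have [h|h] := leqP (Num.truncn (K%:R * sigma x)) K.-1.
  rewrite -minnE (minn_idPl h); exact/ltW/truncnS_gt.
rewrite -minnE (minn_idPr (ltnW h)) prednK//.
by rewrite ler_piMr.
Qed.

Let slice_ltE x m : cube_set Q0 x -> (m < K)%N ->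
  (slice_index x < m)%N = (sigma x < m%:R / K%:R).
Proof.
move=> Qx mK; have /andP[s0 s1] := first_coord_itv i0 Q01 Qx.
have [->|m0] := eqVneq m 0%N; first by rewrite ltn0 mul0r ltNge s0.
apply/idP/idP => [h|].
  move: h; rewrite /slice_index gtn_min.
  have -> : (K.-1 < m)%N = false by rewrite ltnNge -ltnS prednK ?mK.
  rewrite orbF => h; rewrite ltr_pdivlMr// mulrC.
  by apply: (lt_le_trans (truncnS_gt _)); rewrite ler_nat.
move=> h; rewrite -(ltr_nat R).
have h2 := le_lt_trans (slice_index_lb Qx) h.
by move: h2; rewrite ltr_pM2r ?invr_gt0.
Qed.

Let slice i : set (Rn R n) := Q0 `&` [set x | slice_index x = i].

Let below m : set (Rn R n) := Q0 `&` [set x | (slice_index x < m)%N].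

Let lebesgue_below m : (m <= K)%N -> measurable (below m) /\ mu (below m) = (m%:R / K%:R)%:E.
Proof.
rewrite leq_eqVlt => /orP[/eqP ->|mK].
  have -> : below K = Q0 by apply/seteqP; split => x; [case|split => //; exact: slice_index_lt].
  by rewrite divff ?gt_eqF// Q01.
have -> : below m = Q0 `&` [set x | sigma x < m%:R / K%:R].
  by apply/seteqP; split => x [Qx /=]; [rewrite slice_ltE|rewrite -slice_ltE].
split.
  rewrite (_ : [set x | _] = sigma @^-1` `]-oo, m%:R / K%:R[%classic).
    by apply: measurable_first_coord => //; exact: measurable_itv.
  by apply/seteqP; split => x /=; rewrite in_itv.
apply: lebesgue_first_coord_lt => //.
by rewrite divr_ge0//= ler_pdivrMr// mul1r ler_nat ltnW.
Qed.

Let lebesgue_slice i : (i < K)%N -> measurable (slice i) /\ mu (slice i) = (K%:R^-1)%:E.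
Proof.
move=> iK; have [m1 e1] := lebesgue_below (ltnW iK); have [m2 e2] := lebesgue_below iK.
have E : slice i = below i.+1 `\` below i.
  apply/seteqP; split => x.
    by move=> [Qx /= xi]; split; [split => //=; rewrite xi|move=> [_ /=]; rewrite xi ltnn].
  move=> [[Qx /=]]; rewrite ltnS => xi nx; split => //=; apply/eqP.
  by rewrite eqn_leq xi leqNgt; apply/negP => h; apply: nx.
have sub : below i `<=` below i.+1 by move=> x [Qx /= h]; split => //=; exact: ltnW.
split; first by rewrite E; exact: measurableD.
have b2 : (mu (below i.+1) < +oo)%E by rewrite e2 ltry.
have := @measureD _ _ _ mu (below i.+1) (below i) m2 m1 b2.
rewrite E (setIidr sub) => ->; rewrite [X in (X - _)%E]e2 [X in (_ - X)%E]e1 -EFinB; congr EFin.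
by rewrite -mulrBl -natrB ?leqnSn// subSnn mul1r.
Qed.

Definition step (v : nat -> R) (x : Rn R n) : R := v (slice_index x).

Lemma measurable_step v : measurable_fun Q0 (step v).
Proof.
move=> _ Y mY; rewrite (_ : _ `&` _ = \big[setU/set0]_(i < K | v i \in Y) slice i).
  by apply: bigsetU_measurable => i _; exact: (lebesgue_slice (ltn_ord i)).1.
apply/seteqP; split => x.
  move=> [Qx /= vY]; rewrite -bigcup_seq_cond.
  exists (Ordinal (slice_index_lt x)) => //=; rewrite mem_index_enum/=.
  exact: mem_set.
rewrite -bigcup_seq_cond => -[i /= /andP[_ /set_mem vY] [Qx /= xi]]; split => //=.
by rewrite /step xi.
Qed.

Lemma integral_step (v : nat -> R) : (forall i, (i < K)%N -> 0 <= v i) ->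
  (\int[mu]_(x in Q0) (step v x)%:E = (K%:R^-1 * \sum_(i < K) v i)%:E)%E.
Proof.
move=> v0.
have -> : (\int[mu]_(x in Q0) (step v x)%:E =
    \int[mu]_(x in Q0) \sum_(i < K) ((v i)%:E * (\1_(slice i) x)%:E))%E.
  apply: eq_integral => x /set_mem Qx.
  rewrite (bigD1 (Ordinal (slice_index_lt x)))//= indicE mem_set// mule1.
  rewrite big1 ?adde0// => i ix; rewrite indicE memNset ?mule0// => -[_ /= xi].
  by move/eqP: ix; apply; apply/val_inj.
have mi i : measurable_fun Q0 (fun x => (v (i : 'I_K))%:E * (\1_(slice i) x)%:E)%E.
  apply: emeasurable_funM; first exact: measurable_cst.
  apply/measurable_EFinP; apply: measurable_funTS; apply: measurable_indic.
  exact: (lebesgue_slice (ltn_ord i)).1.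
rewrite ge0_integral_sum//; last first.
  by move=> i x _; rewrite mule_ge0// lee_fin// v0.
rewrite mulr_sumr -sumEFin; apply: eq_bigr => i _.
have [mi' ei] := lebesgue_slice (ltn_ord i).
have ind0 x : cube_set Q0 x -> (0 <= (\1_(slice i) x)%:E :> \bar R)%E.
  by rewrite lee_fin.
have mind : measurable_fun Q0 (fun x => (\1_(slice i) x)%:E : \bar R).
  by apply/measurable_EFinP; apply: measurable_funTS; exact: measurable_indic.
rewrite (ge0_integralZl_EFin mu mQ0 ind0 mind (v0 _ (ltn_ord i))).
rewrite integral_indic// (setIidl (fun x (h : slice i x) => h.1)) mulrC EFinM.
by congr (_ * _)%E.
Qed.

(** Reduces distributions of step functions to counts of slices, so that the discretization error
    becomes a counting error. *)
Lemma lebesgue_step (p : pred nat) :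
  mu (Q0 `&` [set x | p (slice_index x)]) = (K%:R^-1 * \sum_(i < K) (p i)%:R)%:E.
Proof.
rewrite -(@integral_step (fun i => (p i)%:R))//.
have mp : measurable (Q0 `&` [set x | p (slice_index x)]).
  have := @measurable_superlevel _ (Rn R n) R Q0 (step (fun i => (p i)%:R)) 2^-1 mQ0 (measurable_step _).
  rewrite (_ : [set x | _] = [set x | p (slice_index x)])//.
  apply/seteqP; split => x /=; rewrite /step; case: (p _) => //=.
    by move=> h; have : 2^-1 < 0 :> R := h; rewrite ltNge invr_ge0 ler0n.
  by move=> _; rewrite invf_lt1// ltr1n.
rewrite (_ : _ `&` _ = (Q0 `&` [set x | p (slice_index x)]) `&` Q0); last first.
  by rewrite setIAC setIid.
rewrite -[LHS](integral_indic mu mQ0 mp); apply: eq_integral => x /set_mem Qx.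
congr EFin; rewrite indicE /step; case: (boolP (p _)) => px; first by rewrite mem_set.
by rewrite memNset// => -[_ /=]; rewrite (negbTE px).
Qed.

End step_functions.

(** * Counting slices, and partial sums from excesses *)

Section counting.
Context {R : realType}.

(** For y = K d this counts the left end points i / K below d: sampling there overshoots by at most
    one slice. *)
Lemma count_lt_le (K : nat) (y : R) : 0 <= y ->
  \sum_(i < K) (i%:R < y)%R%:R <= y + 1 :> R.
Proof.
move=> y0; elim: K => [|K ih]; first by rewrite big_ord0; lra.
rewrite big_ord_recr/=; case: (ltP K%:R y) => Ky; last by rewrite addr0.
have : \sum_(i < K) (i%:R < y)%R%:R <= K%:R :> R.
  rewrite -[in leRHS](card_ord K) -sumr_const; apply: ler_sum => i _.
  by case: (_ < _).
by rewrite mulr1n; lra.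
Qed.

(** The same count for right end points, where sampling falls short by at most one slice. *)
Lemma count_lt_ge (K : nat) (y : R) : y <= K%:R ->
  y - 1 <= \sum_(i < K) (i.+1%:R < y)%R%:R :> R.
Proof.
elim: K => [|K ih] yK; first by rewrite big_ord0; lra.
rewrite big_ord_recr/= ltNge yK mulr0n addr0.
have [/ih//|Ky] := leP y K%:R.
rewrite (eq_bigr (fun=> 1)) ?sumr_const ?card_ord; first by rewrite -natr1 in yK; lra.
by move=> i _; rewrite (le_lt_trans _ Ky)// ler_nat.
Qed.

(* The Legendre-dual form of the majorization hypothesis: testing the excesses
   at the level l = b (m - 1) yields the partial sums of length m. *)
Lemma partial_sums_of_excess (K : nat) (a b : nat -> R) :
  (forall i, (i < K)%N -> 0 <= b i) ->
  (forall i j, (i <= j)%N -> (j < K)%N -> b j <= b i) ->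
  (forall l, 0 < l -> \sum_(i < K) Num.max 0 (a i - l) <= \sum_(i < K) Num.max 0 (b i - l)) ->
  forall m, (m <= K)%N -> \sum_(i < m) a i <= \sum_(i < m) b i.
Proof.
move=> b0 ndb ab [|m] mK; first by rewrite !big_ord0.
set l := b m; apply/ler_addgt0Pr => e e0.
(* The hypothesis asks for a positive level, and [b m] may be 0; over the m + 1 terms the shift by
   [e'] adds up to [e]. *)
pose e' := e / m.+1%:R.
have e'0 : 0 < e' by rewrite divr_gt0.
have l0 : 0 < l + e' by rewrite ltr_wpDl// b0.
have split_sum (v : nat -> R) : \sum_(i < K) v i =
    \sum_(i < m.+1) v i + \sum_(m.+1 <= i < K) v i.
  by rewrite -!(big_mkord xpredT) (big_cat_nat (n := m.+1)).
apply: (@le_trans _ _ (\sum_(i < m.+1) (Num.max 0 (a i - (l + e')) + (l + e')))).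
  by apply: ler_sum => i _; rewrite -lerBlDr le_max lexx orbT.
rewrite big_split/= sumr_const card_ord -mulr_natl mulrDr [_ * e']mulrC divfK ?pnatr_eq0//.
rewrite addrA lerD2r.
have h1 : \sum_(i < m.+1) Num.max 0 (a i - (l + e')) <=
    \sum_(i < K) Num.max 0 (a i - (l + e')).
  rewrite (split_sum (fun i => Num.max 0 (a i - (l + e')))) lerDl.
  by apply: sumr_ge0 => i _; rewrite le_max lexx.
have h2 : \sum_(i < K) Num.max 0 (b i - (l + e')) <= \sum_(i < m.+1) (b i - l).
  rewrite (split_sum (fun i => Num.max 0 (b i - (l + e')))).
  rewrite [X in _ + X]big_nat_cond [X in _ + X]big1 ?addr0.
    apply: ler_sum => i _; rewrite ge_max; apply/andP; split; last lra.
    by rewrite subr_ge0; apply: ndb => //; rewrite -ltnS.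
  move=> i /andP[/andP[mi iK] _]; apply/max_idPl.
  by have := ndb m i (ltnW mi) iK; rewrite -/l; lra.
have := ab _ l0; rewrite sumrB sumr_const card_ord -mulr_natl in h2 *.
by lra.
Qed.

Lemma eseries2 (F : nat -> \bar R) : (forall i, (1 < i)%N -> F i = 0%E) ->
  (\sum_(i <oo) F i = F 0%N + F 1%N)%E.
Proof.
move=> F0; apply/cvg_lim => //; apply: cvg_near_cst; exists 2%N => // k /= k2.
rewrite big_ltn; last exact: ltnW.
rewrite big_ltn// big_nat_cond big1 ?adde0// => i /andP[/andP[i1 _] _].
exact: F0.
Qed.

Lemma le_integral_distribution2 d (T : measurableType d)
    (m : {sigma_finite_measure set T -> \bar R}) (c : R) (D : set T) (f g h : T -> R) :
  0 <= c -> measurable D -> measurable_fun D f -> (forall x, D x -> 0 <= f x) ->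
  measurable_fun D g -> (forall x, D x -> 0 <= g x) ->
  measurable_fun D h -> (forall x, D x -> 0 <= h x) ->
  (forall t, 0 < t -> (m (D `&` [set x | (t < f x)%R]) <=
    c%:E * (m (D `&` [set x | (t < g x)%R]) + m (D `&` [set x | (t < h x)%R])))%E) ->
  (\int[m]_(x in D) (f x)%:E <=
    c%:E * (\int[m]_(x in D) (g x)%:E + \int[m]_(x in D) (h x)%:E))%E.
Proof.
move=> c0 mD mf f0 mg g0 mh h0 H.
pose E (i : nat) := if (i < 2)%N then D else set0.
pose G (i : nat) := if i == 0%N then g else h.
have := @le_integral_distribution _ _ _ m c D f E G c0 mD mf f0.
rewrite (@eseries2 (fun i => \int[m]_(x in E i) (G i x)%:E)%E); last first.
  by move=> i i1; rewrite /E ltnNge i1/= integral_set0.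
apply.
- by move=> i; rewrite /E; case: ifP.
- by move=> i; rewrite /E /G; case: ifP => _; [case: ifP|exact: measurable_fun_set0].
- by move=> i x; rewrite /E /G; case: ifP => // _; case: ifP => _; [exact: g0|exact: h0].
move=> t t0; rewrite (@eseries2 (fun i => m (E i `&` [set x | (t < G i x)%R])%E)); last first.
  by move=> i i1; rewrite /E ltnNge i1/= set0I measure0.
exact: H.
Qed.

End counting.

(** * Discretized majorization in a rearrangement invariant space *)

Section ri_norm.
Context {R : realType} {n : nat} (i0 : 'I_n) (Q0 : cube R n).
Local Notation mu := (@lebesgue R n).
Hypothesis Q01 : mu Q0 = 1%E.
Context (X : set (Rn R n -> R)) (N : (Rn R n -> R) -> R) (ri : ri_space Q0 X N).
Implicit Types f g w : Rn R n -> R.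

Let bfs := ri_bfs ri.
Let mQ0 := measurable_cube Q0.

Lemma ri_equimeasurable f g : measurable_fun Q0 f -> X g ->
  (forall a, 0 <= a -> mu (Q0 `&` [set x | a < `|f x|]) = mu (Q0 `&` [set x | a < `|g x|])) ->
  X f /\ N f = N g.
Proof.
move=> mf Xg fg; apply: (ri_invariant ri mf Xg) => t _.
congr ereal_inf; apply/seteqP; split => _ [a [a0 ha] <-]; exists a => //; split => //.
  by rewrite -fg.
by rewrite fg.
Qed.

Lemma ri_rear f : X f -> (forall x, 0 <= f x) ->
  X (rear i0 Q0 f) /\ N (rear i0 Q0 f) = N f.
Proof.
move=> Xf f0; have mf := bfs_measurable bfs Xf.
apply: ri_equimeasurable => //; first exact: measurable_rear.
move=> a a0; rewrite (_ : [set x | a < `|f x|] = [set x | a < f x]); last first.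
  by apply/seteqP; split => x /=; rewrite ger0_norm.
rewrite -(distribution_rear i0 Q01 mf a0); congr (mu (_ `&` _)).
by apply/seteqP; split => x /=; rewrite ger0_norm// star_ge0.
Qed.

Lemma ri_ideal f g : measurable_fun Q0 f -> X g ->
  (forall x, cube_set Q0 x -> `|f x| <= `|g x|) -> X f /\ N f <= N g.
Proof.
move=> mf Xg fg; apply: (bfs_ideal bfs mf Xg).
by apply: filterE => x; exact: fg.
Qed.

Section step_norm.
Context (K : nat) (K0 : (0 < K)%N).
Let st := step i0 Q0 K.

Lemma ri_step v : X (st v).
Proof.
have [C HC] := ri_Linfty_sub ri.
pose M := \sum_(i < K) `|v i|.
apply: (HC (st v) M _ _ _).1; [exact: measurable_step|by apply: sumr_ge0|].
apply: filterE => x _; rewrite /M (bigD1 (Ordinal (slice_index_lt i0 Q0 K0 x)))//=.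
by rewrite lerDl sumr_ge0.
Qed.

Let Phi v := N (st v).

Let Phi_mono a b : (forall i, (i < K)%N -> 0 <= a i <= b i) -> Phi a <= Phi b.
Proof.
move=> ab; apply: (ri_ideal _ (ri_step b) _).2; first exact: measurable_step.
move=> x _; rewrite /st /step; have /andP[a0 aleb] := ab _ (slice_index_lt i0 Q0 K0 x).
by rewrite !ger0_norm// (le_trans a0).
Qed.

(** The slices have equal measure, so exchanging two of them preserves the distribution. *)
Let Phi_swap b j k : (j < K)%N -> (k < K)%N ->
  (forall i, (i < K)%N -> 0 <= b i) -> Phi (swap_seq j k b) = Phi b.
Proof.
move=> jK kK _; apply: (ri_equimeasurable _ (ri_step b) _).2; first exact: measurable_step.
move=> a a0.
rewrite [LHS](lebesgue_step i0 Q01 K0 (fun i => a < `|swap_seq j k b i|)).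
rewrite [RHS](lebesgue_step i0 Q01 K0 (fun i => a < `|b i|)).
congr (_ * _)%:E.
pose s := tperm (Ordinal jK) (Ordinal kK).
rewrite [RHS](reindex_inj (@perm_inj _ s)); apply: eq_bigr => i _.
congr ((_ < `|_|)%R%:R); rewrite /swap_seq.
case: tpermP => [->|->|/eqP ij /eqP ik] /=.
- by rewrite eqxx.
- by rewrite eqxx; case: eqP => // ->.
- by rewrite -!val_eqE/= in ij ik; rewrite (negbTE ij) (negbTE ik).
Qed.

Let Phi_convex a b (t : R) : 0 <= t <= 1 ->
  (forall i, (i < K)%N -> 0 <= a i) -> (forall i, (i < K)%N -> 0 <= b i) ->
  Phi (fun i => (1 - t) * a i + t * b i) <= (1 - t) * Phi a + t * Phi b.
Proof.
move=> /andP[t0 t1] _ _.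
have Xa := bfs_scale bfs (1 - t) (ri_step a); have Xb := bfs_scale bfs t (ri_step b).
apply: (le_trans (bfs_norm_add bfs Xa Xb)).
rewrite (bfs_norm_scale bfs _ (ri_step a)) (bfs_norm_scale bfs _ (ri_step b)).
by rewrite !ger0_norm// subr_ge0.
Qed.

Lemma ri_step_majorized a b :
  (forall i, (i < K)%N -> 0 <= a i) -> (forall i, (i < K)%N -> 0 <= b i) ->
  (forall i j, (i <= j)%N -> (j < K)%N -> a j <= a i) ->
  (forall i j, (i <= j)%N -> (j < K)%N -> b j <= b i) ->
  (forall l, 0 < l -> \sum_(i < K) Num.max 0 (a i - l) <= \sum_(i < K) Num.max 0 (b i - l)) ->
  N (st a) <= N (st b).
Proof.
move=> a0 b0 nda ndb ab.
apply: (@majorized_le R K Phi) => //.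
exact: partial_sums_of_excess.
Qed.

End step_norm.

Lemma excess_vanish g c : L1 Q0 g -> (forall x, 0 <= g x) -> 0 < c ->
  exists2 T : R, 0 < T & (\int[mu]_(x in Q0) (Num.max 0 (g x - T))%:E <= c%:E)%E.
Proof.
move=> L1g g0 c0.
have mg : measurable_fun Q0 g by move: L1g => /measurable_int/measurable_EFinP.
have h0 : (\int[mu]_(x in Q0) (Num.max 0 (g x - k%:R))%:E)%E @[k --> \oo] --> 0%E.
  have -> : (0%E : \bar R) = (\int[mu]_(x in Q0) (fun=> 0%E) x)%E.
    by rewrite integral0_eq.
  have [] := @dominated_convergence _ _ _ mu Q0 mQ0
    (fun k x => (Num.max 0 (g x - k%:R))%:E) (fun=> 0%E) (EFin \o g).
  - by move=> k; apply/measurable_EFinP; exact: measurable_excess.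
  - exact: measurable_cst.
  - apply: aeW => x _; apply: cvg_near_cst.
    exists (Num.truncn (g x)).+1 => // k /= gk; congr EFin; apply/max_idPl.
    rewrite subr_le0; apply: (le_trans (ltW (truncnS_gt _))).
    by rewrite ler_nat.
  - exact: L1g.
  - apply: aeW => x k _; rewrite /= lee_fin ger0_norm ?excess_ge0//.
    by rewrite ge_max g0 gerBl/= ler0n.
  by move=> _ _; exact.
have /h0[k _ Hk] : nbhs (0%E : \bar R) [set y | (y < c%:E)%E].
  by apply: open_nbhs_nbhs; split; [exact: open_ereal_lt_ereal|rewrite /= lte_fin].
exists k.+1%:R => //; apply/ltW/(Hk k.+1); exact: leqnSn.
Qed.

Let excess_split (x T l : R) : 0 <= l ->
  Num.max 0 (x - l) <= Num.max 0 (Num.min x T - l) + Num.max 0 (x - T).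
Proof.
move=> l0; have [xT|Tx] := leP x T; first by rewrite lerDl le_max lexx.
rewrite ge_max addr_ge0 ?le_max ?lexx//=.
have : T - l <= Num.max 0 (T - l) by rewrite le_max lexx orbT.
have : x - T <= Num.max 0 (x - T) by rewrite le_max lexx orbT.
by move: (Num.max 0 (T - l)) (Num.max 0 (x - T)) => p q; lra.
Qed.

Let star_dom0 w W t : measurable_fun Q0 w -> (forall x, 0 <= w x <= W) -> 0 <= t ->
  exists2 a, 0 <= a & distribution Q0 w a <= t.
Proof.
move=> mw wW t0; exists (Num.max 0 W); first by rewrite le_max lexx.
rewrite -lee_fin -distributionE// (_ : _ `&` _ = set0) ?measure0 ?lee_fin//.
apply/seteqP; split => x // [_ /=]; rewrite ltNge => /negP; apply.
by have /andP[_ /le_trans] := wW x; apply; rewrite le_max lexx orbT.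
Qed.

(* Meant for w truncated at a level W below its essential supremum: its
   distribution function is then at least r until it vanishes, and the factor 1/4
   absorbs the discretization error once K is large compared with r^-1 and T/c. *)
Lemma majorized_truncated w g W r c : measurable_fun Q0 w -> (forall x, 0 <= w x <= W) ->
  0 < W -> 0 < r -> (forall a, 0 <= a < W -> r <= distribution Q0 w a) ->
  X g -> (forall x, 0 <= g x) ->
  0 < c -> (\int[mu]_(x in Q0) (Num.max 0 (g x - W))%:E = c%:E)%E ->
  (forall l, 0 < l -> (\int[mu]_(x in Q0) (Num.max 0 (w x - l))%:E <=
    4^-1%:E * \int[mu]_(x in Q0) (Num.max 0 (g x - l))%:E)%E) ->
  X w -> N w <= N g.
Proof.
move=> mw wW W0 r0 wr Xg g0 c0 cE wg Xw.
have mg := bfs_measurable bfs Xg.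
have [C HC] := ri_sub_L1 ri; have [L1g _] := HC g Xg.
have w0 x : 0 <= w x by have /andP[] := wW x.
have [T T0 HT] : exists2 T : R, 0 < T &
    (\int[mu]_(x in Q0) (Num.max 0 (g x - T))%:E <= (c / 4)%:E)%E.
  by apply: excess_vanish => //; rewrite divr_gt0.
(* K >= 1 / r makes one slice no larger than any nonempty superlevel set of [w], up to null sets; K
   >= 4 T / c makes a slice of height [T] integrate to at most c / 4. *)
pose K := (Num.truncn (r^-1 + 4 * T / c)).+1.
have K0 : (0 < K)%N by [].
have K0' : 0 < K%:R :> R by rewrite ltr0n.
have KK : r^-1 + 4 * T / c < K%:R by exact: truncnS_gt.
have rK : K%:R^-1 <= r.
  rewrite -[r]invrK lef_pV2 ?posrE ?invr_gt0//; apply: ltW; apply: le_lt_trans KK.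
  by rewrite lerDl divr_ge0 ?mulr_ge0// ltW.
have TK : T / K%:R <= c / 4.
  rewrite ler_pdivrMr// mulrC mulrA ler_pdivlMr// -ler_pdivrMr// mulrC [T * 4]mulrC mulrC.
  apply: ltW; apply: le_lt_trans KK.
  by rewrite lerDr invr_ge0 ltW.
(* Left end points for [w] and right end points for [g]: the two step functions then lie above the
   rearrangement of [w] and below that of [g]. *)
pose a i := star Q0 w (i%:R / K%:R).
pose b i := star Q0 g (i.+1%:R / K%:R).
have iK0 (i : nat) : 0 <= i%:R / K%:R :> R by rewrite divr_ge0.
have adom i := star_dom0 mw wW (iK0 i).
have bdom (i : nat) : exists2 a, 0 <= a & distribution Q0 g a <= i.+1%:R / K%:R.
  by apply: distribution_vanish => //; rewrite divr_gt0.
have nda i j : (i <= j)%N -> (j < K)%N -> a j <= a i.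
  by move=> ij _; apply: star_noninc => //; rewrite ler_pM2r ?invr_gt0// ler_nat.
have ndb i j : (i <= j)%N -> (j < K)%N -> b j <= b i.
  by move=> ij _; apply: star_noninc => //; rewrite ler_pM2r ?invr_gt0// ler_nat ltnS.
have wa : N w <= N (step i0 Q0 K a).
  have [Xr <-] := ri_rear Xw w0.
  apply: (ri_ideal _ (ri_step K0 a) _).2; first exact: measurable_rear.
  move=> x Qx; rewrite !ger0_norm ?star_ge0// /rear /step /a.
  apply: star_noninc => //; exact: slice_index_lb.
have bg : N (step i0 Q0 K b) <= N g.
  have [Xr <-] := ri_rear Xg g0.
  apply: (bfs_ideal bfs _ Xr _).2; first exact: measurable_step.
  apply: filterS (first_coord_gt0_ae i0 Q01) => x s0 Qx.
  rewrite !ger0_norm ?star_ge0// /rear /step /b; apply: star_noninc => //.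
    by apply: distribution_vanish => //; exact: s0.
  exact: slice_index_ub.
apply: (le_trans wa); apply: le_trans bg.
apply: ri_step_majorized => //.
- by move=> i _; exact: star_ge0.
- by move=> i _; exact: star_ge0.
move=> l l0.
have [lW|Wl] := ltP l W; last first.
  rewrite big1 => [|i _]; first by apply: sumr_ge0 => i _; exact: excess_ge0.
  apply/max_idPl; rewrite subr_le0; apply: le_trans Wl; rewrite leNgt; apply/negP.
  rewrite star_gt ?ltW// ltNge => /negP; apply; apply: le_trans (iK0 i).
  rewrite -lee_fin -distributionE// (_ : _ `&` _ = set0) ?measure0//.
  by apply/seteqP; split => x // [_ /=]; rewrite ltNge; have /andP[_ ->] := wW x.
have Ki0 : 0 < K%:R^-1 :> R by rewrite invr_gt0.
rewrite -(ler_pM2l Ki0) -lee_fin.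
have e0 v i : (i < K)%N -> 0 <= Num.max 0 (v i - l) by move=> _; exact: excess_ge0.
rewrite -(@integral_step _ _ i0 Q0 Q01 K K0 (fun i => Num.max 0 (a i - l)) (e0 a)).
rewrite -(@integral_step _ _ i0 Q0 Q01 K K0 (fun i => Num.max 0 (b i - l)) (e0 b)).
set IA := (\int[mu]_(x in Q0) _)%E; set IB := (\int[mu]_(x in Q0) _)%E.
(* A superlevel set of [w] has measure 0 or at least r >= 1 / K, so the slice gained by sampling at
   most doubles its measure. *)
have IAw : (IA <= 2%:E * \int[mu]_(x in Q0) (Num.max 0 (w x - l))%:E)%E.
  rewrite -[X in (_ * X)%E]adde0 -[X in (_ * (_ + X))%E](integral0 mu Q0).
  have ma : measurable_fun Q0 (step i0 Q0 K (fun i => Num.max 0 (a i - l))).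
    exact: measurable_step.
  apply: (@le_integral_distribution2 _ _ _ mu 2 Q0 _ _ (fun=> 0) (ler0n _ 2) mQ0 ma
    (fun x _ => excess_ge0 _ _) (measurable_excess l mw) (fun x _ => excess_ge0 _ _)
    (measurable_cst _) (fun x _ => lexx _)).
  move=> t t0; rewrite [leLHS](lebesgue_step i0 Q01 K0 (fun i => t < Num.max 0 (a i - l))).
  rewrite (_ : [set x | t < Num.max 0 (w x - l)] = [set x | l + t < w x]); last first.
    by apply/seteqP; split => x /=; rewrite lt_excess.
  rewrite (_ : Q0 `&` [set x | t < 0] = set0); last first.
    by apply/seteqP; split => x // [_ /=]; rewrite ltNge ltW.
  rewrite measure0 adde0 [X in (_ * X)%E](distributionE Q01 _ mw) -EFinM lee_fin.
  have lt0 : 0 <= l + t by rewrite addr_ge0 ?ltW.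
  set d := distribution Q0 w (l + t).
  have d0 : 0 <= d by exact: distribution_ge0.
  rewrite (eq_bigr (fun i : 'I_K => (i%:R < K%:R * d)%R%:R)); last first.
    by move=> i _; rewrite lt_excess// star_gt// ltr_pdivrMr// [d * _]mulrC.
  have [d00|dr] : d = 0 \/ r <= d.
    have [ltW_|Wlt] := ltP (l + t) W; first by right; apply: wr; rewrite lt0.
    left; rewrite /d /distribution (_ : _ `&` _ = set0) ?measure0//.
    apply/seteqP; split => x // [_ /=]; rewrite ltNge => /negP; apply.
    by have /andP[_ /le_trans] := wW x; apply.
  + rewrite d00 mulr0 big1 ?mulr0// => i _.
    by rewrite ltNge ler0n.
  + have := @count_lt_le R K (K%:R * d) (mulr_ge0 (ler0n _ _) d0).
    move=> cnt; rewrite mulrC ler_pdivrMr//; apply: (le_trans cnt).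
    have : 1 <= K%:R * d by rewrite mulrC -ler_pdivrMr// mul1r (le_trans rK).
    by rewrite [2 * d * _]mulrC mulrCA; lra.
have mb : measurable_fun Q0 (step i0 Q0 K (fun i => Num.max 0 (b i - l))).
  exact: measurable_step.
(* One slice of height [T] makes up, at all levels below [T], for the slice lost in sampling [g]. *)
pose h (i : nat) : R := if i == 0%N then T else 0.
have h0 i : (i < K)%N -> 0 <= h i by move=> _; rewrite /h; case: ifP => // _; exact: ltW.
have h0' x : 0 <= step i0 Q0 K h x by rewrite /step /h; case: ifP => // _; exact: ltW.
have mh : measurable_fun Q0 (step i0 Q0 K h) by exact: measurable_step.
have mgT : measurable_fun Q0 (fun x => Num.min (g x) T).
  by apply: measurable_minr => //; exact: measurable_cst.
have pB : (\int[mu]_(x in Q0) (Num.max 0 (Num.min (g x) T - l))%:E <=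
    1%:E * (IB + \int[mu]_(x in Q0) (step i0 Q0 K h x)%:E))%E.
  apply: (@le_integral_distribution2 _ _ _ mu 1 Q0 _ _ _ ler01 mQ0 (measurable_excess l mgT)
    (fun x _ => excess_ge0 _ _) mb (fun x _ => excess_ge0 _ _) mh (fun x _ => h0' x)).
  move=> t t0; rewrite mul1e.
  have lt0 : 0 <= l + t by rewrite addr_ge0 ?ltW.
  rewrite (_ : [set x | t < Num.max 0 (Num.min (g x) T - l)] =
      [set x | l + t < Num.min (g x) T]); last first.
    by apply/seteqP; split => x /=; rewrite lt_excess.
  have [Tlt|ltT] := leP T (l + t).
    rewrite (_ : _ `&` _ = set0) ?measure0 ?adde_ge0//.
    apply/seteqP; split => x // [_ /=]; rewrite lt_min => /andP[_ h1].
    by have := lt_le_trans h1 Tlt; rewrite ltxx.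
  rewrite (_ : _ `&` _ = Q0 `&` [set x | l + t < g x]); last first.
    by apply/seteqP; split => x [Qx /=]; rewrite lt_min ltT andbT.
  rewrite [leLHS](distributionE Q01 _ mg).
  rewrite [X in (_ <= X + _)%E](lebesgue_step i0 Q01 K0 (fun i => t < Num.max 0 (b i - l))).
  rewrite [X in (_ <= _ + X)%E](lebesgue_step i0 Q01 K0 (fun i => t < h i)).
  rewrite -EFinD lee_fin -mulrDr.
  set d := distribution Q0 g (l + t).
  rewrite (eq_bigr (fun i : 'I_K => (i.+1%:R < K%:R * d)%R%:R)); last first.
    by move=> i _; rewrite lt_excess// star_gt// ltr_pdivrMr// [d * _]mulrC.
  have d1 : d <= 1 by exact: distribution_le1.
  have cnt : K%:R * d - 1 <= \sum_(i < K) (i.+1%:R < K%:R * d)%R%:R.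
    by apply: count_lt_ge; rewrite ler_piMr.
  have cnt1 : 1 <= \sum_(i < K) (t < h i)%R%:R :> R.
    rewrite (bigD1 (Ordinal K0))//= {1}/h eqxx.
    have -> : t < T by apply: le_lt_trans ltT; rewrite lerDr ltW.
    by rewrite lerDl; apply: sumr_ge0 => i _; rewrite ler0n.
  rewrite mulrC ler_pdivlMr// mulrC.
  by apply: le_trans (lerD cnt cnt1); rewrite subrK.
have hE : (\int[mu]_(x in Q0) (step i0 Q0 K h x)%:E <= (c / 4)%:E)%E.
  rewrite integral_step// lee_fin; apply: le_trans TK.
  rewrite mulrC (bigD1 (Ordinal K0))//= big1 ?addr0 // => i iK.
  by rewrite /h ifF//; apply/negbTE; apply: contra iK => /eqP i00; apply/eqP/val_inj.
pose G := (\int[mu]_(x in Q0) (Num.max 0 (g x - l))%:E)%E.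
(* The two halves of c / 2 are the part of [g] above [T] and the extra slice [h]. *)
have GB : (G <= IB + (c / 2)%:E)%E.
  apply: (@le_trans _ _ (\int[mu]_(x in Q0) (Num.max 0 (Num.min (g x) T - l))%:E +
      \int[mu]_(x in Q0) (Num.max 0 (g x - T))%:E)%E).
    have mp : measurable_fun Q0 (fun x => (Num.max 0 (Num.min (g x) T - l))%:E).
      by apply/measurable_EFinP; exact: measurable_excess.
    have mq : measurable_fun Q0 (fun x => (Num.max 0 (g x - T))%:E).
      by apply/measurable_EFinP; exact: measurable_excess.
    have ex0 u m x : cube_set Q0 x -> (0 <= (Num.max 0 (u x - m))%:E :> \bar R)%E.
      by rewrite lee_fin excess_ge0.
    rewrite -(ge0_integralD mu mQ0 (ex0 (fun x => Num.min (g x) T) l) mp (ex0 g T) mq).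
    apply: le_integral_nonneg => x _; first by rewrite lee_fin excess_ge0.
    by rewrite -EFinD lee_fin excess_split// ltW.
  rewrite mul1e in pB; apply: (le_trans (leeD pB HT)).
  rewrite -addeA leeD2l//; apply: (le_trans (leeD2r _ hE)).
  by rewrite -EFinD lee_fin; lra.
have cG : (c%:E <= G)%E.
  rewrite -cE; apply: le_integral_nonneg => x _; first by rewrite lee_fin excess_ge0.
  by rewrite lee_fin le_excess// ltW.
(* IA <= G / 2 by the factor 1/4, and c <= G turns G <= IB + c / 2 into G / 2 <= IB. *)
apply: (le_trans IAw); apply: (@le_trans _ _ (2%:E * (4^-1%:E * G))%E).
  by apply: lee_wpmul2l; [rewrite lee_fin|exact: wg].
have IBE : IB = (K%:R^-1 * \sum_(i < K) Num.max 0 (b i - l))%:E.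
  exact: (integral_step i0 Q01 K0 (e0 b)).
move: GB cG; rewrite IBE.
have G0 : (0 <= G)%E by apply: integral_ge0 => x _; rewrite lee_fin excess_ge0.
case: G G0 => [y| |] // _; rewrite -?EFinD -?EFinM ?lee_fin.
by move: (_ * \sum_(i < K) _) => B; lra.
Qed.

End ri_norm.

(** * Majorization for bounded functions *)

Section majorization.
Context {R : realType} {n : nat} (i0 : 'I_n) (Q0 : cube R n).
Local Notation mu := (@lebesgue R n).
Hypothesis Q01 : mu Q0 = 1%E.
Context (X : set (Rn R n -> R)) (N : (Rn R n -> R) -> R) (ri : ri_space Q0 X N).
Implicit Types f g w : Rn R n -> R.

Let bfs := ri_bfs ri.
Let mQ0 := measurable_cube Q0.

(** The Hardy-Littlewood-Polya relation expressed through excesses and strengthened by the factor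
    1/4. *)
Definition majorized w g := forall l, 0 < l ->
  (\int[mu]_(x in Q0) (Num.max 0 (w x - l))%:E <=
    4^-1%:E * \int[mu]_(x in Q0) (Num.max 0 (g x - l))%:E)%E.

Lemma majorizedS w w' g : (forall x, w' x <= w x) -> majorized w g -> majorized w' g.
Proof.
move=> ww' wg l l0; apply: le_trans (wg l l0).
apply: le_integral_nonneg => x _; first by rewrite lee_fin excess_ge0.
by rewrite lee_fin le_excess.
Qed.

Let ri_bounded : exists2 C, 0 < C & forall f M, measurable_fun Q0 f -> 0 <= M ->
  {ae mu, forall x, cube_set Q0 x -> `|f x| <= M} -> X f /\ N f <= C * M.
Proof.
have [C HC] := ri_Linfty_sub ri; exists (`|C| + 1); first by rewrite ltr_wpDl.
move=> f M mf M0 fM; have [Xf Nf] := HC f M mf M0 fM; split => //.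
apply: (le_trans Nf); apply: ler_wpM2r => //.
by have := ler_norm C; lra.
Qed.

(** Truncation at [W], a distance [d] below the essential supremum of [w], changes the norm by at
    most C d = e. All superlevel sets of the truncated function below [W] contain {w > W}, which has
    positive measure, as [majorized_truncated] requires. *)
Lemma ri_majorized_bounded w g M : measurable_fun Q0 w -> (forall x, 0 <= w x <= M) ->
  X g -> (forall x, 0 <= g x) -> majorized w g -> X w /\ N w <= N g.
Proof.
move=> mw wM Xg g0 wg.
have mg := bfs_measurable bfs Xg.
have w0 x : 0 <= w x by have /andP[] := wM x.
have [C C0 HC] := ri_bounded.
have [D HD] := ri_sub_L1 ri; have [L1g _] := HD g Xg.
have Xw : X w.
  have M0 : 0 <= M by have /andP[/le_trans h /h] := wM (nseq_tuple n 0).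
  apply: (HC w M mw M0 _).1; apply: aeW => x _.
  by rewrite ger0_norm//; have /andP[] := wM x.
split => //.
apply/ler_addgt0Pr => e e0.
pose d := e / C.
have d0 : 0 < d by rewrite divr_gt0.
have Cd : C * d = e by rewrite mulrC divfK// gt_eqF.
have dom0 : exists2 a, 0 <= a & distribution Q0 w a <= 0.
  exists (Num.max 0 M); first by rewrite le_max lexx.
  rewrite -lee_fin -distributionE// (_ : _ `&` _ = set0) ?measure0 ?lee_fin//.
  apply/seteqP; split => x // [_ /=]; rewrite ltNge => /negP; apply.
  by have /andP[_ /le_trans] := wM x; apply; rewrite le_max lexx orbT.
(* The essential supremum of [w]. *)
pose E := star Q0 w 0.
have EP a : 0 <= a -> (a < E) = (0 < distribution Q0 w a).
  by move=> a0; exact: star_gt.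
have ae_le a : 0 <= a -> E <= a -> {ae mu, forall x, cube_set Q0 x -> w x <= a}.
  move=> a0 Ea; exists (Q0 `&` [set x | a < w x]); split.
  - exact: measurable_superlevel.
  - rewrite [LHS](distributionE Q01 _ mw); congr EFin; apply/eqP.
    by rewrite eq_le distribution_ge0 andbT leNgt -EP// -leNgt.
  - by move=> x /= /not_implyP[Qx /negP]; rewrite -ltNge.
have [Ed|dE] := leP E d.
  have [_ Nw] : X w /\ N w <= C * d.
    apply: HC => //; first exact: ltW.
    by apply: filterS (ae_le d (ltW d0) Ed) => x h Qx; rewrite ger0_norm//; exact: h.
  by rewrite -Cd; apply: (le_trans Nw); rewrite lerDr (bfs_norm_ge0 bfs Xg).
pose W := E - d.
have W0 : 0 < W by rewrite subr_gt0.
have WE : W < E by rewrite ltrBlDr ltrDl.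
pose w' x := Num.min (w x) W.
have w'W x : 0 <= w' x <= W by rewrite le_min w0 ltW//= ge_min lexx orbT.
have mw' : measurable_fun Q0 w'.
  by apply: measurable_minr => //; exact: measurable_cst.
have w'w x : w' x <= w x by rewrite ge_min lexx.
have [Xw' _] : X w' /\ N w' <= C * W.
  by apply: HC => //; [exact: ltW|apply: aeW => x _; have /andP[? ?] := w'W x; rewrite ger0_norm].
have Xd : X (w \- w') /\ N (w \- w') <= C * d.
  apply: HC; [by apply: measurable_funB|exact: ltW|].
  have E0 : 0 <= E by exact: star_ge0.
  apply: filterS (ae_le E E0 (lexx E)) => x h Qx; have wE := h Qx.
  rewrite /= ger0_norm ?subr_ge0// /w' /W; have [_|_] := leP (w x) (E - d); lra.
have Nw : N w <= N w' + C * d.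
  rewrite (_ : w = w' \+ (w \- w')); last by apply/funext => x /=; lra.
  apply: (le_trans (bfs_norm_add bfs Xw' Xd.1)); rewrite lerD2l.
  exact: Xd.2.
rewrite -Cd; apply: (le_trans Nw); rewrite lerD2r.
have [b Wb wb] := distribution_rcont Q01 mw (etrans (esym (EP _ (ltW W0))) WE).
have cfin : (\int[mu]_(x in Q0) (Num.max 0 (g x - W))%:E)%E \is a fin_num.
  have := integral_excess_fin L1g (ltW W0).
  by under eq_integral do rewrite ger0_norm//.
(* [w] exceeds some b > W on a set of positive measure, so its excess over [W] has positive
   integral, and by majorization so has that of [g]. *)
have c0 : 0 < fine (\int[mu]_(x in Q0) (Num.max 0 (g x - W))%:E)%E.
  rewrite -lte_fin fineK//.
  have bW : 0 < b - W by rewrite subr_gt0.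
  have h : ((4 * (b - W))%:E * (distribution Q0 w b)%:E <=
      \int[mu]_(x in Q0) (Num.max 0 (g x - W))%:E)%E.
    have := wg W W0; rewrite -lee_pdivrMl ?invr_gt0// invrK; apply: le_trans.
    rewrite EFinM -muleA; apply: lee_wpmul2l => //.
    have := @chebyshev_superlevel _ _ _ mu Q0 (fun x => Num.max 0 (w x - W)) (b - W) mQ0
      (measurable_excess _ mw) (fun x _ => excess_ge0 _ _) bW.
    apply: le_trans; apply: lee_wpmul2l; first by rewrite lee_fin ltW.
    rewrite -(distributionE Q01 _ mw); apply: le_measure; rewrite ?inE.
    - exact: measurable_superlevel.
    - exact: (measurable_superlevel _ mQ0 (measurable_excess _ mw)).
    by move=> x [Qx /= bx]; split => //=; rewrite lt_excess// addrC subrK.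
  by apply: lt_le_trans h; rewrite -EFinM lte_fin !mulr_gt0.
apply: (@majorized_truncated _ _ i0 Q0 Q01 X N ri w' g W (distribution Q0 w W)
  (fine (\int[mu]_(x in Q0) (Num.max 0 (g x - W))%:E)%E)) => //.
- by rewrite -EP// ltW.
- move=> a /andP[a0 aW]; apply: le_distribution => // x _ Wx.
  by rewrite /w' lt_min aW andbT (lt_trans aW Wx).
- by rewrite fineK.
- exact: majorizedS wg.
Qed.

End majorization.

(** * Majorization for unbounded functions *)

Section majorization_unbounded.
Context {R : realType} {n : nat} (i0 : 'I_n) (Q0 : cube R n).
Local Notation mu := (@lebesgue R n).
Hypothesis Q01 : mu Q0 = 1%E.
Context (X : set (Rn R n -> R)) (N : (Rn R n -> R) -> R) (ri : ri_space Q0 X N).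
Implicit Types f g w : Rn R n -> R.

Let bfs := ri_bfs ri.
Let mQ0 := measurable_cube Q0.

Lemma ext_norm_EFin f : X f -> ext_norm Q0 X N (EFin \o f) = (N f)%:E.
Proof.
move=> Xf; rewrite /ext_norm ifT//; apply/asboolP; split; last exact: Xf.
by apply: aeW => x _.
Qed.

Lemma ext_norm_lty (g : Rn R n -> \bar R) (y : R) : (ext_norm Q0 X N g <= y%:E)%E ->
  X (fine \o g) /\ N (fine \o g) <= y.
Proof.
rewrite /ext_norm; case: ifPn => [/asboolP[_ Xg]|_]; last by rewrite leye_eq.
by rewrite lee_fin.
Qed.

Lemma bfs_sub f g : X f -> X g -> X (f \- g).
Proof.
move=> Xf Xg; have := bfs_add bfs Xf (bfs_scale bfs (-1) Xg).
by rewrite (_ : _ \+ _ = f \- g)//; apply/funext => x /=; rewrite mulN1r.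
Qed.

Lemma bfs_distC f g : X f -> X g -> N (f \- g) = N (g \- f).
Proof.
move=> Xf Xg; have := bfs_norm_scale bfs (-1) (bfs_sub Xg Xf).
rewrite normrN1 mul1r => <-; congr N; apply/funext => x /=; lra.
Qed.

Lemma bfs_triangle f g : X f -> X g -> N f <= N (f \- g) + N g.
Proof.
move=> Xf Xg; rewrite {1}(_ : f = (f \- g) \+ g); last by apply/funext => x /=; lra.
by apply: (bfs_norm_add bfs) => //; exact: bfs_sub.
Qed.

Let truncation w (k : nat) x := Num.min (w x) k%:R.

Let measurable_truncation w k : measurable_fun Q0 w -> measurable_fun Q0 (truncation w k).
Proof. by move=> mw; apply: measurable_minr => //; exact: measurable_cst. Qed.

Let truncation_cvg w x : truncation w k x @[k --> \oo] --> w x.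
Proof.
apply: cvg_near_cst; exists (Num.truncn (w x)).+1 => // k /= kw.
by apply/min_idPl; apply: (le_trans (ltW (truncnS_gt _))); rewrite ler_nat.
Qed.

Let ri_truncation w g k : measurable_fun Q0 w -> (forall x, 0 <= w x) ->
  X g -> (forall x, 0 <= g x) -> majorized Q0 w g ->
  X (truncation w k) /\ N (truncation w k) <= N g.
Proof.
move=> mw w0 Xg g0 wg.
apply: (@ri_majorized_bounded _ _ i0 Q0 Q01 X N ri _ _ k%:R).
- exact: measurable_truncation.
- by move=> x; rewrite le_min w0 ler0n ge_min lexx orbT.
- exact: Xg.
- exact: g0.
- by apply: majorizedS wg => x; rewrite ge_min lexx.
Qed.

Let majorized_fatou w g : fatou_property Q0 X N ->
  measurable_fun Q0 w -> (forall x, 0 <= w x) ->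
  X g -> (forall x, 0 <= g x) -> majorized Q0 w g -> X w /\ N w <= N g.
Proof.
move=> fatouX mw w0 Xg g0 wg.
have [||| _ cvgN] := fatouX (truncation w) w.
- by move=> k; exact: measurable_truncation.
- exact: mw.
- apply: aeW => x _; split.
  + by move=> k; rewrite le_min w0 ler0n.
  + apply/nondecreasing_seqP => k; rewrite le_min ge_min lexx/= ge_min ler_nat leqnSn.
    by rewrite orbT.
  + exact: truncation_cvg.
apply: (@ext_norm_lty (EFin \o w)); rewrite -(cvg_lim _ cvgN)//.
apply: lime_le; first by apply/cvg_ex; eexists; exact: cvgN.
apply: nearW => k; have [Xk Nk] := ri_truncation k mw w0 Xg g0 wg.
by rewrite ext_norm_EFin// lee_fin.
Qed.

(** The embedding in L1 turns norm convergence into convergence of integrals, and Fatou's lemma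
    gives int |h - f| = 0. *)
Let norm_limit_ae (u : nat -> Rn R n -> R) f (h : Rn R n -> R) : (forall k, X (u k)) -> X f ->
  measurable_fun Q0 h -> N (u k \- f) @[k --> \oo] --> (0 : R) ->
  (forall x, u k x @[k --> \oo] --> h x) ->
  {ae mu, forall x, cube_set Q0 x -> h x = f x}.
Proof.
move=> Xu Xf mh uf uh.
have [C HC] := ri_sub_L1 ri.
have mf := bfs_measurable bfs Xf.
have mu_ k := bfs_measurable bfs (Xu k).
have muf k : measurable_fun Q0 (fun x => `|u k x - f x|%:E).
  apply/measurable_EFinP; apply: (measurableT_comp (@normr_measurable R setT)).
  exact: measurable_funB (mu_ k) mf.
have mhf : measurable_fun Q0 (fun x => (h x - f x)%:E).
  by apply/measurable_EFinP; exact: measurable_funB mh mf.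
have I0 : (\int[mu]_(x in Q0) `|(h x - f x)%:E| = 0)%E.
  apply/eqP; rewrite eq_le integral_ge0 ?andbT//.
  have := fatou mu mQ0 muf (fun k x _ => normr_ge0 _ : (0 <= `|u k x - f x|%:E)%E).
  rewrite (eq_integral (fun x => `|(h x - f x)%:E|)%E); last first.
    move=> x _; suff /cvg_limn_einf_sup[-> _] :
        `|u k x - f x|%:E @[k --> \oo] --> `|h x - f x|%:E by [].
    apply: cvg_EFin; first exact: nearW.
    by apply: cvg_norm; apply: cvgB; [exact: uh|exact: cvg_cst].
  move=> /le_trans; apply.
  suff /cvg_limn_einf_sup[-> _] :
    (\int[mu]_(x in Q0) `|u k x - f x|%:E)%E @[k --> \oo] --> (0%E : \bar R) by [].
  apply: (@squeeze_cvge _ _ _ _ (fun=> 0%E) _ (fun k => (C * N (u k \- f))%:E)).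
  - apply: nearW => k; apply/andP; split.
      by apply: integral_ge0 => x _; rewrite lee_fin.
    exact: (HC _ (bfs_sub (Xu k) Xf)).2.
  - exact: cvg_cst.
  - apply: cvg_EFin; first exact: nearW.
    by rewrite -[0](mulr0 C); apply: cvgM uf; exact: cvg_cst.
have := (ae_eq_integral_abs mu mQ0 mhf).1 I0; apply: filterS => x /= + Qx => /(_ Qx).
by move=> [/eqP]; rewrite subr_eq0 => /eqP.
Qed.

Lemma bfs_ae_eq f g : X f -> measurable_fun Q0 g ->
  {ae mu, forall x, cube_set Q0 x -> g x = f x} -> X g /\ N g = N f.
Proof.
move=> Xf mg gf; have mf := bfs_measurable bfs Xf.
have [Xg gf1] : X g /\ N g <= N f.
  by apply: (bfs_ideal bfs mg Xf); apply: filterS gf => x h Qx; rewrite h.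
have [_ gf2] : X f /\ N f <= N g.
  by apply: (bfs_ideal bfs mf Xg); apply: filterS gf => x h Qx; rewrite h.
by split => //; apply/eqP; rewrite eq_le gf1.
Qed.

Let restrict f g (p : R -> bool) x := if p (g x) then f x else 0.

Let measurable_between (a b : R) : measurable [set y : R | a < y <= b].
Proof.
rewrite (_ : [set y | _] = `]a, b]%classic); first exact: measurable_itv.
by apply/seteqP; split => y /=; rewrite in_itv.
Qed.

Let measurable_restrict f g (p : R -> bool) : measurable_fun Q0 f -> measurable_fun Q0 g ->
  measurable [set y | p y] -> measurable_fun Q0 (restrict f g p).
Proof.
move=> mf mg mp.
rewrite (_ : restrict f g p = fun x => f x * (\1_[set y | p y] \o g) x); last first.
  apply/funext => x; rewrite /restrict /= indicE; case: (boolP (p (g x))) => pg.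
    by rewrite mem_set// mulr1.
  by rewrite memNset ?mulr0//=; exact/negP.
by apply: measurable_funM => //; apply: measurableT_comp.
Qed.

Let ri_restrict f g (p : R -> bool) : X f -> measurable_fun Q0 g -> measurable [set y | p y] ->
  X (restrict f g p) /\ N (restrict f g p) <= N f.
Proof.
move=> Xf mg mp; apply: (bfs_ideal bfs _ Xf).
  by apply: measurable_restrict => //; exact: (bfs_measurable bfs Xf).
by apply: aeW => x _; rewrite /restrict; case: ifP; rewrite ?normr0.
Qed.

(* If the truncations of g were not Cauchy, g would have disjoint blocks of norm
   at least e, and a diagonal union of them would be far from every member of a
   dense sequence. *)
Let separable_cauchy g : separable_space X N -> X g -> (forall x, 0 <= g x) ->
  forall e, 0 < e -> exists K : nat, forall j k : nat, (K <= k)%N -> (k <= j)%N ->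
    N (restrict g g (fun y => k%:R < y <= j%:R)) < e.
Proof.
move=> [u [Xu dense]] Xg g0 e e0; apply: contrapT => /forallNP nK.
have mg := bfs_measurable bfs Xg.
have pick (K : nat) : exists jk : nat * nat, [/\ (K <= jk.2)%N, (jk.2 <= jk.1)%N &
    e <= N (restrict g g (fun y => jk.2%:R < y <= jk.1%:R))].
  have /existsNP[j /existsNP[k /not_implyP[Kk /not_implyP[kj /negP]]]] := nK K.
  by rewrite -leNgt => h; exists (j, k).
have [jk Hjk] := choice pick.
(* Each block is chosen to start no lower than the previous one ends. *)
pose m := fix m i := if i is i'.+1 then (jk (m i')).1 else 0%N.
pose lo i := (jk (m i)).2; pose hi i := (jk (m i)).1.
pose B i (y : R) := (lo i)%:R < y <= (hi i)%:R.
have mB i : measurable [set y | B i y] by exact: measurable_between.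
have lohi i : (lo i <= hi i)%N by have [] := Hjk (m i).
have hilo i : (hi i <= lo i.+1)%N by have [] := Hjk (m i.+1).
have hi_le i j : (i < j)%N -> (hi i <= lo j)%N.
  elim: j => // j ih; rewrite ltnS leq_eqVlt => /orP[/eqP ->|ij]; first exact: hilo.
  by apply: (leq_trans (ih ij)); apply: (leq_trans (lohi j)); exact: hilo.
have disj i j y : B i y -> B j y -> i = j.
  move=> /andP[a1 a2] /andP[b1 b2]; have [ij|ij|//] := ltngtP i j.
    have h : (hi i)%:R <= (lo j)%:R :> R by rewrite ler_nat; exact: hi_le.
    by have := le_lt_trans (le_trans a2 h) b1; rewrite ltxx.
  have h : (hi j)%:R <= (lo i)%:R :> R by rewrite ler_nat; exact: hi_le.
  by have := le_lt_trans (le_trans b2 h) a1; rewrite ltxx.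
have eB i : e <= N (restrict g g (B i)) by have [] := Hjk (m i).
(* The diagonal choice: block [i] is kept exactly when [u i] has norm less than e / 2 on it. Either
   way the union differs from [u k] on block [k] by at least e / 2 in norm. *)
pose A := [set i | N (restrict (u i) g (B i)) < e / 2].
pose p (y : R) : bool := `[< exists2 i, A i & B i y >].
have mp : measurable [set y | p y].
  rewrite (_ : [set y | p y] = \bigcup_(i in A) [set y | B i y]).
    by apply: bigcup_measurable.
  by apply/seteqP; split => y /=; [move=> /asboolP|move=> ?; apply/asboolP].
have [Xy _] := ri_restrict Xg mg mp.
have [k kdense] := dense _ Xy (e / 2) (divr_gt0 e0 (ltr0n _ 2)).
have Xd := bfs_sub Xy (Xu k).
have [Xr Nr] := ri_restrict Xd mg (mB k).
have Nr2 := le_lt_trans Nr kdense.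
have [Xuk _] := ri_restrict (Xu k) mg (mB k).
have [Xgk _] := ri_restrict Xg mg (mB k).
have [Ak|nAk] := pselect (A k).
  have E : restrict (restrict g g p \- u k) g (B k) =
      restrict g g (B k) \- restrict (u k) g (B k).
    apply/funext => x; rewrite /restrict /=; case: ifP => Bx; last by rewrite subrr.
    by rewrite ifT//; apply/asboolP; exists k.
  have := bfs_triangle Xgk Xuk; rewrite -E; have := eB k; move: Ak; rewrite /A/=.
  by move: Nr2; lra.
have E : restrict (restrict g g p \- u k) g (B k) =
    (fun x => -1 * restrict (u k) g (B k) x).
  apply/funext => x; rewrite /restrict /=; case: ifP => Bx; last by rewrite mulr0.
  rewrite ifF ?sub0r ?mulN1r//; apply/asboolP => -[i Ai Bi].
  by apply: nAk; rewrite -(disj _ _ _ Bi Bx).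
apply: nAk; rewrite /A/=; move: Nr2.
by rewrite E (bfs_norm_scale bfs _ Xuk) normrN1 mul1r.
Qed.

Let cut g (k : nat) := restrict g g (fun y => y <= k%:R).

Let tail g (k : nat) := restrict g g (fun y => k%:R < y).

Let measurable_le (a : R) : measurable [set y : R | y <= a].
Proof.
rewrite (_ : [set y | _] = `]-oo, a]%classic); first exact: measurable_itv.
by apply/seteqP; split => y /=; rewrite in_itv.
Qed.

Let measurable_gt (a : R) : measurable [set y : R | a < y].
Proof.
rewrite (_ : [set y | _] = `]a, +oo[%classic); first exact: measurable_itv.
by apply/seteqP; split => y /=; rewrite in_itv/= andbT.
Qed.

(** The functions [cut g k] are Cauchy by [separable_cauchy]; completeness gives a limit,
    [norm_limit_ae] identifies it with [g], and the tail is the difference. *)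
Let separable_tail g : separable_space X N -> X g -> (forall x, 0 <= g x) ->
  forall e, 0 < e -> exists K : nat, forall k, (K <= k)%N -> N (tail g k) < e.
Proof.
move=> sepX Xg g0 e e0; have mg := bfs_measurable bfs Xg.
have Xcut k : X (cut g k) := (ri_restrict Xg mg (measurable_le _)).1.
have cutB (j k : nat) : (k <= j)%N ->
    cut g j \- cut g k = restrict g g (fun y => k%:R < y <= j%:R).
  move=> kj; apply/funext => x; rewrite /cut /restrict /=.
  have [xk|kx] := leP (g x) k%:R; last by case: leP => _; rewrite subr0.
  by rewrite (le_trans xk) ?ler_nat// subrr.
have [f [Xf cvgf]] : exists f, X f /\ N (cut g k \- f) @[k --> \oo] --> (0 : R).
  apply: (bfs_complete bfs) => // d d0.
  have [K HK] := separable_cauchy sepX Xg g0 d0; exists K => j k Kj Kk.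
  have [kj|jk] := leqP k j; first by rewrite cutB//; exact: HK.
  by rewrite bfs_distC// cutB ?(ltnW jk)//; apply: HK => //; exact: ltnW.
have gf : {ae mu, forall x, cube_set Q0 x -> g x = f x}.
  apply: (norm_limit_ae Xcut Xf mg cvgf) => x; apply: cvg_near_cst.
  exists (Num.truncn (g x)).+1 => // k /= gk; rewrite /cut /restrict ifT//.
  by apply: (le_trans (ltW (truncnS_gt _))); rewrite ler_nat.
move/cvgr0Pnorm_lt : cvgf => /(_ e e0)[K _ HK]; exists K => k Kk.
have tailE : tail g k = g \- cut g k.
  apply/funext => x; rewrite /tail /cut /restrict /=.
  by case: leP => _; rewrite ?subrr ?subr0.
have Xt : X (tail g k) := (ri_restrict Xg mg (measurable_gt _)).1.
have [_ ->] : X (tail g k) /\ N (tail g k) = N (f \- cut g k).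
  apply: bfs_ae_eq; [exact: bfs_sub|exact: (bfs_measurable bfs Xt)|].
  by apply: filterS gf => x h Qx; rewrite tailE /= h.
rewrite bfs_distC//; apply: le_lt_trans (HK k Kk).
exact: ler_norm.
Qed.

(** The difference of the truncations of [w] at k <= j is majorized by the tail of [g] above [k]. So
    the truncations are Cauchy, and their limit is [w] almost everywhere. *)
Let majorized_separable w g : separable_space X N ->
  measurable_fun Q0 w -> (forall x, 0 <= w x) ->
  X g -> (forall x, 0 <= g x) -> majorized Q0 w g -> X w /\ N w <= N g.
Proof.
move=> sepX mw w0 Xg g0 wg; have mg := bfs_measurable bfs Xg.
have Xtr k : X (truncation w k) := (ri_truncation k mw w0 Xg g0 wg).1.
have Ntr k : N (truncation w k) <= N g := (ri_truncation k mw w0 Xg g0 wg).2.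
have cauchy (j k : nat) : (k <= j)%N ->
    N (truncation w j \- truncation w k) <= N (tail g k).
  move=> kj; have Xt : X (tail g k) := (ri_restrict Xg mg (measurable_gt _)).1.
  have dE x : (truncation w j \- truncation w k) x = Num.max 0 (truncation w j x - k%:R).
    rewrite /truncation /=; have kj' : k%:R <= j%:R :> R by rewrite ler_nat.
    have [xk|kx] := leP (w x) k%:R.
      rewrite (min_idPl _) ?(le_trans xk)// subrr; apply/esym/max_idPl; lra.
    have [xj|jx] := leP (w x) j%:R; apply/esym/max_idPr; lra.
  apply: (@ri_majorized_bounded _ _ i0 Q0 Q01 X N ri _ _ j%:R _ _ Xt _ _).2.
  - exact: measurable_funB (measurable_truncation _ mw) (measurable_truncation _ mw).
  - move=> x; rewrite dE excess_ge0/= ge_max ler0n/= /truncation.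
    by rewrite lerBlDr ge_min lerDl ler0n orbT.
  - by move=> x; rewrite /tail /restrict; case: ifP.
  (* The excess over [l] of a function already lowered by [k] is an excess over k + l, and the
     majorization of [w] by [g] is used at that level. *)
  move=> l l0; have kl : 0 < k%:R + l by rewrite ltr_wpDl.
  have exc (x m : R) : Num.max 0 (Num.max 0 (x - k%:R) - l) <= Num.max 0 (x - (k%:R + l)).
    rewrite ge_max excess_ge0/=; have [xk|kx] := leP (x - k%:R) 0.
      by rewrite sub0r (le_trans _ (excess_ge0 _ _))// oppr_le0 ltW.
    by rewrite opprD addrA le_max lexx orbT.
  apply: (@le_trans _ _ (\int[mu]_(x in Q0) (Num.max 0 (w x - (k%:R + l)))%:E)%E).
    apply: le_integral_nonneg => x _; rewrite lee_fin ?excess_ge0// dE.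
    apply: (le_trans (exc _ 0)); apply: le_excess => //.
    by rewrite /truncation ge_min lexx.
  apply: (le_trans (wg _ kl)); apply: lee_wpmul2l; first by rewrite lee_fin invr_ge0.
  apply: le_integral_nonneg => x _; rewrite lee_fin ?excess_ge0//.
  rewrite /tail /restrict; case: ltP => kx; first by rewrite le_excess// lerDr.
  rewrite ge_max excess_ge0 (le_trans _ (excess_ge0 _ _))//; lra.
have [f [Xf cvgf]] : exists f, X f /\ N (truncation w k \- f) @[k --> \oo] --> (0 : R).
  apply: (bfs_complete bfs) => // d d0.
  have [K HK] := separable_tail sepX Xg g0 d0; exists K => j k Kj Kk.
  have [kj|jk] := leqP k j; first exact: le_lt_trans (cauchy _ _ kj) (HK _ Kk).
  by rewrite bfs_distC//; exact: le_lt_trans (cauchy _ _ (ltnW jk)) (HK _ Kj).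
have wf : {ae mu, forall x, cube_set Q0 x -> w x = f x}.
  by apply: (norm_limit_ae Xtr Xf mw cvgf) => x; exact: truncation_cvg.
have [Xw ->] := bfs_ae_eq Xf mw wf; split => //.
apply/ler_addgt0Pr => e e0.
move/cvgr0Pnorm_lt : cvgf => /(_ e e0)[K _ HK].
apply: (le_trans (bfs_triangle Xf (Xtr K))); rewrite addrC; apply: lerD => //.
rewrite bfs_distC//; apply/ltW; apply: le_lt_trans (HK K (leqnn K)).
exact: ler_norm.
Qed.

Lemma ri_majorized w g : measurable_fun Q0 w -> (forall x, 0 <= w x) ->
  X g -> (forall x, 0 <= g x) -> majorized Q0 w g -> X w /\ N w <= N g.
Proof.
have [sepX|fatouX] := ri_separable_or_fatou ri; first exact: majorized_separable.
exact: majorized_fatou.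
Qed.

End majorization_unbounded.

(** * Comparison of the two norms *)

Section garo.
Context {R : realType} {n : nat} (i0 : 'I_n) (Q0 : cube R n).
Local Notation mu := (@lebesgue R n).
Hypothesis Q01 : mu Q0 = 1%E.
Context (X : set (Rn R n -> R)) (N : (Rn R n -> R) -> R) (ri : ri_space Q0 X N).
Variables (s : R) (f : Rn R n -> R).
Hypotheses (s0 : 0 < s) (L1f : L1 Q0 f).

Let bfs := ri_bfs ri.
Let u := sharp_maximal Q0 s f.
Let C : R := 32 * (5 ^+ n * 5 ^+ n) / s.

Let C0 : 0 < C.
Proof. by rewrite divr_gt0// !mulr_gt0// exprn_gt0. Qed.

Lemma sharp_maximal_le_garo : (C^-1%:E * ext_norm Q0 X N u <= garo_norm Q0 X N f)%E.
Proof.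
apply: le_ereal_inf_tmp => _ [g Gg <-].
have [->|] := eqVneq (ext_norm Q0 X N (EFin \o g)) +oo%E; first exact: leey.
rewrite {1}/ext_norm; case: ifPn => [/asboolP[_ Xg] _|]; last by rewrite eqxx.
have {Xg} Xg : X g := Xg.
have mg := bfs_measurable bfs Xg.
have [Xg' Ng'] : X (fun x => `|g x|) /\ N (fun x => `|g x|) <= N g.
  apply: (bfs_ideal bfs _ Xg); first exact: measurableT_comp.
  by apply: aeW => x _; rewrite normr_id.
have mF : measurable_fun Q0 (fine \o u).
  by apply: (measurableT_comp (fine_measurable measurableT)); exact: measurable_sharp_maximal.
(* The absolute value makes [w] nonnegative at every point, as [ri_majorized] asks; on [Q0] it
   changes nothing. *)
pose w x := C^-1 * `|(fine \o u) x|.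
have [Xw Nw] : X w /\ N w <= N (fun x => `|g x|).
  apply: (ri_majorized i0 Q01 ri) => //.
  - apply: measurable_funM; first exact: measurable_cst.
    exact: measurableT_comp.
  - by move=> x; rewrite mulr_ge0// invr_ge0 ltW.
  move=> l l0; apply: le_trans (sharp_maximal_majorized i0 s0 l0 L1f Gg).
  apply: le_integral_nonneg => x Qx; rewrite lee_fin ?excess_ge0//.
  by rewrite /w /= ger0_norm//; apply: fine_ge0; exact: sharp_maximal_ge0.
have [XF NF] : X (fine \o u) /\ N (fine \o u) <= C * N w.
  have -> : C * N w = N (fun x => C * w x).
    by rewrite (bfs_norm_scale bfs C Xw) gtr0_norm.
  apply: (bfs_ideal bfs mF (bfs_scale bfs C Xw)).
  apply: aeW => x _; rewrite /w mulrA divff ?gt_eqF// mul1r normr_id.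
  exact: lexx.
rewrite (ext_norm_EFin Q0 N Xg) /ext_norm ifT; last first.
  by apply/asboolP; split => //; exact: (sharp_maximal_ae_fin i0 s0 L1f Gg).
rewrite -EFinM lee_fin ler_pdivrMl//; apply: (le_trans NF).
by rewrite ler_pM2l// (le_trans Nw).
Qed.

Lemma garo_le_sharp_maximal : s <= (8 * 2 ^+ n)^-1 ->
  (garo_norm Q0 X N f <= 8%:E * ext_norm Q0 X N u)%E.
Proof.
move=> s1; rewrite {1}/ext_norm; case: ifPn => [/asboolP[ufin Xu]|_]; last first.
  by rewrite gt0_muley// leey.
have [K HK] := ri_sub_L1 ri.
have Gu := sharp_maximal_Gamma s1 L1f ufin (HK _ Xu).1.
apply: ereal_inf_le; exists (ext_norm Q0 X N (EFin \o (fun x => 8 * (fine \o u) x))).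
  by exists (fun x => 8 * (fine \o u) x).
rewrite (ext_norm_EFin Q0 N (bfs_scale bfs 8 Xu)) (bfs_norm_scale bfs 8 Xu).
by rewrite ger0_norm.
Qed.

End garo.

Theorem theorem1 (R : realType) (n : nat) (n_gt0 : (0 < n)%N) :
  exists s0 : R, 0 < s0 < 1 /\
  forall s : R, 0 < s < s0 ->
  exists c1 c2 : R, [/\ 0 < c1, 0 < c2 &
  forall (Q0 : cube R n), lebesgue Q0 = 1%E ->
  forall (X : set (Rn R n -> R)) (N : (Rn R n -> R) -> R), ri_space Q0 X N ->
    GaRo Q0 X N =
      [set f | L1 Q0 f /\ (ext_norm Q0 X N (sharp_maximal Q0 s f) < +oo)%E] /\
    forall f, L1 Q0 f ->
      (c1%:E * ext_norm Q0 X N (sharp_maximal Q0 s f) <= garo_norm Q0 X N f /\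
       garo_norm Q0 X N f <= c2%:E * ext_norm Q0 X N (sharp_maximal Q0 s f))%E].
Proof.
exists (8 * 2 ^+ n)^-1; split.
  have p1 : 1 <= 2 ^+ n :> R by rewrite exprn_ege1// ler1n.
  rewrite invr_gt0 mulr_gt0 ?exprn_gt0//= invf_lt1 ?mulr_gt0 ?exprn_gt0//.
  by lra.
move=> s /andP[s_gt0 /ltW s_le]; pose i0 := Ordinal n_gt0.
pose C : R := 32 * (5 ^+ n * 5 ^+ n) / s.
have C0 : 0 < C by rewrite divr_gt0// !mulr_gt0// exprn_gt0.
exists C^-1, 8; split; [by rewrite invr_gt0|by []|move=> Q0 Q01 X N ri].
have lower f (L1f : L1 Q0 f) := sharp_maximal_le_garo i0 Q01 ri s_gt0 L1f.
have upper f (L1f : L1 Q0 f) := garo_le_sharp_maximal ri L1f s_le.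
split; last by move=> f L1f; split; [exact: lower|exact: upper].
apply/seteqP; split => f [L1f fin]; split => //.
  (* An infinite norm of the maximal function would remain infinite after multiplication by the
     positive constant [C^-1]. *)
  have := le_lt_trans (lower f L1f) fin.
  rewrite /ext_norm; case: ifP => _; first by move=> _; rewrite ltry.
  by rewrite gt0_muley ?ltxx// lte_fin invr_gt0.
apply: (le_lt_trans (upper f L1f)); move: fin.
by rewrite /ext_norm; case: ifP => // _ _; rewrite -EFinM ltry.
Qed.
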